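(* With the notation of the context, the following hold. (a) We have $\widetilde N=\widehat N$, except when $m=2$ with $h$ hermitian and non isotropic, in which case $\widetilde N$ is a proper subset of $\widehat N$ of cardinality $2(q^\ell-q^{\ell-1})$. (b) $Top$ admits the following multiplicity free decomposition into irreducible $\mathcal U(V)$-modules: $$Top\cong\bigoplus_{\phi\in\widetilde N}Top(\phi).$$ (c) $Top$ admits the following decomposition into $\mathcal U(V)$-submodules: $$Top\cong\bigoplus_{t\in T\cap\mathcal P}\mathrm{ind}_{G_t}^{\mathcal U(V)}Z_t,$$ where $Z_t$ affords the representation $W_t$ and $\dim Z_t=\sqrt{|U^\perp/U|}$. (d) Let $t\in T\cap\mathcal P$. Then the $\mathcal U(V)$-module $\mathrm{ind}_{G_t}^{\mathcal U(V)}Z_t$ admits the following multiplicity free decomposition into irreducible components: $$\mathrm{ind}_{G_t}^{\mathcal U(V)}Z_t\cong\bigoplus_{\phi\in E_t}Top(\phi),$$ where $E_t$ consists of all $|N/N\cap(1+\mathfrak i)|$ linear characters $\phi:N\to\mathbb C^*$ that extend $\alpha_t|_{N\cap(1+\mathfrak i)}$. (e) Let $\phi\in\widetilde N$. Then there is one and only one $t\in T\cap\mathcal P$ such that the linear character $\alpha_t$ of $\Omega(\mathfrak i)$ enters $Top(\phi)$ (i.e. is a constituent of the restriction of $Top(\phi)$ to $\Omega(\mathfrak i)$). Moreover, the stabilizer of $\alpha_t$ in $\mathcal U(V)$ is $G_tN$, and $$Top(\phi)\cong\mathrm{ind}_{G_tN}^{\mathcal U(V)}Z_t(\phi),$$ where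 $Z_t(\phi)$ is the eigenspace of $Z_t$ for the subgroup $N\cap G_t=N\cap(1+\mathfrak j)$ of $G_t$ corresponding to the linear character $\phi|_{N\cap(1+\mathfrak j)}$ (that is, $Z_t(\phi)=e_\phi Z_t$, where $e_\phi$ is the idempotent of $N\cap(1+\mathfrak j)$ associated to $\phi|_{N\cap(1+\mathfrak j)}$), with $G_t$ acting through $W_t$ and $N$ acting through $\phi$. Moreover, $Z_t(\phi)$ is an irreducible $G_tN$-module of dimension $$\dim Z_t(\phi)=\frac{\sqrt{|U^\perp/U|}}{|N\cap(1+\mathfrak j)/N\cap(1+\mathfrak i)|}.$$
   Context: **Rings.** $\mathcal O$ is a discrete valuation ring with an involution (possibly trivial) and finite residue field of characteristic not 2. $A$ is a quotient of $\mathcal O$ by a nonzero power of its maximal ideal, $*$ is the involution of $A$ inherited from $\mathcal O$, $R=\{a\in A: a^*=a\}$ and $S=\{a\in A: a^*=-a\}$, so $A=R\oplus S$. $A$ is assumed not to be a field. $\mathfrak r=A\pi$ and $\mathfrak m=Rp$ are the maximal ideals of $A$ and $R$, $F_q=R/\mathfrak m$, and $\mathfrak n$ is the minimal nonzero ideal of $A$. Exactly one of the following cases occurs. Symplectic: $*$ is trivial, $A=R$, $\pi=p$. Unramified: $A=R\oplus\theta R$ with $\theta$ a unit of $A$, $\theta^*=-\theta$, $\pi=p$. Ramified: $A=R\oplus\pi R$ with $\pi^*=-\pi$, $\pi^2=p$; this case is called odd (resp. even) if the nilpotency degree of $\pi$ is odd, equal to $2\ell-1$ (resp. even, equal to $2\ell$).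 **Forms and groups.** $V$ is a free $A$-module of finite rank $m>1$. $h:V\times V\to A$ is a nondegenerate form, $A$-linear in the second variable and $*$-semilinear in the first; $h$ is skew hermitian ($h(v,u)=-h(u,v)^*$) in the symplectic, unramified and ramified odd cases, and hermitian ($h(v,u)=h(u,v)^*$) in the ramified even case. $h$ is isotropic if there is a primitive $v\in V$ with $h(v,v)=0$, where primitive means belonging to an $A$-basis of $V$. $\mathcal P=V\setminus\mathfrak rV$ is the set of primitive vectors. $d:A\to R$ is the $R$-linear map which is the projection of $A=R\oplus S$ onto $R$ in the symplectic, unramified and ramified odd cases, and $d(r+s\pi)=s$ ($r,s\in R$) in the ramified even case. $f=d\circ h:V\times V\to R$ is a nondegenerate alternating $R$-bilinear form. $\mathcal U(V)$ is the group of $A$-linear automorphisms of $V$ preserving $h$, and $\mathrm{Sp}(V)$ the group of $R$-linear automorphisms of $V$ preserving $f$. For an ideal $\mathfrak k$ of $A$, $\Omega(\mathfrak k)=\{g\in\mathcal U(V): gv\equiv v \bmod \mathfrak kV \text{ for all }v\in V\}$. $N=\{a\in A^\times: aa^*=1\}$, viewed as a central subgroup of $\mathcal U(V)$ via $a\mapsto a\cdot 1_V$; $\widehat N$ is the group of linear characters $N\to\mathbb C^*$. **Ideals.** $\mathfrak i$ is a fixed nonzero ideal of $A$ with $\mathfrak i^2=(0)$, $\mathfrak j$ is its annihilator in $A$, and $U=\mathfrak iV$, so that $U^\perp=\mathfrak jV$ (with respect to both $h$ and $f$) and $U\subseteq U^\perp$. **Heisenberg group and Weil module.** $H(V)$ is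 $R\times V$ with multiplication $(r,u)(s,v)=(r+s+f(u,v),u+v)$; $\mathrm{Sp}(V)$ acts on it by ${}^g(r,u)=(r,gu)$. $H(U^\perp)$ is the subgroup $R\times U^\perp$. $\lambda:R^+\to\mathbb C^*$ is a fixed linear character that is primitive (its kernel contains no ideal of $R$ other than $(0)$), and $\mu:A^+\to\mathbb C^*$ is $\mu(a)=\lambda(d(a))$. $S':H(U^\perp)\to\mathrm{GL}(Z)$ is the unique (up to isomorphism) irreducible complex representation of $H(U^\perp)$ in which each $(r,u)\in(R,U)$ acts as the scalar $\lambda(r)$. There is a corresponding Weil representation $\mathrm{Sp}(U^\perp)\to\mathrm{GL}(Z)$ ($\mathrm{Sp}(U^\perp)$ being the group of $R$-linear automorphisms of $U^\perp$ preserving $f$), i.e. a representation $W'$ with $W'(g)S'(k)W'(g)^{-1}=S'({}^gk)$ for all $g$ and all $k\in H(U^\perp)$; $W'$ denotes its restriction to the unitary group $\mathcal U(U^\perp)$ of $A$-linear automorphisms of $U^\perp$ preserving $h$. Via restriction $g\mapsto g|_{U^\perp}$, $Z$ is an $H(U^\perp)\rtimes\mathcal U(V)$-module. Put $X=\mathrm{ind}_{H(U^\perp)\rtimes\mathcal U(V)}^{H(V)\rtimes\mathcal U(V)}Z$. Restricted to $H(V)$, $X$ is the unique irreducible module lying over $\lambda$ (the Schrödinger module of type $\lambda$), and restricted to $\mathcal U(V)$ it is called the Weil module of type $\lambda$. $Bot$ is the $\mathcal U(V)$-submodule of $X$ of all fixed points of $(0,\mathfrak nV)$, and $Top=X/Bot$.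 For $\phi\in\widehat N$, $Top(\phi)$ is the $\phi$-eigenspace of $N$ in $Top$. **Orbits.** $T\subseteq V$ is a system of representatives for the $\mathcal U(V)$-orbits of $V/U^\perp$. For $t\in V$, $G_t=\{g\in\mathcal U(V): gt\equiv t\bmod U^\perp\}$, and $Z_t=Z$ as a vector space, affording the representation $W_t:G_t\to\mathrm{GL}(Z_t)$, $W_t(g)=S'(f(gt,t),gt-t)\,W'(g|_{U^\perp})$. The group $\Omega(\mathfrak i)$ acts on $Z_t$ through the linear character $\alpha_t:\Omega(\mathfrak i)\to\mathbb C^*$, $\alpha_t(g)=\lambda(f(gt,t))=\mu(h(gt,t))$. Stabilizers of characters refer to the conjugation action. $\widetilde N$ is the set of all $\phi\in\widehat N$ that extend $\alpha_t|_{N\cap(1+\mathfrak i)}$ for some $t\in T\cap\mathcal P$ (such $t$ is necessarily unique). *)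

(* Defs.v *)
From HB Require Import structures.
From mathcomp Require Import all_boot all_order all_algebra all_fingroup.
From mathcomp Require Import sesquilinear mxrepresentation.

Set Implicit Arguments.
Unset Strict Implicit.
Unset Printing Implicit Defensive.

Import GRing.Theory FinRing.Theory.

Local Open Scope group_scope.
Local Open Scope ring_scope.

(* Left and right.  Products of permutations and matrix representations act   *)
(* on the right in the library: (g * k) v = k (g v), and a representation     *)
(* acts on row vectors.  Every group below (linear automorphisms, Heisenberg  *)
(* group, semidirect product) is therefore the opposite of the group of       *)
(* left operators: the product x * y here is the product y x of left          *)
(* operators.  Left modules become right modules over the opposite group,     *)
(* with the same submodules, quotients, isomorphisms and eigenspaces, and the *)
(* order of the factors in formulas for operators is reversed.  Subgroups,    *)
(* orbits, stabilisers and linear characters are unaffected.                  *)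

Section Ideals.
Variable B : finComNzRingType.
Implicit Types I K : {set B}.

Definition is_ideal I : bool :=
  [&& 0 \in I, [forall x in I, forall y in I, x + y \in I]
    & [forall b, forall x in I, b * x \in I]].

Definition principal (x : B) : {set B} := [set b * x | b : B].

Definition ann I : {set B} := [set a | [forall b in I, a * b == 0]].

Definition maximal_ideal I : bool :=
  maxset (fun K : {set B} => is_ideal K && (1 \notin K)) I.

Definition minimal_ideal I : bool :=
  minset (fun K : {set B} => is_ideal K && (K != [set 0])) I.

Definition quotient_card I : nat := #|[set [set b + x | x in I] | b : B]|.

Definition nilpotency_degree (x : B) (n : nat) : Prop :=
  x ^+ n = 0 /\ forall k, (k < n)%N -> x ^+ k != 0.

Definition direct_sum (P Q : B -> Prop) : Prop :=
  forall a, exists! xy : B * B, [/\ P xy.1, Q xy.2 & a = xy.1 + xy.2].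

End Ideals.

Section FixedRing.
Variables (A : finComUnitRingType) (s : {rmorphism A -> A}).

Definition fixed_by : pred A := fun a => s a == a.

Lemma fixed_by_subring : subring_closed fixed_by.
Proof.
split=> [|a b|a b]; rewrite !unfold_in ?rmorph1 //.
  by move=> /eqP Ea /eqP Eb; rewrite rmorphB Ea Eb.
by move=> /eqP Ea /eqP Eb; rewrite rmorphM Ea Eb.
Qed.

HB.instance Definition _ :=
  GRing.isSubringClosed.Build A fixed_by fixed_by_subring.

Record fixed_ring := FixedRing { fval :> A; _ : fval \in fixed_by }.
HB.instance Definition _ := [isSub for fval].
HB.instance Definition _ := [Finite of fixed_ring by <:].
HB.instance Definition _ := [SubChoice_isSubComNzRing of fixed_ring by <:].

Lemma fixed_ringP (r : fixed_ring) : s (fval r) = fval r.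
Proof. by case: r => a /= /eqP. Qed.

Definition skew (a : A) : Prop := s a = - a.

End FixedRing.

(* A discrete valuation ring with an involution, with its finite residue      *)
(* field of characteristic not 2.                                             *)
Record involutive_dvr := InvolutiveDVR {
  dvr :> idomainType;
  uniformizer : dvr;
  dvr_inv : {rmorphism dvr -> dvr};
  residue_field : finFieldType;
  residue : {rmorphism dvr -> residue_field};
  uniformizer_neq0 : uniformizer != 0;
  uniformizer_nonunit : uniformizer \isn't a GRing.unit;
  uniformizerP : forall x : dvr, x != 0 ->
    exists n : nat, exists2 u, u \is a GRing.unit & x = u * uniformizer ^+ n;
  dvr_invK : involutive dvr_inv;
  residue_surj : forall k, exists x, residue x = k;
  residue_ker : forall x, residue x = 0 <-> exists y, x = y * uniformizer;
  residue_char : 2%N \notin [pchar residue_field] }.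

Arguments uniformizer {i}.
Arguments dvr_inv {i}.
Arguments residue {i}.

(* A = O / (uniformizer ^ e), presented by the projection O -> A. *)
Record dvr_quotient (O : involutive_dvr) := DvrQuotient {
  qring :> finComUnitRingType;
  qproj : {rmorphism O -> qring};
  qexp : nat;
  star : {rmorphism qring -> qring};
  qproj_surj : forall a, exists x, qproj x = a;
  qproj_ker : forall x, qproj x = 0 <-> exists y, x = y * uniformizer ^+ qexp;
  star_proj : forall x, qproj (dvr_inv x) = star (qproj x);
  not_field : exists2 a : qring, a != 0 & a \isn't a GRing.unit }.

Arguments qproj {O d}.
Arguments star {O d}.

(* In the ramified cases the argument is l, the nilpotency degree of pi being *)
(* 2 l - 1 (odd) or 2 l (even).                                               *)
Variant ring_case :=
  | Symplectic
  | Unramified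
  | RamifiedOdd of nat
  | RamifiedEven of nat.

Definition hermitian_case (c : ring_case) : bool :=
  if c is RamifiedEven _ then true else false.

Section CaseSpec.
Variables (A : finComUnitRingType) (s : {rmorphism A -> A}).
Variables (pi : A) (p : fixed_ring s).

Definition fixed_multiples (b x : A) : Prop :=
  exists r : fixed_ring s, x = b * fval r.

Definition ramified : Prop :=
  [/\ direct_sum (fixed_multiples 1) (fixed_multiples pi), s pi = - pi
    & pi ^+ 2 = fval p].

Definition case_spec (c : ring_case) : Prop :=
  match c with
  | Symplectic => (forall a, s a = a) /\ pi = fval p
  | Unramified =>
      (exists theta : A, [/\ theta \is a GRing.unit, s theta = - theta
         & direct_sum (fixed_multiples 1) (fixed_multiples theta)])
      /\ pi = fval p
  | RamifiedOdd l => ramified /\ nilpotency_degree pi (2 * l).-1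
  | RamifiedEven l => ramified /\ nilpotency_degree pi (2 * l)
  end.

Definition projection_spec (c : ring_case) (d : A -> fixed_ring s) : Prop :=
  if hermitian_case c then forall r r' : fixed_ring s, d (fval r + fval r' * pi) = r'
  else forall (r : fixed_ring s) a, skew s a -> d (fval r + a) = r.

End CaseSpec.

Record framed_ring (O : involutive_dvr) := FramedRing {
  fring :> dvr_quotient O;
  piA : fring;
  pR : fixed_ring (@star O fring);
  kind : ring_case;
  dproj : fring -> fixed_ring (@star O fring);
  pi_max : maximal_ideal (principal piA);
  p_max : maximal_ideal (principal pR);
  kindP : case_spec piA pR kind;
  dproj_linear : forall r a b, dproj (fval r * a + b) = r * dproj a + dproj b;
  dprojP : projection_spec piA kind dproj }.

Arguments dproj {O f}.

Record herm_space (O : involutive_dvr) (A : framed_ring O) (m : nat) :=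
  HermSpace {
  hform :> {bilinear 'rV[A]_m -> 'rV[A]_m -> A | (@star O A \; *%R) & *%R};
  hform_sym : forall u v, hform v u =
    if hermitian_case (kind A) then star (hform u v) else - star (hform u v);
  hform_nondeg : forall u, (forall v, hform u v = 0) -> u = 0 }.

Section Modules.
Variables (A : finComUnitRingType) (m : nat).
Local Notation V := 'rV[A]_m.

(* The submodule kV, as the additive subgroup generated by the products. *)
Definition idealV (k : {set A}) : {group V} :=
  <<[set (a *: v)%R | a in k, v in [set: V]]>>%G.

Definition in_basis (v : V) : Prop :=
  exists2 M : 'M[A]_m, M \in unitmx & exists i, row i M = v.

Lemma idealVD k u v : u \in idealV k -> v \in idealV k -> u + v \in idealV k.
Proof. by move=> ku kv; rewrite -zmodMgE groupM. Qed.

Lemma idealVN k u : u \in idealV k -> - u \in idealV k.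
Proof. by move=> ku; rewrite -zmodVgE groupV. Qed.

Lemma idealV0 k : 0 \in idealV k.
Proof. exact: group1. Qed.

Lemma idealV_stable k (g : V -> V) :
    (forall a u v, g (a *: u + v) = a *: g u + g v) ->
  forall u, u \in idealV k -> g u \in idealV k.
Proof.
move=> lin.
have g0 : g 0 = 0.
  by apply: (addrI (g 0)); have := lin 1 0 0; rewrite !scale1r !addr0.
have gD u v : g (u + v) = g u + g v by rewrite -[u]scale1r lin !scale1r.
have gM : {in [set: V] &, {morph g : x y / (x * y)%g}} by move=> x y _ _; apply: gD.
pose gm := Morphism gM.
move=> u ku; have : gm u \in (gm @* idealV k)%g by rewrite mem_morphim ?inE.
rewrite morphim_gen ?subsetT //; apply/subsetP; rewrite genS //.
apply/subsetP => _ /morphimP[_ _ /imset2P[a v ka _ ->] ->] /=.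
have -> : g (a *: v) = a *: g v by rewrite -[a *: v]addr0 lin g0 addr0.
by apply/imset2P; exists a (g v); rewrite ?inE.
Qed.

Lemma idealVZ k a u : u \in idealV k -> a *: u \in idealV k.
Proof.
apply: (@idealV_stable k ( *:%R a)) => b v w.
by rewrite scalerDr !scalerA mulrC.
Qed.

End Modules.

Section Unitary.
Variables (O : involutive_dvr) (A : framed_ring O) (m : nat).
Variable h : herm_space A m.
Local Notation V := 'rV[A]_m.
Local Notation R := (fixed_ring (@star O A)).

Definition isotropic : Prop := exists2 v : V, in_basis v & h v v = 0.

Definition primitive_vectors : {set V} := ~: idealV m (principal (piA A)).

Definition fform (u v : V) : R := dproj (h u v).

Lemma dprojD a b : dproj (a + b) = dproj a + dproj b :> R.
Proof. by have := dproj_linear 1 a b; rewrite !mul1r. Qed.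

Lemma fformDl u u' v : fform (u + u') v = fform u v + fform u' v.
Proof. by rewrite /fform linearDl dprojD. Qed.

Lemma fformDr u v v' : fform u (v + v') = fform u v + fform u v'.
Proof. by rewrite /fform linearDr dprojD. Qed.

Lemma fform0l v : fform 0 v = 0.
Proof. by apply: (addrI (fform 0 v)); rewrite -fformDl !addr0. Qed.

Lemma fform0r u : fform u 0 = 0.
Proof. by apply: (addrI (fform u 0)); rewrite -fformDr !addr0. Qed.

Lemma fform_alt v : fform v v = 0.
Proof.
have := hform_sym h v v; have := dprojP A; rewrite /fform /projection_spec.
case: hermitian_case => [dP Hh | dP Hh].
  have Fh : h v v \in fixed_by (@star O A).
    by rewrite unfold_in; apply/eqP.
  by have := dP (FixedRing Fh) 0; rewrite /= mul0r addr0.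
have Sh : skew (@star O A) (h v v) by rewrite /skew {2}Hh opprK.
by have := dP 0 _ Sh; rewrite /= add0r.
Qed.

Lemma fformNr u v : fform u (- v) = - fform u v.
Proof.
by apply: (addrI (fform u v)); rewrite -fformDr !subrr fform0r.
Qed.

Lemma fformNl u v : fform (- u) v = - fform u v.
Proof. by apply: (addrI (fform u v)); rewrite -fformDl !subrr fform0l. Qed.

Lemma fformC u v : fform v u = - fform u v.
Proof.
apply/eqP; rewrite -addr_eq0; have := fform_alt (u + v).
by rewrite fformDl !fformDr !fform_alt add0r addr0 addrC => /eqP.
Qed.

Definition unitary_set : {set {perm V}} :=
  [set g : {perm V} |
    [forall a, forall u, forall v, g (a *: u + v) == a *: g u + g v]
    && [forall u, forall v, h (g u) (g v) == h u v]].

Lemma unitary_setP (g : {perm V}) :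
  reflect ((forall a u v, g (a *: u + v) = a *: g u + g v)
           /\ (forall u v, h (g u) (g v) = h u v)) (g \in unitary_set).
Proof.
rewrite inE; apply: (iffP andP) => [[/forallP l /forallP f]|[l f]].
  split=> [a u v|u v]; last by have /forallP/(_ v)/eqP := f u.
  by have /forallP/(_ u)/forallP/(_ v)/eqP := l a.
split; last by apply/forallP=> u; apply/forallP=> v; apply/eqP.
by apply/forallP=> a; apply/forallP=> u; apply/forallP=> v; apply/eqP.
Qed.

Lemma unitary_group_set : group_set unitary_set.
Proof.
apply/group_setP; split=> [|g k /unitary_setP[lg fg] /unitary_setP[lk fk]].
  by apply/unitary_setP; split=> *; rewrite !perm1.
by apply/unitary_setP; split=> *; rewrite !permM ?lg ?lk ?fk.
Qed.

Definition unitary_group : {group {perm V}} := Group unitary_group_set.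

Lemma unitary_linear g : g \in unitary_group ->
  forall a u v, g (a *: u + v) = a *: g u + g v.
Proof. by case/unitary_setP. Qed.

Lemma unitaryD g u v : g \in unitary_group -> g (u + v) = g u + g v.
Proof. by move=> Ug; rewrite -[u]scale1r unitary_linear // !scale1r. Qed.

Lemma unitary0 g : g \in unitary_group -> g 0 = 0.
Proof. by move=> Ug; apply: (addrI (g 0)); rewrite -unitaryD // !addr0. Qed.

Lemma unitaryB g u v : g \in unitary_group -> g (u - v) = g u - g v.
Proof.
by move=> Ug; apply: (addIr (g v)); rewrite -unitaryD // !subrK.
Qed.

Lemma unitary_fform g u v :
  g \in unitary_group -> fform (g u) (g v) = fform u v.
Proof. by case/unitary_setP=> _ fg; rewrite /fform fg. Qed.

Lemma unitary_idealV k g u : g \in unitary_group ->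
  (g u \in idealV m k) = (u \in idealV m k).
Proof.
move=> Ug; apply/idP/idP; last exact/idealV_stable/unitary_linear.
have Ug' : (g^-1)%g \in unitary_group by rewrite groupV.
by move/(idealV_stable (unitary_linear Ug')); rewrite permK.
Qed.

Lemma unitary_norm k g : g \in unitary_group -> g \in 'N(idealV m k | 'P).
Proof.
move=> Ug; apply/astabsP => u; exact: unitary_idealV.
Qed.

Lemma homothety_inj (a : {unit A}) : injective ( *:%R (val a) : V -> V).
Proof.
move=> u v /(congr1 ( *:%R (val a)^-1)).
by rewrite !scalerA mulVr ?scale1r //; apply: valP.
Qed.

Definition homothety (a : {unit A}) : {perm V} := perm (@homothety_inj a).

Definition unitary_scalars_set : {set {unit A}} :=
  [set a : {unit A} | val a * star (val a) == 1].

Lemma unitary_scalars_group_set : group_set unitary_scalars_set.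
Proof.
apply/group_setP; split=> [|a b]; rewrite !inE ?mul1r ?rmorph1 //.
by move=> /eqP Ea /eqP Eb; rewrite rmorphM mulrACA Ea Eb mulr1.
Qed.

(* The group N. *)
Definition unitary_scalars : {group {unit A}} := Group unitary_scalars_group_set.

(* The intersection of N and 1 + k. *)
Definition unitary_scalars_congr (k : {set A}) : {set {unit A}} :=
  [set a in unitary_scalars | val a - 1 \in k].

Lemma homothety_unitary a : a \in unitary_scalars -> homothety a \in unitary_group.
Proof.
rewrite inE => /eqP Na; apply/unitary_setP; split=> [b u v|u v]; rewrite !permE.
  by rewrite scalerDr !scalerA mulrC.
by rewrite linearZl_LR linearZr_LR /= mulrCA mulrA Na mul1r.
Qed.

Lemma homothetyM : {morph homothety : a b / (a * b)%g}.
Proof. by move=> a b; apply/permP => v; rewrite permM !permE scalerA mulrC. Qed.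

Lemma homothety_cent a g : g \in unitary_group -> commute (homothety a) g.
Proof.
move=> Ug; apply/permP => v; rewrite !permM !permE.
by rewrite -[val a *: v]addr0 unitary_linear // unitary0 // addr0.
Qed.

(* N as a subgroup of U(V). *)
Definition scalar_set : {set {perm V}} := [set homothety a | a in unitary_scalars].

Definition congruence_set (k : {set A}) : {set {perm V}} :=
  [set g in unitary_group | [forall v : V, g v - v \in idealV m k]].

(* G_t, for the submodule kV in place of the orthogonal of U. *)
Definition coset_stab_set (k : {set A}) (t : V) : {set {perm V}} :=
  [set g in unitary_group | g t - t \in idealV m k].

Lemma coset_stab_group_set k t : group_set (coset_stab_set k t).
Proof.
apply/group_setP; split=> [|x y].
  by apply/setIdP; rewrite group1 perm1 subrr idealV0.
move=> /setIdP[Ux Kx] /setIdP[Uy Ky]; apply/setIdP; rewrite groupM //= permM.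
split=> //; rewrite -[y (x t)](subrK (y t)) -unitaryB // -addrA idealVD //.
by rewrite unitary_idealV.
Qed.

Definition coset_stab k t : {group {perm V}} := Group (coset_stab_group_set k t).

(* The group G_t N. *)
Definition coset_stabN_set k t : {set {perm V}} := (coset_stab k t * scalar_set)%g.

Lemma coset_stabN_group_set k t : group_set (coset_stabN_set k t).
Proof.
apply/group_setP; split.
  apply/mulsgP; exists 1%g 1%g; rewrite ?group1 ?mulg1 //.
  apply/imsetP; exists 1%g; rewrite ?group1 //.
  by apply/permP => v; rewrite perm1 permE scale1r.
move=> _ _ /mulsgP[x _ Gx /imsetP[a Na ->] ->] /mulsgP[y _ Gy /imsetP[b Nb ->] ->].
apply/mulsgP; exists (x * y)%g (homothety (a * b)); rewrite ?groupM //.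
  by apply/imsetP; exists (a * b)%g; rewrite ?groupM.
rewrite homothetyM !mulgA; congr (_ * _)%g; rewrite -!mulgA; congr (_ * _)%g.
by apply: homothety_cent; case/setIdP: Gy.
Qed.

Definition coset_stabN k t : {group {perm V}} := Group (coset_stabN_group_set k t).

Lemma coset_stab_sub k t : coset_stab k t \subset unitary_group.
Proof. by apply/subsetP => g /setIdP[]. Qed.

Lemma coset_stabN_sub k t : coset_stabN k t \subset unitary_group.
Proof.
apply/subsetP => _ /mulsgP[x _ Gx /imsetP[a Na ->] ->].
by rewrite groupM ?homothety_unitary //; case/setIdP: Gx.
Qed.

(* T represents the U(V)-orbits of the quotient of V by kV. *)
Definition orbit_representatives (k : {set A}) (T : {set V}) : Prop :=
  forall v : V, exists! t, t \in T /\
    exists2 g, g \in unitary_group & g t - v \in idealV m k.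

(* Sp(U) for an R-submodule U, as permutations of V fixing V \ U pointwise. *)
Definition symplectic_set (U : {set V}) : {set {perm V}} :=
  [set g : {perm V} |
    [&& perm_on U g,
       [forall r : R, forall u in U, forall v in U,
          g (fval r *: u + v) == fval r *: g u + g v]
     & [forall u in U, forall v in U, fform (g u) (g v) == fform u v]]].

Lemma symplectic_setP (U : {set V}) (g : {perm V}) :
  reflect [/\ perm_on U g,
    forall r : R, {in U &, forall u v, g (fval r *: u + v) = fval r *: g u + g v}
    & {in U &, forall u v, fform (g u) (g v) = fform u v}]
  (g \in symplectic_set U).
Proof.
rewrite inE; apply: (iffP and3P) => [[-> /forallP l /forall_inP f]|[-> l f]].
  split=> // [r u v Uu Uv|u v Uu Uv].
    by have /forall_inP/(_ u Uu)/forall_inP/(_ v Uv)/eqP := l r.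
  by have /forall_inP/(_ v Uv)/eqP := f u Uu.
split=> //; last first.
  by apply/forall_inP=> u Uu; apply/forall_inP=> v Uv; rewrite f.
apply/forallP=> r; apply/forall_inP=> u Uu; apply/forall_inP=> v Uv.
by rewrite l.
Qed.

Lemma symplectic_group_set U : group_set (symplectic_set U).
Proof.
apply/group_setP; split=> [|g k].
  apply/symplectic_setP; split=> [|r u v _ _|u v _ _]; rewrite ?perm1 //.
  exact: perm_on1.
case/symplectic_setP=> Ug lg fg /symplectic_setP[Uk lk fk].
apply/symplectic_setP; split=> [|r u v Uu Uv|u v Uu Uv]; rewrite ?permM.
- exact: perm_onM.
- by rewrite lg // lk // perm_closed.
- by rewrite fk ?fg // perm_closed.
Qed.

Definition symplectic_group U : {group {perm V}} :=
  Group (symplectic_group_set U).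

Lemma restr_unitary k g : g \in unitary_group ->
  restr_perm (idealV m k) g \in symplectic_group (idealV m k).
Proof.
move=> Ug; have Ng := unitary_norm k Ug.
apply/symplectic_setP; split=> [|r u v Uu Uv|u v Uu Uv].
- exact: restr_perm_on.
- rewrite !restr_permE //; first exact: unitary_linear.
  exact/idealVD/Uv/idealVZ.
- by rewrite !restr_permE // unitary_fform.
Qed.

End Unitary.

Definition heis (O : involutive_dvr) (A : framed_ring O) (m : nat)
    (h : herm_space A m) : Type :=
  (fixed_ring (@star O A) * 'rV[A]_m)%type.

Section Heisenberg.
Variables (O : involutive_dvr) (A : framed_ring O) (m : nat).
Variable h : herm_space A m.
Local Notation V := 'rV[A]_m.
Local Notation R := (fixed_ring (@star O A)).

HB.instance Definition _ := Finite.copy (heis h) (R * V)%type.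

Definition heis_law (x y : heis h) : heis h :=
  (x.1 + y.1 + fform h x.2 y.2, x.2 + y.2).

(* The opposite of the law [heis_law]: see the remark on left and right. *)
Definition heis_mul (x y : heis h) : heis h := heis_law y x.
Definition heis_one : heis h := (0, 0).
Definition heis_inv (x : heis h) : heis h := (- x.1, - x.2).

Lemma heis_mulA : associative heis_mul.
Proof.
move=> [r u] [s v] [t w]; rewrite /heis_mul /heis_law /=.
rewrite fformDl fformDr; congr pair; last by rewrite addrA.
by rewrite [LHS](AC (4*2) ((1*(2*4*6))*(3*5))).
Qed.

Lemma heis_mul1 : left_id heis_one heis_mul.
Proof. by move=> [r u]; rewrite /heis_mul /heis_law /= fform0r !addr0. Qed.

Lemma heis_mulV : left_inverse heis_one heis_inv heis_mul.
Proof.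
move=> [r u]; rewrite /heis_mul /heis_law /= fformNr fform_alt.
by rewrite !subrr.
Qed.

HB.instance Definition _ :=
  Finite_isGroup.Build (heis h) heis_mulA heis_mul1 heis_mulV.

Lemma heis_mulE (x y : heis h) : (x * y)%g = heis_law y x.
Proof. by []. Qed.

Definition heis_sub_set (U : {set V}) : {set heis h} :=
  [set x : heis h | x.2 \in U].

Lemma heis_sub_group_set (U : {group V}) : group_set (heis_sub_set U).
Proof.
apply/group_setP; split=> [|x y]; rewrite !inE; first exact: group1.
by move=> Ux Uy; rewrite heis_mulE /heis_law /= -zmodMgE groupM.
Qed.

Definition heis_sub (U : {group V}) : {group heis h} :=
  Group (heis_sub_group_set U).

Definition heis_act (x : heis h) (g : {perm V}) : heis h := (x.1, g x.2).

Lemma heis_is_action : is_action (unitary_group h) heis_act.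
Proof.
split=> [g [r u] [s v] [-> /perm_inj ->] //|[r u] g k _ _].
by rewrite /heis_act /= permM.
Qed.

Definition heis_action := Action heis_is_action.

Lemma heis_is_groupAction : is_groupAction [set: heis h] heis_action.
Proof.
move=> g Ug; rewrite inE; apply/andP; split.
  by apply/subsetP=> x _; rewrite inE.
apply/morphicP=> x y _ _; rewrite !actpermE //= /heis_act !heis_mulE /heis_law /=.
by rewrite (unitary_fform _ _ Ug) (unitaryD _ _ Ug).
Qed.

Definition heis_groupAction : groupAction (unitary_group h) [set: heis h] :=
  GroupAction heis_is_groupAction.

(* H(V) >< U(V), an element being the pair of its components. *)
Definition jacobi : finGroupType := sdprod_by heis_groupAction.

(* H(U) >< U(V) for a U(V)-stable U = kV. *)
Definition jacobi_sub_set (k : {set A}) : {set jacobi} :=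
  [set x : sdprod_by heis_groupAction | (pair_of_sd x).2 \in heis_sub (idealV m k)].

Lemma jacobi_sub_group_set k : group_set (jacobi_sub_set k).
Proof.
apply/group_setP; split=> [|x y]; rewrite !inE /=; first exact: group1.
move=> Ux Uy; case: y Uy => [[g y] /= /setXP[Ug _]] Uy.
by rewrite idealVD // (unitary_idealV _ _ Ug).
Qed.

Definition jacobi_sub k : {group jacobi} := Group (jacobi_sub_group_set k).

End Heisenberg.

Section Ind.
Variables (F : fieldType) (gT : finGroupType) (G H : {group gT}).
Variables (n : nat) (rH : mx_representation F H n).
Hypothesis sHG : H \subset G.

Definition coset_rep (i : 'I_#|rcosets H G|) : gT := repr (enum_val i).

Definition ind_mx (g : gT) : 'M[F]_(\sum_(i < #|rcosets H G|) n) :=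
  \mxblock_(i, j)
    (let y := (coset_rep i * g * (coset_rep j)^-1)%g in
     if y \in H then rH y else 0).

Lemma coset_repP i : coset_rep i \in G /\ enum_val i = H :* coset_rep i.
Proof.
rewrite /coset_rep; have /rcosetsP[x Gx ->] := enum_valP i.
case: repr_rcosetP => h Hh.
split; first exact: groupM (subsetP sHG _ Hh) Gx.
by rewrite rcosetM (rcoset_id Hh).
Qed.

Lemma coset_rep_in x i : (x * (coset_rep i)^-1 \in H)%g = (H :* x == enum_val i).
Proof.
by have [_ ->] := coset_repP i; rewrite -mem_rcoset; apply/rcoset_eqP/eqP.
Qed.

Lemma ind_mx_repr : mx_repr G ind_mx.
Proof.
split=> [|g k Gg Gk].
  rewrite /ind_mx -mxdiagZ /mxdiag; apply/eq_mxblockP => i j /=.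
  rewrite mulg1 coset_rep_in; have [_ <-] := coset_repP i.
  rewrite (inj_eq enum_val_inj) conform_mx_id.
  by case: eqVneq => // ->; rewrite mulgV repr_mx1.
rewrite /ind_mx mul_mxblock; apply/eq_mxblockP => i j /=.
have [Gi _] := coset_repP i; have [Gj _] := coset_repP j.
have Cg : H :* (coset_rep i * g) \in rcosets H G by rewrite mem_rcosets mulSGid ?groupM.
pose l := enum_rank_in Cg (H :* (coset_rep i * g)).
have El : enum_val l = H :* (coset_rep i * g) by rewrite enum_rankK_in.
have Hl : (coset_rep i * g * (coset_rep l)^-1)%g \in H by rewrite coset_rep_in El.
rewrite (bigD1 l) //= big1 ?addr0 => [|l' ll']; last first.
  by rewrite coset_rep_in -El (inj_eq enum_val_inj) eq_sym (negPf ll') mul0mx.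
rewrite Hl.
have -> : (coset_rep i * (g * k) * (coset_rep j)^-1 =
  coset_rep i * g * (coset_rep l)^-1 * (coset_rep l * k * (coset_rep j)^-1))%g.
  by rewrite !mulgA mulgKV.
by rewrite groupMl //; case: ifP => Hy; rewrite ?mulmx0 // repr_mxM.
Qed.
Definition ind_repr := MxRepresentation ind_mx_repr.
End Ind.

Section Modules.
Variables (F : fieldType) (gT : finGroupType) (G : {group gT}).
Variables (n : nat) (rG : mx_representation F G n).

(* The vectors on which every e i with i in K acts as the scalar chi i. *)
Definition joint_eigenspace (I : finType) (K : {set I}) (e : I -> gT)
    (chi : I -> F) : 'M[F]_n :=
  (\bigcap_(i in K) eigenspace (rG (e i)) (chi i))%MS.

Lemma joint_eigenspace_module (I : finType) (K : {set I}) e chi :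
    {in K, forall i, e i \in 'C_G(G)} ->
  mxmodule rG (joint_eigenspace K e chi).
Proof.
move=> Ze; apply/mxmoduleP => x Gx; apply/sub_bigcapmxP => i Ki.
have /setIP[Ge /centP Ce] := Ze i Ki.
apply/eigenspaceP; rewrite -mulmxA -repr_mxM // -(Ce x Gx) repr_mxM // mulmxA.
rewrite scalemxAl; congr (_ *m _); apply/eigenspaceP.
exact: bigcapmx_inf Ki (submx_refl _).
Qed.

Lemma rfix_mx_stable (S : {set gT}) x : x \in G -> S \subset G ->
    {in S, forall y, y ^ x^-1 \in S}%g ->
  (rfix_mx rG S *m rG x <= rfix_mx rG S)%MS.
Proof.
move=> Gx sSG SJ; apply/rfix_mxP => y Sy; have Gy := subsetP sSG y Sy.
rewrite -mulmxA -repr_mxM // (conjgCV x) repr_mxM ?groupJ ?groupV // mulmxA.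
by rewrite (rfix_mx_id rG (SJ y Sy)).
Qed.

(* rG is isomorphic to the direct sum of the representations rI i, i in s. *)
Definition is_direct_sum (I : eqType) (s : seq I) (k : I -> nat)
    (rI : forall i, mx_representation F G (k i)) : Prop :=
  exists (W : I -> 'M[F]_n) (modW : forall i, mxmodule rG (W i)),
    [/\ mxdirect (\sum_(i <- s) W i),
        (\sum_(i <- s) W i :=: 1%:M)%MS
      & forall i, i \in s -> mx_rsim (rI i) (submod_repr (modW i))].

Definition is_mult_free_sum (I : eqType) (s : seq I) (k : I -> nat)
    (rI : forall i, mx_representation F G (k i)) : Prop :=
  [/\ is_direct_sum s rI,
      forall i, i \in s -> mx_irreducible (rI i)
    & forall i j, i \in s -> j \in s -> i != j -> ~ mx_rsim (rI i) (rI j)].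

End Modules.

Section Weil.
Variables (C : numClosedFieldType).
Variables (O : involutive_dvr) (A : framed_ring O) (m : nat).
Variable h : herm_space A m.
Variable i : {set A}.
Local Notation V := 'rV[A]_m.
Local Notation R := (fixed_ring (@star O A)).
Local Notation UV := (unitary_group h).

(* ann i is the ideal j, and jV is the orthogonal of U = iV for h and for f. *)
Definition Usub : {group V} := idealV m i.
Definition Uperp : {group V} := idealV m (ann i).

Record weil_data := WeilData {
  lambda : R -> C;
  zdim : nat;
  Srep : mx_representation C (heis_sub h Uperp) zdim;
  Wrep : mx_representation C (symplectic_group h Uperp) zdim;
  lambda0 : lambda 0 = 1;
  lambdaD : forall r s, lambda (r + s) = lambda r * lambda s;
  lambda_primitive : forall K : {set R},
    is_ideal K -> {in K, forall r, lambda r = 1} -> K = [set 0];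
  Srep_irr : mx_irreducible Srep;
  Srep_scalar : forall (r : R) (u : V),
    u \in Usub -> Srep ((r, u) : heis h) = (lambda r)%:M;
  Wrep_intertwines : forall g (r : R) (u : V),
    g \in symplectic_group h Uperp -> u \in Uperp ->
    invmx (Wrep g) *m Srep ((r, u) : heis h) *m Wrep g
      = Srep ((r, g u) : heis h) }.

Variable w : weil_data.

Lemma WrepJ g (x : heis h) : g \in UV -> x.2 \in Uperp ->
  Srep w x *m Wrep w (restr_perm Uperp g)
    = Wrep w (restr_perm Uperp g) *m Srep w (heis_act x g).
Proof.
move=> Ug Ux; have Sg := restr_unitary (ann i) Ug.
have := Wrep_intertwines w x.1 Sg Ux; rewrite restr_permE ?(unitary_norm _ Ug) //.
rewrite /heis_act => <-; rewrite !mulmxA mulmxV ?mul1mx; first by case: (x).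
exact: repr_mx_unit Sg.
Qed.

(* Z as a module over the semidirect product of H(Uperp) by U(V). *)
Definition Zmx (x : jacobi h) : 'M[C]_(zdim w) :=
  Wrep w (restr_perm Uperp (pair_of_sd x).1) *m Srep w (pair_of_sd x).2.

Lemma restrM g k : g \in UV -> k \in UV ->
  Wrep w (restr_perm Uperp (g * k))
   = Wrep w (restr_perm Uperp g) *m Wrep w (restr_perm Uperp k).
Proof.
move=> Ug Uk; rewrite morphM ?(unitary_norm _ Ug) ?(unitary_norm _ Uk) //.
by rewrite repr_mxM // restr_unitary.
Qed.

Lemma Zmx_repr : mx_repr (jacobi_sub h (ann i)) Zmx.
Proof.
split=> [|[[g x] gx] [[k y] ky]].
  by rewrite /Zmx /= morph1 (repr_mx1 (Wrep w)) (repr_mx1 (Srep w)) mulmx1.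
case/setXP: (gx) => /= Ug _; case/setXP: (ky) => /= Uk _.
rewrite !inE /= => Ux Uy; rewrite /Zmx /= restrM // (repr_mxM (Srep w)) ?inE //=.
  by rewrite !mulmxA -!(mulmxA (Wrep w (restr_perm Uperp g))) WrepJ.
by rewrite (unitary_idealV _ _ Uk).
Qed.

Definition Zrep := MxRepresentation Zmx_repr.

Definition Xrep : mx_representation C [set: jacobi h] _ :=
  ind_repr Zrep (subsetT _).

Definition weil_mx (g : {perm V}) := Xrep (sdpair2 (heis_groupAction h) g).

Lemma weil_mx_repr : mx_repr UV weil_mx.
Proof.
split=> [|g k Ug Uk]; rewrite /weil_mx ?morph1 ?repr_mx1 //.
by rewrite morphM // repr_mxM ?inE.
Qed.

Definition weil_repr := MxRepresentation weil_mx_repr.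

Definition Bot (n : {set A}) :=
  rfix_mx Xrep
    [set sdpair1 (heis_groupAction h) ((0, v) : heis h) | v in idealV m n].

Lemma Bot_module n : mxmodule weil_repr (Bot n).
Proof.
apply/mxmoduleP => g Ug; apply: rfix_mx_stable (in_setT _) (subsetT _) _.
move=> _ /imsetP[v nv ->]; have Ug' : (g^-1)%g \in UV by rewrite groupV.
rewrite -(morphV (sdpair2_morphism _)) // -sdpair_act ?in_setT //.
by apply/imsetP; exists ((g^-1)%g v); rewrite ?(unitary_idealV _ _ Ug').
Qed.

Definition Top_repr n := factmod_repr (Bot_module n).

(* The group N as a type; its linear characters are functions on it. *)
Local Notation N := (subg_of (unitary_scalars A)).

Definition linear_character (gT : finGroupType) (phi : {ffun gT -> C}) : Prop :=
  phi 1%g = 1 /\ forall x y : gT, phi (x * y)%g = phi x * phi y.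

Definition scalar_of (a : N) : {perm V} := homothety m (sgval a).

Lemma scalar_of_center a : scalar_of a \in 'C_UV(UV).
Proof.
apply/setIP; split; first exact/homothety_unitary/subgP.
by apply/centP => g Ug; apply: homothety_cent Ug.
Qed.

Definition Top_eigenspace n (phi : {ffun N -> C}) :=
  joint_eigenspace (Top_repr n) [set: N] scalar_of phi.

Lemma Top_eigenspace_module n phi : mxmodule (Top_repr n) (Top_eigenspace n phi).
Proof. by apply: joint_eigenspace_module => a _; apply: scalar_of_center. Qed.

Definition Top_phi n phi := submod_repr (Top_eigenspace_module n phi).

Local Notation Gt := (coset_stab h (ann i)).
Local Notation GtN := (coset_stabN h (ann i)).

Definition alpha (t : V) (g : {perm V}) : C := lambda w (fform h (g t) t).

Definition Wt_mx (t : V) (g : {perm V}) : 'M[C]_(zdim w) :=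
  Wrep w (restr_perm Uperp g)
    *m Srep w ((fform h (g t) t, g t - t) : heis h).

Lemma Wt_mx_repr t : mx_repr (Gt t) (Wt_mx t).
Proof.
split=> [|g k].
  rewrite /Wt_mx perm1 subrr fform_alt morph1 (repr_mx1 (Wrep w)).
  by rewrite (repr_mx1 (Srep w)) mulmx1.
move=> /setIdP[Ug tg] /setIdP[Uk tk]; rewrite /Wt_mx restrM //.
rewrite !mulmxA -!(mulmxA (Wrep w (restr_perm Uperp g))) WrepJ //.
rewrite -!mulmxA -(repr_mxM (Srep w)) ?inE //=; last first.
  by rewrite (unitary_idealV _ _ Uk).
congr (_ *m (_ *m Srep w _)).
rewrite heis_mulE /heis_law /heis_act /= permM (unitaryB _ _ Uk).
rewrite !fformDr !fformDl !fformNr !fformNl fform_alt !(unitary_fform _ _ Uk).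
rewrite (fformC _ (k (g t)) t) (fformC _ (k t) t) (fformC _ (g t) t).
congr pair; last by rewrite [RHS]addrC addrA subrK.
rewrite oppr0 add0r !opprK [RHS](AC (2*(2*1)) (4*(2*3)*(1*5))) /=.
by rewrite !subrr !addr0.
Qed.

Definition Wt_repr t := MxRepresentation (Wt_mx_repr t).

Definition ind_Wt t := ind_repr (Wt_repr t) (coset_stab_sub h (ann i) t).

(* phi belongs to E_t. *)
Definition extends_alpha (t : V) (phi : {ffun N -> C}) : Prop :=
  linear_character phi /\
  forall a : N, sgval a \in unitary_scalars_congr i -> phi a = alpha t (scalar_of a).

Definition primitive_reps (T : {set V}) : {set V} :=
  T :&: primitive_vectors A m.

Definition N_tilde (T : {set V}) (phi : {ffun N -> C}) : Prop :=
  exists2 t, t \in primitive_reps T & extends_alpha t phi.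

Definition Omega (k : {set A}) : {set {perm V}} := congruence_set h k.

(* alpha_t is a constituent of the restriction of rG to Omega(i). *)
Definition alpha_enters t n (rG : mx_representation C UV n) : Prop :=
  exists2 v : 'rV_n, v != 0 &
    forall g, g \in Omega i -> v *m rG g = alpha t g *: v.

Definition alpha_stabilizer t : {set {perm V}} :=
  [set g in UV | [forall x in Omega i, alpha t (x ^ g)%g == alpha t x]].

Definition Zt_eigenspace t (phi : {ffun N -> C}) : 'M[C]_(zdim w) :=
  joint_eigenspace (Wt_repr t)
    [set a : N | sgval a \in unitary_scalars_congr (ann i)] scalar_of phi.

Lemma scalar_of_coset_stab t (a : N) :
  sgval a \in unitary_scalars_congr (ann i) -> scalar_of a \in Gt t.
Proof.
move=> /setIdP[Na ja]; apply/setIdP; split; first exact: homothety_unitary.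
rewrite permE -{2}[t]scale1r -scalerBl mem_gen //.
by apply/imset2P; exists (val (sgval a) - 1) t; rewrite ?in_setT.
Qed.

Lemma Zt_eigenspace_module t phi : mxmodule (Wt_repr t) (Zt_eigenspace t phi).
Proof.
apply: joint_eigenspace_module => a; rewrite inE => ja.
apply/setIP; split; first exact: scalar_of_coset_stab.
by apply/centP => g /setIdP[Ug _]; apply: homothety_cent Ug.
Qed.

Definition Zt_phi t phi := submod_repr (Zt_eigenspace_module t phi).

(* rY is the space Z_t(phi) on which G_t acts through W_t and N through phi. *)
Definition Zt_phi_extension t phi
    (rY : mx_representation C (GtN t) (\rank (Zt_eigenspace t phi))) : Prop :=
  (forall g, g \in Gt t -> rY g = Zt_phi t phi g)
  /\ (forall a : N, rY (scalar_of a) = (phi a)%:M).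

Definition ind_GtN t n (rY : mx_representation C (GtN t) n) :=
  ind_repr rY (coset_stabN_sub h (ann i) t).

End Weil.

Definition enumerates (I : eqType) (s : seq I) (P : I -> Prop) : Prop :=
  uniq s /\ forall x, x \in s <-> P x.

(* Main.v *)
Require Import Defs.
From HB Require Import structures.
From mathcomp Require Import all_boot all_order all_algebra all_fingroup.
From mathcomp Require Import sesquilinear mxrepresentation center pgroup.
From mathcomp Require Import zify ring.

Set Implicit Arguments.
Unset Strict Implicit.
Unset Printing Implicit Defensive.

Import GRing.Theory FinRing.Theory Num.Theory.

Local Open Scope group_scope.
Local Open Scope ring_scope.

Section Ideals.
Variable B : finComNzRingType.
Implicit Types I : {set B}.

Lemma is_idealP I :
  reflect [/\ 0 \in I, forall x y, x \in I -> y \in I -> x + y \in I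
             & forall b x, x \in I -> b * x \in I] (is_ideal I).
Proof.
apply: (iffP and3P) => [[I0 /forall_inP ID /forallP IM]|[I0 ID IM]]; split => //.
- by move=> x y Ix Iy; have /forall_inP := ID x Ix; apply.
- by move=> b x Ix; have /forall_inP := IM b; apply.
- by apply/forall_inP => x Ix; apply/forall_inP => y Iy; apply: ID.
- by apply/forallP => b; apply/forall_inP => x Ix; apply: IM.
Qed.

Lemma ideal_zero I : is_ideal I -> 0 \in I. Proof. by case/is_idealP. Qed.

Lemma ideal_add I x y : is_ideal I -> x \in I -> y \in I -> x + y \in I.
Proof. by case/is_idealP => _ ID _; apply: ID. Qed.

Lemma ideal_mull I b x : is_ideal I -> x \in I -> b * x \in I.
Proof. by case/is_idealP => _ _; apply. Qed.

Lemma ideal_mulr I b x : is_ideal I -> x \in I -> x * b \in I.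
Proof. by rewrite mulrC; apply: ideal_mull. Qed.

Lemma ideal_opp I x : is_ideal I -> x \in I -> - x \in I.
Proof. by rewrite -mulN1r; apply: ideal_mull. Qed.

Lemma ideal_sub I x y : is_ideal I -> x \in I -> y \in I -> x - y \in I.
Proof. by move=> iI Ix Iy; rewrite ideal_add ?ideal_opp. Qed.

Lemma ideal_sum I (J : Type) (r : seq J) (P : pred J) (F : J -> B) :
  is_ideal I -> (forall j, P j -> F j \in I) -> \sum_(j <- r | P j) F j \in I.
Proof.
move=> iI FI; apply: (big_ind (fun x => x \in I)) => //; first exact: ideal_zero.
by move=> x y; apply: ideal_add.
Qed.

Lemma principalP (x a : B) : reflect (exists b, a = b * x) (a \in principal x).
Proof. by apply: (iffP imsetP) => [[b _ ->]|[b ->]]; exists b. Qed.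

Lemma principal_ideal (x : B) : is_ideal (principal x).
Proof.
apply/is_idealP; split=> [|a b|b a].
- by apply/principalP; exists 0; rewrite mul0r.
- by move=> /principalP[c ->] /principalP[d ->]; apply/principalP; exists (c + d); rewrite mulrDl.
- by case/principalP => c ->; apply/principalP; exists (b * c); rewrite mulrA.
Qed.

Lemma annP I (a : B) : reflect (forall b, b \in I -> a * b = 0) (a \in ann I).
Proof.
rewrite inE; apply: (iffP forall_inP) => H b /H; first by move/eqP.
by move=> ->.
Qed.

Lemma ann_ideal I : is_ideal (ann I).
Proof.
apply/is_idealP; split=> [|a b /annP Ha /annP Hb|b a /annP Ha]; apply/annP => c Ic.
- by rewrite mul0r.
- by rewrite mulrDl Ha // Hb // addr0.
- by rewrite -mulrA Ha // mulr0.
Qed.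

End Ideals.

Section ChainRing.
Variables (O : involutive_dvr) (A : dvr_quotient O).
Implicit Types (a b x y : A) (I : {set A}).

Definition unif : A := qproj uniformizer.

Lemma unif_factor a : a != 0 ->
  exists k, exists2 u, u \is a GRing.unit & a = u * unif ^+ k.
Proof.
have [x <-] := qproj_surj a => nz.
have xnz : x != 0 by apply: contraNneq nz => ->; rewrite rmorph0.
have [k [u Uu ->]] := uniformizerP xnz.
by exists k, (qproj u); rewrite ?rmorph_unit // rmorphM rmorphXn.
Qed.

Lemma unif_nonunit : unif \isn't a GRing.unit.
Proof.
have [b bnz bU] := not_field A; apply: contra bU => uU.
by have [k [u Uu ->]] := unif_factor bnz; rewrite unitrM Uu unitrX.
Qed.

Lemma unif_nilp : exists k, unif ^+ k == 0.
Proof.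
exists (qexp A); rewrite -rmorphXn; apply/eqP/qproj_ker.
by exists 1; rewrite mul1r.
Qed.

(** The length of the chain of ideals of the ring. *)
Definition len := ex_minn unif_nilp.

Lemma unif_len : unif ^+ len = 0.
Proof. by rewrite /len; case: ex_minnP => k /eqP. Qed.

Lemma unif_exp_eq0 k : (unif ^+ k == 0) = (len <= k)%N.
Proof.
apply/idP/idP => [|lk].
  by rewrite /len; case: ex_minnP => j _ min /min.
by rewrite -(subnK lk) exprD unif_len mulr0.
Qed.

Lemma unit_unif_eq0 u k : u \is a GRing.unit -> (u * unif ^+ k == 0) = (len <= k)%N.
Proof.
move=> Uu; rewrite -unif_exp_eq0; apply/eqP/eqP => [E|->]; last exact: mulr0.
by apply: (mulrI Uu); rewrite mulr0.
Qed.

Lemma len_gt1 : (1 < len)%N.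
Proof.
have [b bnz bU] := not_field A; have [k [u Uu Eb]] := unif_factor bnz.
have k0 : (0 < k)%N by case: k Eb => // Eb; rewrite Eb expr0 mulr1 Uu in bU.
by rewrite (leq_ltn_trans k0) // ltnNge -(unit_unif_eq0 k Uu) -Eb.
Qed.

Lemma nonunitP a : reflect (exists b, a = b * unif) (a \isn't a GRing.unit).
Proof.
apply: (iffP idP) => [aU|[b ->]]; last first.
  by rewrite unitrM negb_and unif_nonunit orbT.
have [->|nz] := eqVneq a 0; first by exists 0; rewrite mul0r.
have [[|k] [u Uu Ea]] := unif_factor nz.
  by rewrite Ea expr0 mulr1 Uu in aU.
by exists (u * unif ^+ k); rewrite Ea exprSr mulrA.
Qed.

Lemma mem_rad a : (a \in principal unif) = (a \isn't a GRing.unit).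
Proof. by apply/principalP/nonunitP. Qed.

Lemma nonunitD a b : a \isn't a GRing.unit -> b \isn't a GRing.unit ->
  a + b \isn't a GRing.unit.
Proof. rewrite -!mem_rad; apply: ideal_add; exact: principal_ideal. Qed.

Lemma unitD_rad a b : b \in principal unif -> (a + b \is a GRing.unit) = (a \is a GRing.unit).
Proof.
move=> rb; apply/idP/idP; apply: contraLR; rewrite -!mem_rad => ra; last first.
  by rewrite -[a](addrK b) ideal_sub ?principal_ideal.
by rewrite ideal_add ?principal_ideal.
Qed.

Lemma ideal_powerP I : is_ideal I ->
  exists2 k, (k <= len)%N & I = principal (unif ^+ k).
Proof.
move=> iI; have ex : exists k, unif ^+ k \in I.
  by exists len; rewrite unif_len ideal_zero.
have [k Ik min] := ex_minnP ex; exists k; first by rewrite min // unif_len ideal_zero.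
apply/setP => a; apply/idP/principalP => [Ia|[b ->]]; last exact: ideal_mull.
have [->|nz] := eqVneq a 0; first by exists 0; rewrite mul0r.
have [j [u Uu Ea]] := unif_factor nz.
have kj : (k <= j)%N.
  by apply: min; rewrite -[_ ^+ _](mulKr Uu) -Ea; apply: ideal_mull.
by exists (u * unif ^+ (j - k)); rewrite -mulrA -exprD subnK.
Qed.

Lemma ann_power k : (k <= len)%N ->
  ann (principal (unif ^+ k)) = principal (unif ^+ (len - k)).
Proof.
move=> kl; apply/setP => a; apply/annP/principalP => [H|[b ->] _ /principalP[c ->]].
  have [->|nz] := eqVneq a 0; first by exists 0; rewrite mul0r.
  have [j [u Uu Ea]] := unif_factor nz.
  have jk : (len - k <= j)%N.
    have pk : unif ^+ k \in principal (unif ^+ k) by apply/principalP; exists 1; rewrite mul1r.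
    have /eqP := H _ pk; rewrite Ea -mulrA -exprD unit_unif_eq0 //.
    by rewrite leq_subLR addnC.
  by exists (u * unif ^+ (j - (len - k))); rewrite -mulrA -exprD subnK.
by rewrite mulrACA -exprD subnK // unif_len mulr0.
Qed.

Lemma annK I : is_ideal I -> ann (ann I) = I.
Proof.
by case/ideal_powerP => k kl ->; rewrite !ann_power ?leq_subr // subKn.
Qed.

Lemma principal_powerS j k : (k <= j)%N ->
  principal (unif ^+ j) \subset principal (unif ^+ k).
Proof.
move=> kj; apply/subsetP => _ /principalP[b ->]; apply/principalP.
by exists (b * unif ^+ (j - k)); rewrite -mulrA -exprD subnK.
Qed.

Lemma principal_power_eq0 k : (principal (unif ^+ k) == [set 0]) = (len <= k)%N.
Proof.
rewrite -unif_exp_eq0; apply/eqP/eqP => [E|->].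
  by apply/set1P; rewrite -E; apply/principalP; exists 1; rewrite mul1r.
apply/setP => a; rewrite inE; apply/principalP/eqP => [[b ->]|->]; first exact: mulr0.
by exists 0; rewrite mul0r.
Qed.

Lemma minimal_idealE n : minimal_ideal n -> n = principal (unif ^+ len.-1).
Proof.
case/minsetP => /andP[in_ nnz] min; symmetry; apply: min.
  rewrite principal_ideal principal_power_eq0 -ltnNge.
  by have := len_gt1; lia.
have [k kl En] := ideal_powerP in_; rewrite En principal_powerS //.
rewrite En principal_power_eq0 -ltnNge in nnz.
by have := len_gt1; lia.
Qed.

Lemma minimal_sub n I : minimal_ideal n -> is_ideal I -> I != [set 0] -> n \subset I.
Proof.
move=> /minimal_idealE -> /ideal_powerP[k _ ->]; rewrite principal_power_eq0 -ltnNge => kl.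
by rewrite principal_powerS //; lia.
Qed.

Lemma ann_minimal n : minimal_ideal n -> ann n = principal unif.
Proof.
have l0 : (0 < len)%N := ltn_trans (ltnSn 0) len_gt1.
by move/minimal_idealE->; rewrite ann_power ?leq_pred // -subn1 subKn // expr1.
Qed.

Lemma maximal_idealE I : maximal_ideal I -> I = principal unif.
Proof.
case/maxsetP => /andP[iI I1] max; symmetry; apply: max.
  by rewrite principal_ideal mem_rad negbK unitr1.
apply/subsetP => a Ia; rewrite mem_rad; apply: contra I1 => Ua.
by rewrite -(mulVr Ua) ideal_mull.
Qed.

Lemma ann_proper I : is_ideal I -> I != [set 0] -> ann I \subset principal unif.
Proof.
move=> /ideal_powerP[k kl ->]; rewrite principal_power_eq0 -ltnNge => lk.
by rewrite ann_power // -[unif in X in _ \subset X]expr1 principal_powerS // subn_gt0.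
Qed.

(** A square-zero ideal that is as large as possible: its annihilator is at
    most one step above it in the chain of ideals. *)
Lemma half_ideal : exists k : {set A},
  [/\ is_ideal k, k != [set 0], {in k &, forall a b, a * b = 0}
    & {in ann k &, forall a b, a * b \in k}].
Proof.
exists (principal (unif ^+ (len - len./2))); have l1 := len_gt1.
have l2 : (0 < len./2)%N by rewrite half_gt0.
have D := odd_double_half len; rewrite -addnn in D.
have oL : (odd len <= 1)%N by case: odd.
have l3 : (len./2 <= len)%N by lia.
split; first exact: principal_ideal.
- by rewrite principal_power_eq0; lia.
- move=> _ _ /principalP[a ->] /principalP[b ->]; rewrite mulrACA -exprD.
  suff /eqP -> : unif ^+ (len - len./2 + (len - len./2)) == 0 by rewrite mulr0.
  by rewrite unif_exp_eq0; lia.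
rewrite ann_power ?leq_subr // subKn // => _ _ /principalP[a ->] /principalP[b ->].
rewrite mulrACA -exprD ideal_mull ?principal_ideal //.
apply: (subsetP (principal_powerS _)) (_ : unif ^+ (len./2 + len./2) \in _); last first.
  by apply/principalP; exists 1; rewrite mul1r.
by lia.
Qed.

Lemma starK : involutive (@star O A).
Proof.
by move=> a; have [x <-] := qproj_surj a; rewrite -!star_proj dvr_invK.
Qed.

Lemma star_unit a : (star a \is a GRing.unit) = (a \is a GRing.unit).
Proof.
apply/idP/idP => [Ua|]; last exact: rmorph_unit.
by rewrite -[a]starK rmorph_unit.
Qed.

Lemma star_ideal I a : is_ideal I -> (star a \in I) = (a \in I).
Proof.
move=> iI; suff S b : b \in I -> star b \in I.
  by apply/idP/idP => /S //; rewrite starK.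
have [k _ ->] := ideal_powerP iI; case/principalP => c ->.
have /nonunitP[d Ed] : star unif \isn't a GRing.unit by rewrite star_unit unif_nonunit.
by apply/principalP; exists (star c * d ^+ k); rewrite rmorphM rmorphXn Ed exprMn mulrA.
Qed.

Lemma two_unit : (2%:R : A) \is a GRing.unit.
Proof.
have two_res : residue (2%:R : O) != 0.
  rewrite rmorph_nat; apply: contra (residue_char O) => /eqP E.
  by rewrite inE E eqxx.
have nz : (2%:R : O) != 0 by apply: contraNneq two_res => ->; rewrite rmorph0.
have [[|k] [u Uu E2]] := uniformizerP nz; last first.
  case/negP: two_res; rewrite E2; apply/eqP/residue_ker.
  by exists (u * uniformizer ^+ k); rewrite exprSr mulrA.
have := rmorph_unit (@qproj O A) Uu.
by rewrite -[u]mulr1 -[1](expr0 uniformizer) -E2 rmorph_nat.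
Qed.

Fact repr_exists a : exists x : O, qproj x == a.
Proof. by have [x <-] := qproj_surj a; exists x. Qed.

Definition residueA a : residue_field O := residue (xchoose (repr_exists a)).

Lemma residueA_proj (x : O) : residueA (qproj x) = residue x.
Proof.
apply/eqP; rewrite -subr_eq0 -rmorphB; apply/eqP/residue_ker.
have /eqP E := xchooseP (repr_exists (qproj x)).
have /qproj_ker[y ->] : qproj (xchoose (repr_exists (qproj x)) - x) = 0 :> A.
  by rewrite rmorphB E subrr.
case e0 : (qexp A) => [|e]; last by exists (y * uniformizer ^+ e); rewrite exprSr mulrA.
have /eqP[] : (1 : A) != 0 by exact: oner_neq0.
by rewrite -(rmorph1 qproj); apply/qproj_ker; exists 1; rewrite e0 mulr1.
Qed.

Fact residueA_zmod : zmod_morphism residueA.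
Proof.
move=> a b; have [x <-] := qproj_surj a; have [y <-] := qproj_surj b.
by rewrite -(rmorphB (@qproj O A)) !residueA_proj rmorphB.
Qed.

Fact residueA_monoid : monoid_morphism residueA.
Proof.
split; first by rewrite -(rmorph1 (@qproj O A)) residueA_proj rmorph1.
move=> a b; have [x <-] := qproj_surj a; have [y <-] := qproj_surj b.
by rewrite -(rmorphM (@qproj O A)) !residueA_proj rmorphM.
Qed.

HB.instance Definition _ := GRing.isZmodMorphism.Build A (residue_field O) residueA residueA_zmod.
HB.instance Definition _ := GRing.isMonoidMorphism.Build A (residue_field O) residueA residueA_monoid.

Lemma residueA_surj k : exists a, residueA a = k.
Proof. by have [x <-] := residue_surj k; exists (qproj x); rewrite residueA_proj. Qed.

Lemma residueA_eq0 a : (residueA a == 0) = (a \in principal unif).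
Proof.
apply/eqP/principalP => [|[b ->]].
  have [x <-] := qproj_surj a; rewrite residueA_proj => /residue_ker[y ->].
  by exists (qproj y); rewrite rmorphM.
rewrite rmorphM .
rewrite [X in _ * X]residueA_proj.
have -> : residue (uniformizer : O) = 0 by apply/residue_ker; exists 1; rewrite mul1r.
by rewrite mulr0.
Qed.

End ChainRing.

Section IdealMultiples.
Variables (O : involutive_dvr) (A : dvr_quotient O) (m : nat).
Local Notation V := 'rV[A]_m.
Implicit Types (k : {set A}) (u v : V).

Lemma idealVP k v : is_ideal k -> reflect (forall j, v 0 j \in k) (v \in idealV m k).
Proof.
move=> ik; apply: (iffP idP) => [|H].
  have gS : group_set [set u : V | [forall j, u 0 j \in k]].
    apply/group_setP; split=> [|x y]; rewrite !inE.
      by apply/forallP => j; rewrite mxE ideal_zero.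
    move=> /forallP Hx /forallP Hy; apply/forallP => j.
    by rewrite zmodMgE mxE ideal_add.
  have : idealV m k \subset Group gS.
    rewrite gen_subG; apply/subsetP => _ /imset2P[a u ka _ ->].
    by rewrite inE; apply/forallP => j; rewrite mxE ideal_mulr.
  by move/subsetP => S /S; rewrite inE => /forallP.
rewrite (row_sum_delta v); apply: (big_ind (fun x => x \in idealV m k)).
- exact: idealV0.
- by move=> x y; apply: idealVD.
- by move=> j _; rewrite mem_gen //; apply/imset2P; exists (v 0 j) (delta_mx 0 j); rewrite ?inE.
Qed.

Lemma idealV_scale k a v : is_ideal k -> a \in k -> a *: v \in idealV m k.
Proof. by move=> ik ka; apply/idealVP => // j; rewrite mxE ideal_mulr. Qed.

Lemma idealVB k u v : u \in idealV m k -> v \in idealV m k -> u - v \in idealV m k.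
Proof. by move=> ku kv; rewrite idealVD ?idealVN. Qed.

Lemma idealVDr k u v : u \in idealV m k -> (v + u \in idealV m k) = (v \in idealV m k).
Proof.
move=> ku; apply/idP/idP => [|kv]; last by rewrite idealVD.
by move=> kvu; rewrite -[v](addrK u) idealVB.
Qed.

Lemma idealVBC k u v : (u - v \in idealV m k) = (v - u \in idealV m k).
Proof. by apply/idP/idP => /idealVN; rewrite opprB. Qed.

Lemma idealVS k (l : {set A}) v : k \subset l -> v \in idealV m k -> v \in idealV m l.
Proof.
move/subsetP => kl; apply/subsetP; apply: genS; apply/subsetP => _ /imset2P[a u ka _ ->].
by apply/imset2P; exists a u; rewrite ?inE ?kl.
Qed.

End IdealMultiples.

Section Form.
Variables (O : involutive_dvr) (A : framed_ring O) (m : nat) (h : herm_space A m).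
Local Notation V := 'rV[A]_m.
Local Notation bar := (@star O A).
Implicit Types (k : {set A}) (u v w x y t : V) (a b c : A).

(** The sign of the form: 1 for hermitian, - 1 for skew hermitian forms. *)
Definition sgn : A := if hermitian_case (kind A) then 1 else - 1.

Lemma sgnK : sgn * sgn = 1.
Proof. by rewrite /sgn; case: ifP; rewrite ?mulr1 // mulrNN mulr1. Qed.

Lemma bar_sgn : bar sgn = sgn.
Proof. by rewrite /sgn; case: ifP; rewrite ?rmorphN rmorph1. Qed.

Lemma barK a : bar (bar a) = a. Proof. exact: starK. Qed.

Lemma hC u v : h v u = sgn * bar (h u v).
Proof. by rewrite hform_sym /sgn; case: ifP; rewrite ?mul1r ?mulN1r. Qed.

Lemma hDl u u' v : h (u + u') v = h u v + h u' v. Proof. exact: linearDl. Qed.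
Lemma hDr u v v' : h u (v + v') = h u v + h u v'. Proof. exact: linearDr. Qed.
Lemma hNl u v : h (- u) v = - h u v. Proof. exact: linearNl. Qed.
Lemma hNr u v : h u (- v) = - h u v. Proof. exact: linearNr. Qed.
Lemma hBl u u' v : h (u - u') v = h u v - h u' v. Proof. exact: linearBl. Qed.
Lemma hBr u v v' : h u (v - v') = h u v - h u v'. Proof. exact: linearBr. Qed.
Lemma h0l v : h 0 v = 0. Proof. exact: linear0l. Qed.
Lemma h0r u : h u 0 = 0. Proof. exact: linear0r. Qed.
Lemma hZl a u v : h (a *: u) v = bar a * h u v. Proof. by rewrite linearZl_LR. Qed.
Lemma hZr a u v : h u (a *: v) = a * h u v. Proof. by rewrite linearZr_LR. Qed.

Lemma hsumr u (I : Type) (r : seq I) (P : pred I) (F : I -> V) :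
  h u (\sum_(i <- r | P i) F i) = \sum_(i <- r | P i) h u (F i).
Proof. exact: (big_morph (h u) (hDr u) (h0r u)). Qed.

Lemma h_nondeg_r v : (forall u, h u v = 0) -> v = 0.
Proof.
move=> H; apply: (hform_nondeg (h:=h)) => u.
by rewrite hC H rmorph0 mulr0.
Qed.

Lemma h_idealVr k u v : is_ideal k -> v \in idealV m k -> h u v \in k.
Proof.
move=> ik /(idealVP _ ik) kv; rewrite (row_sum_delta v) hsumr ideal_sum // => j _.
by rewrite hZr ideal_mulr.
Qed.

Lemma h_idealVl k u v : is_ideal k -> u \in idealV m k -> h u v \in k.
Proof. by move=> ik ku; rewrite hC ideal_mull // star_ideal // h_idealVr. Qed.

Lemma h_idealV_ann k u v : is_ideal k -> u \in idealV m k -> v \in idealV m (ann k) -> h u v = 0.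
Proof.
move=> ik ku /(idealVP _ (ann_ideal _)) kv.
rewrite (row_sum_delta v) hsumr big1 // => j _; rewrite hZr.
by have /annP := kv j; apply; apply: h_idealVl.
Qed.

Lemma h_ann_idealV k u v : is_ideal k -> u \in idealV m (ann k) -> v \in idealV m k -> h u v = 0.
Proof. by move=> ik ku kv; rewrite hC (h_idealV_ann (k:=k)) // rmorph0 mulr0. Qed.

Lemma mem_idealV_form k v : is_ideal k -> (forall u, h u v \in k) -> v \in idealV m k.
Proof.
move=> ik H; apply/idealVP => // j; rewrite -(annK ik); apply/annP => c /annP kc.
suff : c *: v = 0 by move/rowP/(_ j); rewrite !mxE mulrC.
by apply: h_nondeg_r => u; rewrite hZr kc.
Qed.

Lemma primitiveP t : reflect (exists j, t 0 j \is a GRing.unit) (t \in primitive_vectors A m).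
Proof.
rewrite inE (maximal_idealE (pi_max A)).
apply: (iffP idP) => [|[j Uj]].
  move=> H; apply/existsP; apply: contraR H; rewrite negb_exists => /forallP H.
  by apply/idealVP => [|j]; rewrite ?principal_ideal ?mem_rad.
by apply: contraL Uj => /(idealVP _ (principal_ideal _))/(_ j); rewrite mem_rad.
Qed.

Lemma primitive_rad t : (t \in primitive_vectors A m) = (t \notin idealV m (principal (unif A))).
Proof. by rewrite inE (maximal_idealE (pi_max A)). Qed.

Lemma unit_primitive t w : h w t \is a GRing.unit -> t \in primitive_vectors A m.
Proof.
rewrite primitive_rad; apply: contraL => rt.
by rewrite -mem_rad h_idealVr ?principal_ideal.
Qed.

Lemma primitive_dual t : t \in primitive_vectors A m -> exists w, h w t = 1.
Proof.
move=> Pt; have [/existsP[w Uw]|/existsPn nU] := boolP [exists w, h w t \is a GRing.unit].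
  exists ((bar (h w t))^-1 *: w); rewrite hZl rmorphV ?star_unit //= barK mulVr //.
move: Pt; rewrite primitive_rad => /negP[].
apply: mem_idealV_form => [|u]; first exact: principal_ideal.
by rewrite mem_rad nU.
Qed.

Lemma hC1 t w : h w t = 1 -> h t w = sgn.
Proof. by move=> E; rewrite hC E rmorph1 mulr1. Qed.

Lemma primitive_congr k t v : is_ideal k -> k \subset principal (unif A) ->
  t - v \in idealV m k -> (t \in primitive_vectors A m) = (v \in primitive_vectors A m).
Proof.
move=> ik kr tv; rewrite !primitive_rad; congr negb.
by rewrite -{1}[t](subrK v) addrC idealVDr //; apply: idealVS tv.
Qed.

Lemma unitary_primitive g t : g \in unitary_group h ->
  (g t \in primitive_vectors A m) = (t \in primitive_vectors A m).
Proof. by move=> Ug; rewrite !primitive_rad (unitary_idealV _ _ Ug). Qed.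

Lemma unitary_h g u v : g \in unitary_group h -> h (g u) (g v) = h u v.
Proof. by case/unitary_setP => _ ->. Qed.

Lemma unitaryZ g a u : g \in unitary_group h -> g (a *: u) = a *: g u.
Proof. by move=> Ug; rewrite -[a *: u]addr0 (unitary_linear Ug) (unitary0 Ug) // addr0. Qed.

(** The infinitesimal isometry attached to two vectors. *)
Definition inf_isom v w x : V := h w x *: v - (sgn * h v x) *: w.

Lemma inf_isom_linear v w a x y : inf_isom v w (a *: x + y) = a *: inf_isom v w x + inf_isom v w y.
Proof.
rewrite /inf_isom !hDr !hZr !mulrDr !scalerDl scalerBr !scalerA opprD.
rewrite (mulrCA sgn); set p := _ *: v; set q := _ *: w; set r := _ *: v; set s := _ *: w.
by rewrite addrACA.
Qed.

Lemma inf_isomZ v w a x : inf_isom v w (a *: x) = a *: inf_isom v w x.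
Proof. by rewrite /inf_isom !hZr scalerBr !scalerA (mulrCA sgn). Qed.

Lemma inf_isom_skew v w x y : h (inf_isom v w x) y = - h x (inf_isom v w y).
Proof.
rewrite /inf_isom hBl hBr !hZl !hZr (hC v x) (hC w x) rmorphM bar_sgn.
by ring: sgnK.
Qed.

Lemma inf_isom_ideal k v w x : is_ideal k -> v \in idealV m k -> inf_isom v w x \in idealV m k.
Proof.
move=> ik kv; apply: idealVB; first exact: idealVZ.
by apply: idealV_scale => //; apply: ideal_mull => //; apply: h_idealVl.
Qed.

Lemma inf_isom_kill k v w x : is_ideal k -> v \in idealV m k ->
  (forall b, b \in k -> b *: x = 0) -> inf_isom v w x = 0.
Proof.
move=> ik /(idealVP _ ik) kv kx; rewrite /inf_isom.
have -> : h w x *: v = 0.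
  by apply/rowP => j; rewrite !mxE mulrC -hZr kx // h0r.
have -> : h v x = 0.
  rewrite hC (row_sum_delta v) hsumr rmorph_sum /= big1 ?mulr0 // => j _.
  rewrite hZr hC !rmorphM bar_sgn barK mulrCA -hZr kx ?h0r ?mulr0 //.
  by rewrite star_ideal.
by rewrite mulr0 scale0r subr0.
Qed.

(** The Cayley transform of a small infinitesimal isometry [K]: the isometry
    sending [y - K y] to [y + K y]. *)
Lemma cayley k v w : is_ideal k -> {in k & &, forall a b c, a * b * c = 0} ->
    v \in idealV m k ->
  exists2 g, g \in unitary_group h &
    forall x, exists2 y, y - inf_isom v w y = x & g x = y + inf_isom v w y.
Proof.
move=> ik k3 kv; have [K KE] : exists K, K = inf_isom v w by exists (inf_isom v w).
rewrite -KE.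
have KZ a x : K (a *: x) = a *: K x by rewrite KE inf_isomZ.
have KD x y : K (x + y) = K x + K y by have := inf_isom_linear v w 1 x y; rewrite -KE !scale1r.
have kK x : K x \in idealV m k by rewrite KE inf_isom_ideal.
have fix0 c x : x = c *: K x -> x = 0.
  move=> Ex.
  have k2x a b : a \in k -> b \in k -> (a * b) *: x = 0.
    move=> ka kb; rewrite Ex; move: (K x) (kK x) => z /(idealVP _ ik) kz.
    by apply/rowP => j; rewrite !mxE mulrCA k3 ?mulr0.
  have kx b : b \in k -> b *: x = 0.
    move=> kb; rewrite Ex scalerA mulrC -scalerA -KZ KE (inf_isom_kill _ ik) ?scaler0 //.
    by move=> a ka; rewrite scalerA k2x.
  by rewrite Ex KE (inf_isom_kill _ ik) // scaler0.
have inj c : injective (fun x => x + c *: K x).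
  move=> x y /= E; apply/eqP; rewrite -subr_eq0; apply/eqP/(fix0 (- c)).
  have -> : K (x - y) = K x - K y by rewrite -scaleN1r KD KZ scaleN1r.
  rewrite -{1}[x](addrK (c *: K x)) E scaleNr scalerBr opprB.
  by rewrite addrC -addrA addKr.
pose q1 := perm (inj (- 1)); pose q2 := perm (inj 1).
have q1E x : q1 x = x - K x by rewrite permE scaleN1r.
have q2E x : q2 x = x + K x by rewrite permE scale1r.
exists (q1^-1 * q2)%g; last first.
  move=> x; exists ((q1^-1)%g x); first by rewrite -q1E permKV.
  by rewrite permM q2E.
apply/unitary_setP; split=> [a x y|x y]; rewrite !permM.
  rewrite -{1}[x](permKV q1) -{1}[y](permKV q1).
  move: ((q1^-1)%g x) ((q1^-1)%g y) => {}x {}y.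
  have -> : a *: q1 x + q1 y = q1 (a *: x + y).
    by rewrite !q1E KD KZ scalerBr opprD addrACA.
  by rewrite permK !q2E KD KZ scalerDr addrACA.
rewrite -{2}[x](permKV q1) -{2}[y](permKV q1).
move: ((q1^-1)%g x) ((q1^-1)%g y) => {}x {}y.
rewrite !q2E !q1E !hDl !hDr !hNl !hNr KE !inf_isom_skew -KE; ring.
Qed.

End Form.

Section Projection.
Variables (O : involutive_dvr) (A : framed_ring O).
Local Notation bar := (@star O A).
Local Notation R := (fixed_ring bar).
Implicit Types (z : A) (I : {set A}).

Lemma dprojM (r : R) z : dproj (fval r * z) = r * dproj z.
Proof.
have := dproj_linear r z 0; rewrite addr0 => ->.
have := dproj_linear 1 0 (0 : A); rewrite !mul1r addr0.
by move/(canLR (addrK _)); rewrite subrr => <-; rewrite addr0.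
Qed.

Lemma dproj0 : dproj (0 : A) = 0.
Proof. by have := dprojM 0 0; rewrite mulr0 mul0r. Qed.

Lemma dprojN z : dproj (- z) = - dproj z.
Proof. by apply/eqP; rewrite -addr_eq0 -dprojD addNr dproj0. Qed.

Lemma fval0 : fval (0 : R) = 0. Proof. exact: (rmorph0 (val : R -> A)). Qed.
Lemma fvalN (r : R) : fval (- r) = - fval r. Proof. exact: (rmorphN (val : R -> A)). Qed.
Lemma fvalM (r s : R) : fval (r * s) = fval r * fval s. Proof. exact: (rmorphM (val : R -> A)). Qed.
Lemma fvalD (r s : R) : fval (r + s) = fval r + fval s. Proof. exact: (rmorphD (val : R -> A)). Qed.
Lemma fvalX (r : R) j : fval (r ^+ j) = fval r ^+ j. Proof. exact: (rmorphXn (val : R -> A)). Qed.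

Lemma bar_half : bar 2%:R^-1 = 2%:R^-1.
Proof. by rewrite rmorphV ?two_unit // rmorph_nat. Qed.

Lemma half_sum z : z = 2%:R^-1 * (z + z).
Proof. by rewrite -mulr2n -[z *+ 2]mulr_natl mulKr ?two_unit. Qed.

Lemma dproj_skew z : ~~ hermitian_case (kind A) -> fval (dproj z) = 2%:R^-1 * (z + bar z).
Proof.
move=> /negPf nh; have := dprojP A; rewrite /projection_spec nh => dP.
have Fr : 2%:R^-1 * (z + bar z) \in fixed_by bar.
  by apply/eqP; rewrite rmorphM rmorphD barK bar_half addrC.
have Sa : Defs.skew bar (2%:R^-1 * (z - bar z)).
  by rewrite /Defs.skew rmorphM rmorphB barK bar_half -mulrN opprB.
have := dP (FixedRing Fr) _ Sa; rewrite /= -mulrDr.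
have -> : z + bar z + (z - bar z) = z + z by ring.
by rewrite -half_sum => ->.
Qed.

Definition is_ramified : Prop := ramified (piA A) (pR A).

Lemma ramified_decomp : is_ramified ->
  forall z, exists r r' : R, z = fval r + fval r' * piA A.
Proof.
case=> ds _ _ z; have [[x y] [[[r Ex] [r' Ey] Ez] _]] := ds z.
by exists r, r'; rewrite Ez Ex Ey mul1r mulrC.
Qed.

Lemma hermitian_ramified : hermitian_case (kind A) -> is_ramified.
Proof. by have := kindP A; case: (kind A) => //= l []. Qed.

Lemma dproj_herm (r r' : R) : hermitian_case (kind A) -> dproj (fval r + fval r' * piA A) = r'.
Proof. by move=> hA; have := dprojP A; rewrite /projection_spec hA. Qed.

Lemma dproj_bar z : dproj (bar z) = - (dproj (sgn A * z)).
Proof.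
rewrite /sgn; case: ifP => hA.
  have [r [r' Ez]] := ramified_decomp (hermitian_ramified hA) z.
  have [_ Spi _] := hermitian_ramified hA.
  rewrite mul1r {1}Ez rmorphD rmorphM Spi mulrN -mulNr !fixed_ringP -fvalN.
  by rewrite dproj_herm // Ez dproj_herm.
rewrite mulN1r dprojN opprK; apply: val_inj.
by rewrite /= !dproj_skew ?hA // barK addrC.
Qed.

Lemma unif_piA j : (piA A ^+ j == 0) = (len A <= j)%N.
Proof.
have E := maximal_idealE (pi_max A).
have /principalP[b Eb] : piA A \in principal (unif A).
  by rewrite -E; apply/principalP; exists 1; rewrite mul1r.
have /principalP[c Ec] : unif A \in principal (piA A).
  by rewrite E; apply/principalP; exists 1; rewrite mul1r.
rewrite -unif_exp_eq0; apply/eqP/eqP => E0.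
  by rewrite Ec exprMn E0 mulr0.
by rewrite Eb exprMn E0 mulr0.
Qed.

Lemma piA_minimal I : is_ideal I -> I != [set 0] -> piA A ^+ (len A).-1 \in I.
Proof.
move=> /ideal_powerP[j _ ->]; rewrite principal_power_eq0 -ltnNge => jl.
have /principalP[b ->] : piA A \in principal (unif A).
  rewrite -(maximal_idealE (pi_max A)); apply/principalP; exists 1.
  by rewrite mul1r.
rewrite exprMn ideal_mull ?principal_ideal //.
apply: (subsetP (principal_powerS A (_ : j <= (len A).-1)%N)); first lia.
by apply/principalP; exists 1; rewrite mul1r.
Qed.

Lemma nilpotency_len j : nilpotency_degree (piA A) j -> len A = j.
Proof.
case=> /eqP; rewrite unif_piA => lj min; apply/eqP; rewrite eqn_leq lj /=.
by rewrite leqNgt; apply/negP => /min; rewrite unif_piA leqnn.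
Qed.

(** The projection does not vanish on a nonzero ideal. *)
Lemma dproj_ideal I : is_ideal I -> (forall x, x \in I -> dproj x = 0) -> I = [set 0].
Proof.
move=> iI dI; apply/eqP/negPn/negP => nz.
have l1 := len_gt1 A; have l0 : (0 < len A)%N by lia.
have pnz : piA A ^+ (len A).-1 != 0 by rewrite unif_piA; lia.
have pI := piA_minimal iI nz; have dp := dI _ pI.
have skI (r : R) : fval r \in I -> ~~ hermitian_case (kind A) -> fval r = 0.
  move=> Ir nh; have := dproj_skew (fval r) nh.
  by rewrite dI // fval0 fixed_ringP -half_sum.
have := kindP A; case Ek : (kind A) => [||l|l] /=; rewrite ?Ek /= in skI.
- case=> triv _; case/eqP: pnz.
  have Fp : piA A ^+ (len A).-1 \in fixed_by bar by apply/eqP; rewrite triv.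
  exact: (skI (FixedRing Fp)).
- case=> [[theta [Ut St _]] _]; case/eqP: pnz.
  have nh : ~~ hermitian_case (kind A) by rewrite Ek.
  set z := piA A ^+ _ in pI dp *.
  have Sz : bar z = - z.
    have := dproj_skew z nh; rewrite dp fval0 => /esym.
    move/(congr1 ( *%R 2%:R)); rewrite mulr0 mulVKr ?two_unit // addrC => /eqP.
    by rewrite addr_eq0 => /eqP.
  have Fz : theta * z \in fixed_by bar by apply/eqP; rewrite rmorphM St Sz mulrNN.
  apply: (mulrI Ut); rewrite mulr0; apply: (skI (FixedRing Fz)) => //.
  exact: ideal_mull.
- case=> [[_ _ pi2] /nilpotency_len lE]; case/eqP: pnz.
  move: pI; have -> : (len A).-1 = (2 * l.-1)%N by lia.
  by rewrite exprM pi2 -fvalX => pI; apply: skI.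
- case=> [[_ _ pi2] /nilpotency_len lE]; case/eqP: pnz.
  have hA : hermitian_case (kind A) by rewrite Ek.
  have El : (len A).-1 = (2 * l.-1).+1 by lia.
  move: dp; rewrite El exprSr exprM pi2 -fvalX -[_ * _]add0r -fval0 dproj_herm //.
  by move=> ->; rewrite fval0 mul0r addr0.
Qed.

End Projection.

Section Mu.
Variables (C : numClosedFieldType) (O : involutive_dvr) (A : framed_ring O) (m : nat).
Variables (h : herm_space A m) (i : {set A}) (w : weil_data C h i).
Local Notation V := 'rV[A]_m.
Local Notation bar := (@star O A).
Implicit Types (z b : A) (I : {set A}).

(** The additive character of the whole ring. *)
Definition mu z : C := lambda w (dproj z).

Lemma lambda_fform u v : lambda w (fform h u v) = mu (h u v). Proof. by []. Qed.

Lemma mu0 : mu 0 = 1. Proof. by rewrite /mu dproj0 lambda0. Qed.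

Lemma muD z b : mu (z + b) = mu z * mu b.
Proof. by rewrite /mu dprojD lambdaD. Qed.

Lemma mu_neq0 z : mu z != 0.
Proof.
by have := muD z (- z); rewrite subrr mu0 => /esym/eqP; apply: contraTneq => ->; rewrite mul0r eq_sym oner_eq0.
Qed.

Lemma muN z : mu (- z) = (mu z)^-1.
Proof.
by apply: (mulfI (mu_neq0 z)); rewrite -muD subrr mu0 mulfV ?mu_neq0.
Qed.

Lemma mu_bar z : mu (bar z) = mu (- (sgn A * z)).
Proof. by rewrite /mu dproj_bar dprojN. Qed.

Lemma mu_sgn_bar z : mu (sgn A * bar z) = mu (- z).
Proof. by rewrite -{1}(bar_sgn A) -rmorphM mu_bar mulrA sgnK mul1r. Qed.

Lemma mu_sym z : z = sgn A * bar z -> mu z = 1.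
Proof.
move=> Ez; suff H b : b = sgn A * bar b -> mu (b + b) = 1.
  rewrite (half_sum z) mulrDr H // rmorphM bar_half -mulrCA -Ez //.
by move=> Eb; rewrite muD {1}Eb mu_sgn_bar -muD addNr mu0.
Qed.

Lemma mu_form v : mu (h v v) = 1.
Proof. by rewrite /mu -/(fform h v v) fform_alt lambda0. Qed.

(** The pairing [mu (x * b)] is perfect: an ideal in its kernel is annihilated. *)
Lemma mu_ann I b : is_ideal I -> (forall x, x \in I -> mu (x * b) = 1) -> b \in ann I.
Proof.
move=> iI Hb; pose J := [set x * b | x in I].
have iJ : is_ideal J.
  apply/is_idealP; split=> [|x y|c x].
  - by apply/imsetP; exists 0; rewrite ?mul0r ?ideal_zero.
  - move=> /imsetP[x1 I1 ->] /imsetP[x2 I2 ->]; apply/imsetP.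
    by exists (x1 + x2); rewrite ?mulrDl ?ideal_add.
  - by move=> /imsetP[x1 I1 ->]; apply/imsetP; exists (c * x1); rewrite ?mulrA ?ideal_mull.
pose K := [set dproj x | x in J].
have K0 : K = [set 0].
  apply: (lambda_primitive (w := w)) => [|r /imsetP[_ /imsetP[x Ix ->] ->]]; last exact: Hb.
  apply/is_idealP; split=> [|x y|c x].
  - by apply/imsetP; exists 0; rewrite ?dproj0 ?ideal_zero.
  - move=> /imsetP[x1 I1 ->] /imsetP[x2 I2 ->]; apply/imsetP.
    by exists (x1 + x2); rewrite ?dprojD ?ideal_add.
  - by move=> /imsetP[x1 I1 ->]; apply/imsetP; exists (fval c * x1); rewrite ?dprojM ?ideal_mull.
have J0 : J = [set 0].
  by apply: dproj_ideal => // x Jx; apply/set1P; rewrite -K0; apply: imset_f.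
apply/annP => x Ix; rewrite mulrC; apply/set1P; rewrite -J0; exact: imset_f.
Qed.

End Mu.

Section NormOne.
Variables (O : involutive_dvr) (A : framed_ring O).
Local Notation bar := (@star O A).
Local Notation rad := (principal (unif A)).
Implicit Types (a b s x y z : A) (j : {set A}).

Lemma unit1D x : x \in rad -> 1 + x \is a GRing.unit.
Proof. by move=> rx; rewrite unitD_rad // unitr1. Qed.

Lemma unit_rad x y : x - y \in rad -> (x \is a GRing.unit) = (y \is a GRing.unit).
Proof. by move=> r; rewrite -[x](subrK y) addrC unitD_rad. Qed.

Lemma rad_ideal : is_ideal rad. Proof. exact: principal_ideal. Qed.

Lemma norm_one_unit a : a * bar a = 1 ->
  exists2 u : {unit A}, u \in unitary_scalars A & val u = a.
Proof.
move=> Na; have Ua : a \is a GRing.unit by apply/unitrPr; exists (bar a).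
by exists (FinRing.unit A Ua) => //; rewrite inE; apply/eqP.
Qed.

Lemma cayley_scalar s : s \in rad -> bar s = - s ->
  exists2 u : {unit A}, u \in unitary_scalars A & val u = (1 + s) / (1 - s).
Proof.
move=> rs Ss; apply: norm_one_unit.
have Up := unit1D rs; have Um : 1 - s \is a GRing.unit by apply/unit1D/ideal_opp/rs; apply: rad_ideal.
by rewrite rmorphM rmorphV //= rmorphD rmorphB rmorph1 Ss opprK mulrA divrK // divrr.
Qed.

Lemma rad_powerS k y : (0 < k)%N -> y \in principal (unif A ^+ k) -> y \in rad.
Proof. by move=> k0; apply/subsetP; rewrite -[unif A in X in _ \subset X]expr1 principal_powerS. Qed.

Lemma principal_powerM k x y : (0 < k)%N -> x \in principal (unif A ^+ k) ->
  y \in principal (unif A ^+ k) -> x * y \in principal (unif A ^+ k.+1).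
Proof.
move=> k0 /principalP[c ->] /principalP[d ->]; rewrite mulrACA -exprD.
apply: ideal_mull; first exact: principal_ideal.
apply: (subsetP (principal_powerS A (_ : k.+1 <= k + k)%N)); first lia.
by apply/principalP; exists 1; rewrite mul1r.
Qed.

(** Newton iteration for the square root of a symmetric unit near 1. *)
Lemma sqrt_near1 j y : is_ideal j -> j \subset rad -> y \in j -> bar y = y ->
  exists z, [/\ z ^+ 2 = 1 + y, bar z = z & z - 1 \in j].
Proof.
move=> ij jr; have rI := rad_ideal.
suff H n k x : (0 < k)%N -> (len A <= k + n)%N -> x \in principal (unif A ^+ k) ->
    x \in j -> bar x = x -> exists z, [/\ z ^+ 2 = 1 + x, bar z = z & z - 1 \in j].
  move=> jy; apply: (H (len A) 1%N) => //; rewrite ?leq_addl // expr1.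
  exact: (subsetP jr).
elim: n k x => [|n IHn] k x k0 kn kx jx Rx.
  have -> : x = 0.
    by case/principalP: kx => c ->; rewrite addn0 -unif_exp_eq0 in kn; rewrite (eqP kn) mulr0.
  by exists 1; rewrite expr1n addr0 rmorph1 subrr ideal_zero.
pose z0 := 1 + 2%:R^-1 * x.
have Uz0 : z0 \is a GRing.unit by rewrite unit1D // ideal_mull // (subsetP jr).
have Rz0 : bar z0 = z0 by rewrite rmorphD rmorph1 rmorphM bar_half Rx.
pose y' := - ((2%:R^-1 * x) ^+ 2 * z0^-1 ^+ 2).
have h1 : 2%:R^-1 + 2%:R^-1 = 1 :> A by rewrite [RHS](half_sum 1) mulrDr mulr1.
have [|||||z [z2 Rz jz]] := IHn k.+1 y'; first by [].
- by rewrite addSn -addnS.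
- rewrite /y'; apply: ideal_opp; first exact: principal_ideal.
  apply: ideal_mulr; first exact: principal_ideal.
  by rewrite expr2; apply: principal_powerM => //; apply: ideal_mull => //; apply: principal_ideal.
- by rewrite /y' ideal_opp // ideal_mulr // expr2 ideal_mulr // ideal_mull.
- by rewrite /y' rmorphN rmorphM !rmorphXn rmorphV // rmorphM bar_half Rx Rz0.
exists (z0 * z); split; first 1 last.
- by rewrite rmorphM Rz0 Rz.
- have -> : z0 * z - 1 = z0 * (z - 1) + 2%:R^-1 * x by rewrite /z0; ring.
  by rewrite ideal_add // ideal_mull.
rewrite exprMn z2 /y' mulrDr mulr1 mulrN mulrCA -exprMn mulrV // expr1n mulr1 /z0.
have E : 1 + x = 1 + (2%:R^-1 + 2%:R^-1) * x by rewrite h1 mul1r.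
by rewrite E; ring.
Qed.

Lemma norm_one_lift j a : is_ideal j -> j \subset rad -> a * bar a - 1 \in j ->
  exists2 u : {unit A}, u \in unitary_scalars A & val u - a \in j.
Proof.
move=> ij jr ja.
have Sa : bar (a * bar a - 1) = a * bar a - 1 by rewrite rmorphB rmorph1 rmorphM barK mulrC.
have [z [z2 Rz jz]] := sqrt_near1 ij jr ja Sa.
have Uz : z \is a GRing.unit by rewrite (@unit_rad _ 1) ?unitr1 // (subsetP jr).
have [|u Nu Eu] := @norm_one_unit (a / z).
  rewrite rmorphM rmorphV //= Rz mulrACA -invrM // -expr2 z2 addrC subrK.
  by rewrite divrr // -[a * _](subrK 1) addrC -z2 unitrX.
exists u => //; rewrite Eu.
have -> : a / z - a = - (a / z * (z - 1)) by rewrite mulrBr divrK // mulr1 opprB.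
by rewrite ideal_opp // ideal_mull.
Qed.

End NormOne.

Section NormLift.
Variables (O : involutive_dvr) (A : framed_ring O) (m : nat) (h : herm_space A m).
Local Notation V := 'rV[A]_m.
Local Notation bar := (@star O A).
Local Notation rad := (principal (unif A)).
Implicit Types (j : {set A}) (u v w x y t : V) (a b c D : A).

Lemma h_sym v : h v v = sgn A * bar (h v v). Proof. exact: hC. Qed.

(** Newton iteration for prescribing the length of a primitive vector. *)
Lemma length_lift j t D : is_ideal j -> j \subset rad -> t \in primitive_vectors A m ->
    D = sgn A * bar D -> D - h t t \in j ->
  exists2 v, v - t \in idealV m j & h v v = D.
Proof.
move=> ij jr Pt SD jD; have rI := rad_ideal A.
suff H n k x : (0 < k)%N -> (len A <= k + n)%N -> x \in primitive_vectors A m ->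
    D - h x x \in principal (unif A ^+ k) ->
    D - h x x \in j -> exists2 v, v - x \in idealV m j & h v v = D.
  apply: (H (len A) 1%N) => //; rewrite ?leq_addl // expr1.
  exact: (subsetP jr).
elim: n k x => [|n IHn] k x k0 kn Px kx jx.
  exists x; first by rewrite subrr idealV0.
  apply/eqP; rewrite eq_sym -subr_eq0; case/principalP: kx => c ->.
  by rewrite addn0 -unif_exp_eq0 in kn; rewrite (eqP kn) mulr0.
have [w hwx] := primitive_dual h Px; have hxw := hC1 hwx.
pose c := 2%:R^-1 * (D - h x x).
have Sc : c = sgn A * bar c.
  by rewrite rmorphM bar_half rmorphB mulrCA mulrBr -SD -h_sym.
pose y := x + bar c *: w.
have hyy : D - h y y = - (bar c * c * h w w).
  have E : h x x + c + c = D.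
    by rewrite -addrA -mulrDr -half_sum addrC subrK.
  rewrite /y hDl !hDr !hZl !hZr hwx hxw barK mulr1 -E [in LHS]Sc.
  by rewrite -Sc [bar c * sgn A]mulrC -Sc; ring.
have jc : c \in j by rewrite ideal_mull.
have kc : c \in principal (unif A ^+ k) by rewrite ideal_mull // principal_ideal.
have yx : y - x \in idealV m j.
  by rewrite /y addrC addKr idealV_scale // star_ideal.
have [|||||v vy hv] := IHn k.+1 y; first by [].
- by rewrite addSn -addnS.
- by rewrite (primitive_congr ij jr yx).
- rewrite hyy; apply: ideal_opp; first exact: principal_ideal.
  apply: ideal_mulr; first exact: principal_ideal.
  by apply: principal_powerM => //; rewrite star_ideal // principal_ideal.
- by rewrite hyy ideal_opp // ideal_mulr // ideal_mull.
by exists v => //; rewrite -[v](subrK y) -addrA idealVD.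
Qed.

End NormLift.

Section Witt.
Variables (O : involutive_dvr) (A : framed_ring O) (m : nat) (h : herm_space A m).
Local Notation V := 'rV[A]_m.
Local Notation bar := (@star O A).
Local Notation rad := (principal (unif A)).
Local Notation sgn := (sgn A).
Implicit Types (j : {set A}) (u v w x y t : V) (a b c D : A).

Lemma sgn_unit : sgn \is a GRing.unit.
Proof. by apply/unitrPr; exists sgn; rewrite sgnK. Qed.

Lemma unit_hC u v : (h u v \is a GRing.unit) = (h v u \is a GRing.unit).
Proof. by rewrite (hC h v u) unitrM sgn_unit star_unit. Qed.

Lemma isometry_perm (f : V -> V) : (forall a u v, f (a *: u + v) = a *: f u + f v) ->
    (forall u v, h (f u) (f v) = h u v) ->
  exists2 g, g \in unitary_group h & forall x, g x = f x.
Proof.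
move=> fL fh.
have f0 : f 0 = 0 by apply: (addrI (f 0)); rewrite -{1}[f 0]scale1r -fL scaler0 !addr0.
have fN x : f (- x) = - f x by rewrite -scaleN1r -[_ *: _]addr0 fL f0 addr0 scaleN1r.
have inj : injective f.
  move=> x y E; apply/eqP; rewrite -subr_eq0; apply/eqP/(h_nondeg_r (h:=h)) => u.
  by rewrite -fh -[x]scale1r fL fN scale1r E subrr h0r.
exists (perm inj) => [|x]; last by rewrite permE.
by apply/unitary_setP; split=> *; rewrite !permE.
Qed.

Lemma reflection t v : h t t = h v v -> h (v - t) t \is a GRing.unit ->
  exists2 g, g \in unitary_group h & g t = v.
Proof.
move=> Etv; have [r Er] : exists r, r = v - t by exists (v - t).
rewrite -Er; set D := h r t => UD.
have [||g Ug gE] := @isometry_perm (fun x => x + (D^-1 * h r x) *: r).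
- move=> a x y /=; rewrite hDr hZr mulrDr scalerDl scalerDr scalerA [a * (D^-1 * _)]mulrCA.
  by rewrite addrACA.
- move=> x y; have UbD : bar D \is a GRing.unit by rewrite star_unit.
  have key : sgn * bar D + D + h r r = 0.
    by rewrite /D Er !hBl !hBr rmorphB mulrBr -hC -h_sym Etv; ring.
  rewrite hDl !hDr !hZl !hZr (hC h r x) rmorphM rmorphV //=.
  set X := bar (h r x); set Y := h r y.
  have -> : h x y + D^-1 * Y * (sgn * X) + ((bar D)^-1 * X * Y + (bar D)^-1 * X * (D^-1 * Y * h r r))
      = h x y + X * Y * (D^-1 * (bar D)^-1) * (sgn * bar D + D + h r r)
        + X * Y * (sgn * D^-1 * (1 - (bar D)^-1 * bar D) + (bar D)^-1 * (1 - D^-1 * D)).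
    by ring.
  by rewrite key !mulVr // subrr !mulr0 !addr0 mulr0 addr0.
by exists g => //; rewrite gE -/D mulVr // scale1r Er addrC subrK.
Qed.

Lemma opp_unitary : exists2 g, g \in unitary_group h & forall x, g x = - x.
Proof.
apply: isometry_perm => [a u v|u v]; first by rewrite opprD scalerN.
by rewrite hNl hNr opprK.
Qed.

Lemma common_nonorthogonal t v : t \in primitive_vectors A m -> v \in primitive_vectors A m ->
  exists2 w, h w t \is a GRing.unit & h w v \is a GRing.unit.
Proof.
move=> Pt Pv; have [w1 E1] := primitive_dual h Pt; have [w2 E2] := primitive_dual h Pv.
have [U1|U1] := boolP (h w1 v \is a GRing.unit); first by exists w1; rewrite ?E1 ?unitr1.
have [U2|U2] := boolP (h w2 t \is a GRing.unit); first by exists w2; rewrite ?E2 ?unitr1.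
exists (w1 + w2); first by rewrite hDl E1 unitD_rad ?unitr1 ?mem_rad.
by rewrite hDl E2 addrC unitD_rad ?unitr1 ?mem_rad.
Qed.

Lemma unitary_comp t u v :
  (exists2 g, g \in unitary_group h & g t = u) ->
  (exists2 g, g \in unitary_group h & g u = v) ->
  exists2 g, g \in unitary_group h & g t = v.
Proof.
case=> g Ug gt [k Uk ku]; exists (g * k)%g; rewrite ?groupM //.
by rewrite permM gt.
Qed.

Lemma witt_exact t v : t \in primitive_vectors A m -> v \in primitive_vectors A m ->
  h t t = h v v -> exists2 g, g \in unitary_group h & g t = v.
Proof.
move=> Pt Pv Etv; have rI := rad_ideal A.
have [Ut|Nt] := boolP (h t t \is a GRing.unit).
  have [U1|N1] := boolP (h (v - t) t \is a GRing.unit); first exact: reflection.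
  apply: (@unitary_comp t (- v)); last first.
    by have [g Ug gE] := opp_unitary; exists g; rewrite // gE opprK.
  apply: reflection; first by rewrite hNl hNr opprK.
  have : 2%:R * h t t \is a GRing.unit by rewrite unitrM two_unit.
  apply: contraLR => N2; have := nonunitD N1 N2.
  rewrite -unitrN; congr (~~ (_ \is a GRing.unit)).
  by rewrite !hDl !hNl; ring.
have rt : h t t \in rad by rewrite mem_rad.
have [Uvt|Nvt] := boolP (h v t \is a GRing.unit).
  by apply: reflection => //; rewrite hBl unitD_rad // ideal_opp.
have [w Uwt Uwv] := common_nonorthogonal Pt Pv.
pose z := - (2%:R^-1 * h w w) / h w t; pose s := w + z *: t.
have zwt : z * h w t = - (2%:R^-1 * h w w) by rewrite divrK.
have hss : h s s = z * bar z * h t t.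
  have E : bar z * h t w = - (2%:R^-1 * h w w).
    rewrite (hC h w t) mulrCA -rmorphM zwt rmorphN rmorphM bar_half mulrN mulrCA.
    by rewrite -h_sym.
  rewrite /s hDl !hDr !hZl !hZr zwt E [X in X - _ + _](half_sum (h w w)) mulrDr.
  by ring.
have Uts : h t s \is a GRing.unit.
  by rewrite /s hDr hZr unitD_rad ?ideal_mull // unit_hC.
have Ps := unit_primitive Uts.
have [|s1 s1s hs1] := length_lift (h:=h) (t:=s) (D:=h t t) rI (subxx _) Ps (h_sym h t).
  by rewrite hss ideal_sub ?ideal_mull.
have close u : h s1 u - h s u \in rad by rewrite -hBl h_idealVl.
have Us1t : h s1 t \is a GRing.unit by rewrite (unit_rad (close t)) unit_hC.
have Us1v : h s1 v \is a GRing.unit.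
  rewrite (unit_rad (close v)) /s hDl hZl unitD_rad // ideal_mull // mem_rad.
  by rewrite unit_hC.
apply: (@unitary_comp t s1); apply: reflection => //.
- by rewrite hBl unitD_rad // ideal_opp.
- by rewrite hs1.
- by rewrite hBl hs1 unitD_rad ?ideal_opp // unit_hC.
Qed.

(** Primitive vectors with congruent lengths lie in one orbit modulo the ideal. *)
Lemma witt_congr j t v : is_ideal j -> j \subset rad ->
    t \in primitive_vectors A m -> v \in primitive_vectors A m ->
    h t t - h v v \in j ->
  exists2 g, g \in unitary_group h & g t - v \in idealV m j.
Proof.
move=> ij jr Pt Pv jtv; have [v1 v1v hv1] := length_lift (h:=h) ij jr Pv (h_sym h t) jtv.
have [||g Ug gt] := @witt_exact t v1 Pt.
- by rewrite (primitive_congr ij jr v1v).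
- by rewrite hv1.
by exists g; rewrite // gt.
Qed.

End Witt.

Section Characters.
Variables (C : numClosedFieldType) (O : involutive_dvr) (A : framed_ring O) (m : nat).
Variables (h : herm_space A m) (i : {set A}) (w : weil_data C h i).
Local Notation V := 'rV[A]_m.
Local Notation bar := (@star O A).
Local Notation rad := (principal (unif A)).
Local Notation sgn := (sgn A).
Local Notation mu := (mu w).
Implicit Types (I k : {set A}) (u v x y t : V) (a b c : A).

Lemma mu_skew_pairing I (P Q : A) : is_ideal I ->
    (forall x : A, x \in I -> mu (bar x * P - sgn * x * Q) = 1) ->
  P + bar Q \in ann I.
Proof.
move=> iI H; apply: (mu_ann (w := w)) => // x Ix.
have := H (bar x); rewrite star_ideal // => /(_ Ix); rewrite barK muD.
by rewrite -mulrA -mu_bar rmorphM barK -muD -mulrDr.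
Qed.

Lemma h_inf_isom v x u t : h (inf_isom h v x u) t = bar (h x u) * h v t - sgn * bar (h v u) * h x t.
Proof. by rewrite /inf_isom hBl !hZl rmorphM bar_sgn. Qed.

Lemma two_in k (x : A) : is_ideal k -> 2%:R * x \in k -> x \in k.
Proof. by move=> ik kx; rewrite -[x](mulKr (two_unit A)) ideal_mull. Qed.

Lemma good_vector k t u : is_ideal k -> k != [set 0] ->
    {in k &, forall a b, a * b = 0} -> {in ann k &, forall a b, a * b \in k} ->
    t \in primitive_vectors A m -> u \in idealV m (ann k) ->
    (forall g, g \in coset_stab h (ann k) t -> g u - u \in idealV m k ->
       mu (2%:R * h (g u - u) t) = 1) ->
  exists2 a : {unit A}, a \in unitary_scalars_congr (ann k) &
    u - (1 - (val a)^-1) *: t \in idealV m k.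
Proof.
move=> ik knz kk jj Pt ju good; set j := ann k in jj ju good *.
have ij : is_ideal j by apply: ann_ideal.
have jr : j \subset rad by apply: ann_proper.
have kj : k \subset j by apply/subsetP => a ka; apply/annP => b; apply: kk.
have jjV (a : A) x : a \in j -> x \in idealV m j -> a *: x \in idealV m k.
  by move=> ja /(idealVP _ ij) jx; apply/idealVP => // l; rewrite mxE jj.
have star_uv v x : bar (h x u) * h v t + h v u * bar (h x t) \in k.
  have jhu y : h y u \in j by apply: h_idealVr.
  rewrite -(annK ik) -/j; apply: (@two_in _ _ (ann_ideal _)).
  apply: (@two_in _ _ (ann_ideal _)).
  have -> : 2%:R * (2%:R * (bar (h x u) * h v t + h v u * bar (h x t)))
     = 2%:R * (2%:R * (bar (h x u) * h v t)) + bar (2%:R * (2%:R * (bar (h v u) * h x t))).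
    by rewrite !rmorphM !rmorph_nat barK; ring.
  apply: mu_skew_pairing => // a ja; pose av := a *: v.
  have jav : av \in idealV m j by rewrite idealV_scale.
  have j3 : {in j & &, forall a b c, a * b * c = 0}.
    by move=> b c d jb jc jd; rewrite mulrC; have /annP := jd; apply; apply: jj.
  have [g Ug gE] := cayley h x ij j3 jav.
  move: gE; have [K KE] : exists K, K = inf_isom h av x by exists (inf_isom h av x).
  rewrite -KE => gE.
  have KD y z : K (y + z) = K y + K z by have := inf_isom_linear h av x 1 y z; rewrite -KE !scale1r.
  have jK y : K y \in idealV m j by rewrite KE inf_isom_ideal.
  have jKk y : y \in idealV m j -> K y \in idealV m k.
    move=> jy; rewrite KE /inf_isom; apply: idealVB; first by apply: jjV; rewrite ?h_idealVr.
    rewrite -scalerA; apply/idealVZ/idealV_scale => //.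
    by rewrite /av hZl jj ?h_idealVr // star_ideal.
  have Kskew y z : h (K y) z = - h y (K z) by rewrite KE inf_isom_skew.
  have [y Ey gu] := gE u; have [z Ez gt] := gE t.
  have jy : y \in idealV m j by rewrite -[y](subrK (K y)) Ey idealVD.
  have guu : g u - u = K y + K y.
    by rewrite gu -Ey opprB addrC addrA subrK.
  have hKy : h (K y) t = h (K u) t.
    have h0 : h (K y) (K t) = 0 by apply: (h_idealV_ann h ik); [apply: jKk | apply: jK].
    have -> : K y = K u + K (K y) by rewrite -KD -Ey subrK.
    by rewrite hDl [X in _ + X]Kskew h0 oppr0 addr0.
  have EK : h (K u) t = bar a * (bar (h x u) * h v t) - sgn * a * (bar (h v u) * h x t).
    by rewrite KE h_inf_isom /av !hZl rmorphM barK; ring.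
  have Gg : g \in coset_stab h j t.
    apply/setIdP; split=> //; rewrite gt -Ez opprB addrC addrA subrK.
    by apply: idealVD; apply: jK.
  have := good g Gg; rewrite guu hDl hKy EK => <-; last by apply: idealVD; apply: jKk.
  by congr (mu _); ring.
have [w0 hw0] := primitive_dual h Pt.
pose b := - bar (h w0 u).
have jb : b \in j by rewrite ideal_opp // star_ideal // h_idealVr.
have kub : u - b *: t \in idealV m k.
  apply: (mem_idealV_form (h := h)) => // v.
  have := star_uv v w0; rewrite hw0 rmorph1 mulr1 addrC.
  by rewrite hBr hZr /b mulNr opprK.
have kbb : b + bar b \in k.
  have := star_uv w0 w0; rewrite hw0 rmorph1 !mulr1 => /(ideal_opp ik).
  by rewrite /b rmorphN barK opprD.
pose s := 2%:R^-1 * (2%:R^-1 * (b - bar b)).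
have Ss : bar s = - s by rewrite /s !rmorphM !bar_half rmorphB barK -!mulrN opprB.
have js : s \in j by rewrite !ideal_mull // ideal_sub // star_ideal.
have [a Na Ea] := cayley_scalar (subsetP jr _ js) Ss.
have Up : 1 + s \is a GRing.unit by apply/unit1D/(subsetP jr).
have Um : 1 - s \is a GRing.unit by apply/unit1D/(subsetP jr)/ideal_opp.
exists a.
  apply/setIdP; split=> //.
  have -> : val a - 1 = (1 - s)^-1 * (s + s).
    by rewrite Ea mulrC; apply: (mulrI Um); rewrite mulrBr !mulVKr // mulr1; ring.
  by rewrite ideal_mull // ideal_add.
have -> : 1 - (val a)^-1 = (s + s) - (1 + s)^-1 * (s * (s + s)).
  have -> : (val a)^-1 = (1 + s)^-1 * (1 - s).
    by rewrite Ea invrM ?unitrV // invrK mulrC.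
  by apply: (mulrI Up); rewrite !mulrBr !mulVKr // mulr1; ring.
rewrite scalerBl opprB addrCA idealVD //; first by rewrite idealV_scale // ideal_mull // jj // ideal_add.
have -> : u - (s + s) *: t = (u - b *: t) + (b - (s + s)) *: t by rewrite scalerBl addrA subrK.
apply: idealVD => //; apply: idealV_scale => //.
have -> : b - (s + s) = 2%:R^-1 * (b + bar b).
  rewrite /s -mulrDr -half_sum {1}(half_sum b) -mulrBr; congr (_ * _); ring.
by rewrite ideal_mull.
Qed.

(** The characters [alpha] determine a primitive vector up to the scalars of
    norm one and the annihilator of the ideal. *)
Lemma alpha_separates k t v : is_ideal k -> k != [set 0] ->
    {in k &, forall a b, a * b = 0} -> t \in primitive_vectors A m ->
    (forall g, g \in congruence_set h k -> mu (h (g t) t) = mu (h (g v) v)) ->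
  exists2 a : {unit A}, a \in unitary_scalars A & v - val a *: t \in idealV m (ann k).
Proof.
move=> ik knz kk Pt Heq; set j := ann k.
have ij : is_ideal j by apply: ann_ideal.
have jr : j \subset rad by apply: ann_proper.
have kj : k \subset j by apply/subsetP => a ka; apply/annP => b; apply: kk.
have star_uv u x : bar (h x t) * h u t - bar (h x v) * h u v \in j.
  apply: (@two_in _ _ ij); apply: (@two_in _ _ ij).
  have aux (c : A) : 2%:R * (2%:R * c) = 2%:R * c + bar (2%:R * bar c).
    by rewrite rmorphM rmorph_nat barK; ring.
  rewrite aux; set P := bar (h x t) * h u t - bar (h x v) * h u v.
  apply: mu_skew_pairing => // a ka; pose au := a *: u.
  have kau : au \in idealV m k by rewrite idealV_scale.
  have k3 : {in k & &, forall a b c, a * b * c = 0} by move=> b c d kb kc kd; rewrite (kk b c) ?mul0r.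
  have [g Ug gE] := cayley h x ik k3 kau.
  move: gE; have [K KE] : exists K, K = inf_isom h au x by exists (inf_isom h au x).
  rewrite -KE => gE.
  have KD y z : K (y + z) = K y + K z by have := inf_isom_linear h au x 1 y z; rewrite -KE !scale1r.
  have kK y : K y \in idealV m k by rewrite KE inf_isom_ideal.
  have Kskew y z : h (K y) z = - h y (K z) by rewrite KE inf_isom_skew.
  have Og : g \in congruence_set h k.
    apply/setIdP; split=> //; apply/forallP => y; have [z Ez ->] := gE y.
    by rewrite -Ez opprB addrC addrA subrK idealVD.
  have hg y : mu (h (g y) y) = mu (2%:R * h (K y) y).
    have [z Ez ->] := gE y.
    have hKz : h (K z) y = h (K y) y.
      have h0 : h (K z) (K y) = 0.
        by apply: (h_idealV_ann h ik); [apply: kK | apply/(idealVS kj)/kK].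
      have -> : K z = K y + K (K z) by rewrite -KD -Ez subrK.
      by rewrite hDl [X in _ + X]Kskew h0 oppr0 addr0.
    have -> : z + K z = y + K z + K z by rewrite -Ez subrK.
    rewrite !hDl hKz !muD mu_form mul1r -muD; congr (mu _).
    by ring.
  have := Heq g Og; rewrite !hg => E.
  have : mu (2%:R * h (K t) t - 2%:R * h (K v) v) = 1.
    by rewrite muD E -muD subrr mu0.
  move=> <-; congr (mu _).
  rewrite KE !h_inf_isom /au !hZl !rmorphM !barK /P rmorphB !rmorphM !barK.
  by ring.
have [w0 hw0] := primitive_dual h Pt.
pose r := bar (h w0 v).
have jtv : t - r *: v \in idealV m j.
  apply: (mem_idealV_form (h := h)) => // u.
  by have := star_uv u w0; rewrite hw0 rmorph1 mul1r hBr hZr.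
have jrr : r * bar r - 1 \in j.
  by have := star_uv w0 w0; rewrite hw0 rmorph1 mul1r -/r => /(ideal_opp ij); rewrite opprB /r barK.
have [a Na ja] := norm_one_lift ij jr jrr.
exists (a^-1)%g; first by rewrite groupV.
have Ua : val a \is a GRing.unit := valP a.
rewrite FinRing.val_unitV idealVBC.
have -> : (val a)^-1 *: t - v = (val a)^-1 *: ((t - r *: v) - (val a - r) *: v).
  by rewrite scalerBl opprB addrA subrK scalerBr scalerA mulVr // scale1r.
by apply/idealVZ/idealVB/idealV_scale.
Qed.

End Characters.

Lemma central_corner (F : fieldType) n (e Q : 'M[F]_n) :
  Q *m e = Q -> e *m Q = Q -> (forall M, Q *m M *m e = e *m M *m Q) ->
  exists c, Q = c *: e.
Proof.
move=> Qe eQ cent; have [e0|nz] := eqVneq e 0; first by exists 0; rewrite -Qe e0 mulmx0 scale0r.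
have [a [b nzab]] : exists a b, e a b != 0.
  case/matrix0Pn: nz => a [b H]; by exists a, b.
exists (Q a b / e a b); apply/matrixP => r s; rewrite mxE.
have delta (X Y : 'M[F]_n) : (X *m delta_mx b r *m Y) a s = X a b * Y r s.
  rewrite mxE (bigD1 r) //= big1 ?addr0 => [|l lr].
    rewrite mxE (bigD1 b) //= big1 ?addr0 => [|l lb]; first by rewrite mxE !eqxx mulr1.
    by rewrite mxE (negPf lb) mulr0.
  rewrite mxE big1 ?mul0r // => l' _; by rewrite mxE (negPf lr) andbF mulr0.
have := congr1 (fun M : 'M[F]_n => M a s) (cent (delta_mx b r)).
by rewrite !delta => E; rewrite mulrAC E mulrAC divff // mul1r.
Qed.

Section System.
Variables (C : numClosedFieldType) (O : involutive_dvr) (A : framed_ring O) (m : nat).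
Variables (h : herm_space A m) (i : {set A}) (w : weil_data C h i).
Local Notation V := 'rV[A]_m.
Local Notation UV := (unitary_group h).
Local Notation mu := (mu w).

(** A representation of the unitary group together with the operators of the
    elements (0, v) of the Heisenberg group. *)
Record weil_system := WeilSystem {
  wdim : nat;
  opE : V -> 'M[C]_wdim;
  opW : mx_representation C UV wdim;
  opE0 : opE 0 = 1%:M;
  opED : forall u v, opE u *m opE v = mu (h v u) *: opE (u + v);
  opEW : forall g v, g \in UV -> opE v *m opW g = opW g *m opE (g v) }.

Definition spanning (X : weil_system) : Prop :=
  forall M, exists c : V -> C, M = \sum_v c v *: opE X v.

End System.

Section Blocks.
Variables (C : numClosedFieldType) (O : involutive_dvr) (A : framed_ring O) (m : nat).
Variables (h : herm_space A m) (i : {set A}) (w : weil_data C h i).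
Variable X : weil_system w.
Local Notation V := 'rV[A]_m.
Local Notation UV := (unitary_group h).
Local Notation mu := (mu w).
Local Notation bar := (@star O A).
Local Notation sgn := (sgn A).
Local Notation E := (opE X).
Local Notation W := (opW X).
Local Notation N := (subg_of (unitary_scalars A)).
Local Notation P := (primitive_vectors A m).
Implicit Types (k n : {set A}) (u v x y z t : V).

Definition mu2 (a : A) : C := mu (2%:R * a).

Lemma mu20 : mu2 0 = 1. Proof. by rewrite /mu2 mulr0 mu0. Qed.
Lemma mu2D a b : mu2 (a + b) = mu2 a * mu2 b. Proof. by rewrite /mu2 mulrDr muD. Qed.
Lemma mu2_neq0 a : mu2 a != 0. Proof. exact: mu_neq0. Qed.
Lemma mu2E a : mu2 a = mu a * mu a.
Proof. by rewrite /mu2 -muD; congr (mu _); ring. Qed.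

Lemma muC u v : mu (h v u) = mu (- h u v).
Proof. by rewrite hC mu_sgn_bar. Qed.

Lemma opE_comm u v : E u *m E v = mu2 (h v u) *: (E v *m E u).
Proof.
rewrite !opED scalerA mu2E (muC v u) -mulrA -muD subrr mu0 mulr1.
by rewrite [v + u]addrC.
Qed.

Lemma opE_N u : E u *m E (- u) = 1%:M.
Proof. by rewrite opED subrr opE0 hNl muN mu_form invr1 scale1r. Qed.

Lemma opE_NK u : E (- u) *m E u = 1%:M.
Proof. by rewrite -{2}[u]opprK opE_N. Qed.

(** Orthogonality of the characters of kV given by the form. *)
Lemma form_char_sum k x : is_ideal k ->
  \sum_(z in idealV m k) mu2 (h z x)
    = if x \in idealV m (ann k) then #|idealV m k|%:R else 0.
Proof.
move=> ik; case: ifPn => [jx|jx].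
  rewrite (eq_bigr (fun _ => 1)) ?sumr_const // => z kz.
  by rewrite (h_idealV_ann h ik) // mu20.
have [/existsP[z /andP[kz nz]]|triv] := boolP [exists z, (z \in idealV m k) && (mu2 (h z x) != 1)].
  set S := \sum_(z in _) _; suff /eqP : (mu2 (h z x) - 1) * S = 0.
    by rewrite mulf_eq0 subr_eq0 (negPf nz) => /eqP.
  apply/eqP; rewrite mulrBl mul1r subr_eq0; apply/eqP.
  rewrite mulr_sumr [RHS](reindex_inj (addIr z)) /=; apply: eq_big => y.
    by rewrite idealVDr.
  by move=> _; rewrite hDl mu2D mulrC.
case/negP: jx; apply: (mem_idealV_form (h := h)) => [|u]; first exact: ann_ideal.
apply: (two_in (ann_ideal _)); apply: (mu_ann (w := w)) => // a ka.
have := existsPn triv (bar a *: u).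
rewrite idealV_scale ?star_ideal //= negbK => /eqP.
by rewrite hZl barK /mu2 mulrCA.
Qed.

(** The projection onto the vectors on which kV acts through the character
    attached to [v]. *)
Definition block k v : 'M[C]_(wdim X) :=
  locked (#|idealV m k|%:R^-1 *: \sum_(z in idealV m k) mu2 (- h z v) *: E z).

Lemma blockE k v :
  block k v = #|idealV m k|%:R^-1 *: \sum_(z in idealV m k) mu2 (- h z v) *: E z.
Proof. by rewrite /block -lock. Qed.

Lemma card_neq0 (G : {group V}) : #|G|%:R != 0 :> C.
Proof. by rewrite pnatr_eq0 -lt0n cardG_gt0. Qed.

Lemma block_opE k v z : is_ideal k -> {in k &, forall a b, a * b = 0} ->
  z \in idealV m k -> block k v *m E z = mu2 (h z v) *: block k v.
Proof.
move=> ik kk kz; rewrite !blockE -scalemxAl scalerA mulrC -scalerA; congr (_ *: _).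
rewrite mulmx_suml scaler_sumr (reindex_inj (addIr (- z))) /=.
apply: eq_big => [y|y]; first by rewrite idealVDr // idealVN.
rewrite idealVDr ?idealVN // => ky.
have h0 : h z (y - z) = 0.
  apply: (h_idealV_ann h ik) => //; apply: (idealVS (k := k)); last by rewrite idealVB.
  by apply/subsetP => a ka; apply/annP => b; apply: kk.
rewrite -scalemxAl opED subrK h0 mu0 scale1r scalerA -mu2D.
by congr (mu2 _ *: _); rewrite hDl hNl opprD opprK addrC.
Qed.

Lemma block_shift k v u : block k v *m E u = E u *m block k (v + u).
Proof.
rewrite !blockE -scalemxAl -scalemxAr; congr (_ *: _).
rewrite mulmx_suml mulmx_sumr; apply: eq_bigr => z _.
rewrite -scalemxAl -scalemxAr (opE_comm z u) scalerA; congr (_ *: _).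
rewrite -mu2D hDr opprD; rewrite /mu2 !mulrDr !muD; congr (_ * _).
by rewrite !mulr_natl !mulr2n !muD muC.
Qed.

Lemma block_unitary k v g : g \in UV -> block k v *m W g = W g *m block k (g v).
Proof.
move=> Ug; rewrite !blockE -scalemxAl -scalemxAr; congr (_ *: _).
rewrite mulmx_suml mulmx_sumr [RHS](reindex_inj (@perm_inj _ g)) /=.
apply: eq_big => [z|z _]; first by rewrite (unitary_idealV _ _ Ug).
by rewrite -scalemxAl -scalemxAr opEW // unitary_h.
Qed.

Lemma block_mul k v u : is_ideal k -> {in k &, forall a b, a * b = 0} ->
  block k v *m block k u = if v - u \in idealV m (ann k) then block k v else 0.
Proof.
move=> ik kk; rewrite (blockE k u) -scalemxAr mulmx_sumr.
rewrite (eq_bigr (fun z => mu2 (h z (v - u)) *: block k v)) => [|z kz].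
  rewrite -scaler_suml form_char_sum //; case: ifP; last by rewrite scale0r scaler0.
  by rewrite scalerA mulVf ?card_neq0 // scale1r.
by rewrite -scalemxAr block_opE // scalerA -mu2D hBr addrC.
Qed.

Lemma block_idem k v : is_ideal k -> {in k &, forall a b, a * b = 0} ->
  block k v *m block k v = block k v.
Proof. by move=> ik kk; rewrite block_mul // subrr idealV0. Qed.

Lemma block_congr k v u : is_ideal k -> v - u \in idealV m (ann k) -> block k v = block k u.
Proof.
move=> ik vu; rewrite !blockE; congr (_ *: _); apply: eq_bigr => z kz.
congr (mu2 (- _) *: _); apply/eqP; rewrite -subr_eq0 -hBr.
by rewrite (h_idealV_ann h ik).
Qed.

Lemma idealV_setT v : v \in idealV m [set: A].
Proof.
apply/idealVP => [|j]; last by rewrite inE.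
by apply/is_idealP; split=> *; rewrite inE.
Qed.

Lemma block_sum k : is_ideal k ->
  1%:M = (#|idealV m k|%:R / #|{: V}|%:R) *: \sum_v block k v.
Proof.
move=> ik; have iT : is_ideal [set: A] by apply/is_idealP; split=> *; rewrite inE.
rewrite (eq_bigr _ (fun v _ => blockE k v)) -scaler_sumr scalerA mulrAC divff ?card_neq0 // mul1r exchange_big /=.
rewrite (bigD1 0) ?idealV0 // [X in _ *: (_ + X)]big1 ?addr0 => [|z /andP[kz nz]].
  rewrite (eq_bigr (fun _ => 1%:M)) => [|v _]; last by rewrite h0l oppr0 mu20 scale1r opE0.
  rewrite sumr_const -scaler_nat scalerA mulVf ?scale1r // pnatr_eq0 -lt0n.
  by apply/card_gt0P; exists 0.
have := form_char_sum z iT; rewrite [X in if X then _ else _](_ : _ = false).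
  move=> H; rewrite -scaler_suml.
  rewrite [X in X *: _](_ : _ = 0) ?scale0r //; rewrite -[RHS]H.
  apply: eq_big => [v|v _]; first by rewrite idealV_setT.
  by rewrite /mu2 !mulr_natl !mulr2n !muD muC.
apply: contraNF nz => /(idealVP _ (ann_ideal _)) Hz.
apply/eqP/rowP => j; rewrite mxE; have /annP/(_ 1) := Hz j.
by rewrite inE mulr1; apply.
Qed.

(** Cutting down to a block leaves only the operators that preserve it. *)
Lemma block_corner k v u : is_ideal k -> {in k &, forall a b, a * b = 0} ->
  block k v *m E u *m block k v = if u \in idealV m (ann k) then block k v *m E u else 0.
Proof.
move=> ik kk; rewrite block_shift -mulmxA block_mul // addrC addKr.
by case: ifP; rewrite ?mulmx0.
Qed.

Lemma block_opE_comm k v u : is_ideal k -> u \in idealV m (ann k) ->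
  block k v *m E u = E u *m block k v.
Proof.
move=> ik ju; rewrite block_shift; congr (_ *m _); apply: block_congr => //.
by rewrite addrC addKr.
Qed.

Hypothesis spanX : spanning X.

Lemma block_corner_span k v (M : 'M_(wdim X)) : is_ideal k -> {in k &, forall a b, a * b = 0} ->
  exists c : V -> C,
    block k v *m M *m block k v = \sum_(u in idealV m (ann k)) c u *: (block k v *m E u).
Proof.
move=> ik kk; have [c ->] := spanX M; exists c.
rewrite mulmx_sumr mulmx_suml [RHS]big_mkcond; apply: eq_bigr => u _.
by rewrite -scalemxAr -scalemxAl block_corner //; case: ifP; rewrite ?scaler0.
Qed.

(** A block is an irreducible module of the Heisenberg group of (ann k)V, so its
    centralizer is scalar. *)
Lemma block_schur k v (Q : 'M_(wdim X)) : is_ideal k -> {in k &, forall a b, a * b = 0} ->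
  block k v *m Q = Q -> Q *m block k v = Q ->
  (forall u, u \in idealV m (ann k) -> Q *m E u = E u *m Q) -> exists c, Q = c *: block k v.
Proof.
move=> ik kk eQ Qe comm; apply: central_corner => // M.
have [c Ec] := block_corner_span v M ik kk.
rewrite -{1}Qe -{2}eQ -[_ *m _ *m M *m _]mulmxA -[_ *m _ *m (M *m _)]mulmxA.
rewrite [block k v *m (M *m _)]mulmxA [RHS]mulmxA Ec mulmx_sumr mulmx_suml.
apply: eq_bigr => u ju; rewrite -scalemxAr -scalemxAl; congr (_ *: _).
by rewrite mulmxA Qe -mulmxA -comm // mulmxA eQ.
Qed.

End Blocks.

Section Scalars.
Variables (O : involutive_dvr) (A : framed_ring O) (m : nat) (h : herm_space A m).
Local Notation V := 'rV[A]_m.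
Local Notation UV := (unitary_group h).
Local Notation bar := (@star O A).
Local Notation N := (subg_of (unitary_scalars A)).
Implicit Types (a b : N) (u v x t : V).

Definition nval a : A := val (sgval a).

Lemma scalar_ofE a v : scalar_of m a v = nval a *: v.
Proof. by rewrite permE. Qed.

Lemma scalar_of_UV a : scalar_of m a \in UV.
Proof. exact/homothety_unitary/subgP. Qed.

Lemma scalar_ofM a b : scalar_of m (a * b)%g = (scalar_of m a * scalar_of m b)%g.
Proof. by rewrite /scalar_of sgvalM ?inE // homothetyM. Qed.

Lemma scalar_of1 : scalar_of m (1%g : N) = 1%g.
Proof. by apply/permP => v; rewrite scalar_ofE perm1 scale1r. Qed.

Lemma scalar_ofV a : scalar_of m (a^-1)%g = ((scalar_of m a)^-1)%g.
Proof. by apply/esym/eqP; rewrite eq_invg_mul -scalar_ofM mulgV scalar_of1. Qed.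

Lemma nvalN a : nval a * bar (nval a) = 1.
Proof. by have := subgP a; rewrite inE => /eqP. Qed.

Lemma bar_nval a : bar (nval a) = (nval a)^-1.
Proof.
have U : nval a \is a GRing.unit := valP (sgval a).
by apply: (mulrI U); rewrite nvalN mulrV.
Qed.

Lemma nvalV a : nval (a^-1)%g = (nval a)^-1.
Proof. by rewrite /nval morphV ?inE // FinRing.val_unitV. Qed.

Lemma nvalM a b : nval (a * b)%g = nval a * nval b.
Proof. by rewrite /nval sgvalM ?inE. Qed.

(** The group of scalars of norm one is commutative. *)
Lemma scalarC a b : (a * b = b * a)%g.
Proof.
apply: subg_inj; rewrite !sgvalM ?inE //; apply: val_inj.
by rewrite !FinRing.val_unitM mulrC.
Qed.

Lemma scalar_of_comm a g : g \in UV -> (scalar_of m a * g = g * scalar_of m a)%g.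
Proof. by move=> Ug; apply: homothety_cent Ug. Qed.

Lemma subg_scalar (u : {unit A}) : u \in unitary_scalars A -> exists a : N, sgval a = u.
Proof. by move=> Nu; exists (subg _ u); rewrite subgK. Qed.

Lemma fixes_ann k g u : is_ideal k -> g \in congruence_set h k ->
  u \in idealV m (ann k) -> g u = u.
Proof.
move=> ik /setIdP[Ug /forallP gk] ju; apply/eqP; rewrite -subr_eq0; apply/eqP.
apply: (hform_nondeg (h:=h)) => x; rewrite hBl -(unitary_h u x Ug) -hBr.
rewrite -opprB hNr (h_ann_idealV h ik) ?oppr0 //.
by rewrite (unitary_idealV _ _ Ug).
Qed.

End Scalars.

Section Key.
Variables (C : numClosedFieldType) (O : involutive_dvr) (A : framed_ring O) (m : nat).
Variables (h : herm_space A m) (i : {set A}) (w : weil_data C h i).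
Variable X : weil_system w.
Hypothesis spanX : spanning X.
Local Notation V := 'rV[A]_m.
Local Notation UV := (unitary_group h).
Local Notation mu := (mu w).
Local Notation mu2 := (mu2 w).
Local Notation bar := (@star O A).
Local Notation sgn := (sgn A).
Local Notation E := (opE X).
Local Notation W := (opW X).
Local Notation N := (subg_of (unitary_scalars A)).
Local Notation P := (primitive_vectors A m).
Local Notation block := (block X).
Implicit Types (k n : {set A}) (u v x y z t : V) (a b : N) (M T Q : 'M[C]_(wdim X)).

Lemma opWM g g' : g \in UV -> g' \in UV -> W (g * g')%g = W g *m W g'.
Proof. exact: repr_mxM. Qed.

Lemma opW1 : W 1%g = 1%:M. Proof. exact: repr_mx1. Qed.

Lemma opWVK g : g \in UV -> W (g^-1)%g *m W g = 1%:M.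
Proof. by move=> Ug; rewrite -opWM ?groupV // mulVg opW1. Qed.

Lemma opWKV g : g \in UV -> W g *m W (g^-1)%g = 1%:M.
Proof. by move=> Ug; rewrite -opWM ?groupV // mulgV opW1. Qed.

Definition scalW a := W (scalar_of m a).

Lemma scalWM a b : scalW (a * b)%g = scalW a *m scalW b.
Proof. by rewrite /scalW scalar_ofM opWM ?scalar_of_UV. Qed.

Lemma scalW_comm a g : g \in UV -> scalW a *m W g = W g *m scalW a.
Proof. by move=> Ug; rewrite -!opWM ?scalar_of_UV // (scalar_of_comm a Ug). Qed.

Lemma opW_cancel g M : g \in UV -> M *m W g = 0 -> M = 0.
Proof. by move=> Ug M0; rewrite -[M]mulmx1 -(opWKV Ug) mulmxA M0 mul0mx. Qed.

(** The operators on a block that are combinations of the scalars of norm one. *)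
Definition scalar_span k t M : Prop :=
  exists c : N -> C, M = \sum_a c a *: (block k t *m scalW a).

Lemma scalar_span0 k t : scalar_span k t 0.
Proof. by exists (fun _ => 0); rewrite big1 // => a _; rewrite scale0r. Qed.

Lemma scalar_spanD k t M Q : scalar_span k t M -> scalar_span k t Q -> scalar_span k t (M + Q).
Proof.
move=> [c ->] [d ->]; exists (fun a => c a + d a).
by rewrite -big_split; apply: eq_bigr => a _; rewrite scalerDl.
Qed.

Lemma scalar_spanZ k t c M : scalar_span k t M -> scalar_span k t (c *: M).
Proof.
move=> [d ->]; exists (fun a => c * d a).
by rewrite scaler_sumr; apply: eq_bigr => a _; rewrite scalerA.
Qed.

Lemma scalar_span_sum k t (I : Type) (r : seq I) (Pr : pred I) F :
  (forall l, Pr l -> scalar_span k t (F l)) -> scalar_span k t (\sum_(l <- r | Pr l) F l).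
Proof.
by move=> H; apply: big_ind => //; [apply: scalar_span0 | apply: scalar_spanD].
Qed.

Lemma scalar_span_scalW k t a : scalar_span k t (block k t *m scalW a).
Proof.
exists (fun b => (b == a)%:R); rewrite (bigD1 a) //= eqxx scale1r big1 ?addr0 //.
by move=> b /negPf->; rewrite scale0r.
Qed.

Lemma scalar_spanM k t M a : scalar_span k t M -> scalar_span k t (M *m scalW a).
Proof.
case=> c ->; rewrite mulmx_suml; apply: scalar_span_sum => b _.
by rewrite -scalemxAl -mulmxA -scalWM; apply/scalar_spanZ/scalar_span_scalW.
Qed.

Section Level.
Variable k : {set A}.
Hypotheses (ik : is_ideal k) (knz : k != [set 0]) (kk : {in k &, forall c d : A, c * d = 0}).
Local Notation j := (ann k).
Local Notation e := (block k).

Let ij : is_ideal j. Proof. exact: ann_ideal. Qed.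
Let jr : j \subset principal (unif A). Proof. exact: ann_proper. Qed.
Let kj : k \subset j. Proof. by apply/subsetP => c kc; apply/annP => d; apply: kk. Qed.

Lemma block_translate t z y : z \in idealV m k -> y \in idealV m j ->
  e t *m E (z + y) = mu2 (h z t) *: (e t *m E y).
Proof.
move=> kz jy; have := opED X z y; rewrite (h_ann_idealV h ik) // mu0 scale1r => <-.
by rewrite mulmxA block_opE // scalemxAl.
Qed.

Lemma block_fixed t g : g \in UV -> g t - t \in idealV m j -> e t *m W g = W g *m e t.
Proof. by move=> Ug gt; rewrite block_unitary // (block_congr X ik gt). Qed.

(** The congruence subgroup acts on every block by a scalar, through the
    character [alpha] up to a twist common to all blocks. *)
Lemma block_congruence g : g \in congruence_set h k ->
  exists c, forall v, e v *m W g = (c * mu (h (g v) v)) *: e v.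
Proof.
move=> Og; have /setIdP[Ug /forallP gk] := Og.
have jgt v : g v - v \in idealV m j by apply: idealVS kj (gk v).
have [|||c Ec] := @block_schur _ _ _ _ _ _ _ X spanX k 0 (e 0 *m W g) ik kk.
- by rewrite mulmxA block_idem.
- by rewrite -mulmxA -block_fixed // mulmxA block_idem.
- move=> u ju; rewrite -{1}(fixes_ann ik Og ju) -mulmxA -opEW // mulmxA.
  by rewrite block_opE_comm // mulmxA.
exists c => v; have Ev : e v = E (- v) *m e 0 *m E v.
  by rewrite -mulmxA block_shift add0r mulmxA opE_NK mul1mx.
have := opED X (g v - v) v; rewrite subrK => /(congr1 (fun M => mu (- h v (g v - v)) *: M)).
rewrite scalerA -muD addNr mu0 scale1r => Egv.
rewrite {1}Ev -mulmxA opEW // mulmxA -(mulmxA (E (- v))) Ec -Egv.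
rewrite -scalemxAr -scalemxAr -scalemxAl scalerA mulmxA -(mulmxA (E (- v)) (e 0)) block_opE //.
rewrite h0r mu20 scale1r -Ev mulrC; congr (_ * _ *: _).
by rewrite -muC hBl muD muN mu_form invr1 mulr1.
Qed.

Hypothesis jj : {in j &, forall c d : A, c * d \in k}.

Let jjV c u : c \in j -> u \in idealV m j -> c *: u \in idealV m k.
Proof. by move=> jc /(idealVP _ ij) ju; apply/idealVP => // l; rewrite mxE jj. Qed.

(** The scalars congruent to 1 act on a block as Heisenberg operators. *)
Lemma block_scalar t a : sgval a \in unitary_scalars_congr j ->
  exists c, e t *m E ((1 - (nval a)^-1) *: t) = c *: (e t *m scalW a).
Proof.
move=> /setIdP[_ ja]; rewrite -/(nval a) in ja.
have Ua : nval a \is a GRing.unit := valP (sgval a).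
have jav : (nval a)^-1 - 1 \in j.
  have -> : (nval a)^-1 - 1 = - ((nval a)^-1 * (nval a - 1)) by rewrite mulrBr mulVr // mulr1 opprB.
  by rewrite ideal_opp // ideal_mull.
have UA := scalar_of_UV h a.
have fixA : e t *m scalW a = scalW a *m e t.
  by apply: block_fixed => //; rewrite scalar_ofE -{2}[t]scale1r -scalerBl idealV_scale.
pose x := ((nval a)^-1 - 1) *: t; have jx : x \in idealV m j by apply: idealV_scale.
have [|||c Ec] := @block_schur _ _ _ _ _ _ _ X spanX k t (e t *m scalW a *m E x) ik kk.
- by rewrite !mulmxA block_idem.
- by rewrite -mulmxA -block_opE_comm // mulmxA -(mulmxA (e t)) -fixA mulmxA block_idem.
- move=> u ju; have Ecomm : E u *m scalW a = scalW a *m E (nval a *: u).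
    by rewrite /scalW opEW // scalar_ofE.
  have key : E u *m e t *m scalW a = mu2 (h ((nval a - 1) *: u) t) *: (e t *m scalW a *m E u).
    rewrite -block_opE_comm // -mulmxA Ecomm mulmxA fixA -mulmxA.
    have -> : nval a *: u = (nval a - 1) *: u + u by rewrite scalerBl scale1r subrK.
    by rewrite block_translate ?jjV // -scalemxAr mulmxA.
  rewrite !mulmxA key -scalemxAl -[_ *m E u *m E x]mulmxA (opE_comm X u x) -scalemxAr scalerA mulmxA.
  have bV : bar (nval a)^-1 = nval a by rewrite -bar_nval barK.
  rewrite -[LHS]scale1r; congr (_ *: _).
  have -> : h x u = sgn * bar (h ((nval a - 1) *: u) t).
    rewrite /x !hZl !rmorphB bV !rmorph1 bar_nval (hC h u t) !rmorphM rmorphB bV rmorph1.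
    by rewrite mulrCA.
  by rewrite !mu2E mu_sgn_bar mulrACA -muD subrr mu0 mulr1.
have Ec' : e t *m scalW a = c *: (e t *m E ((1 - (nval a)^-1) *: t)).
  rewrite scalemxAl -Ec -mulmxA.
  have -> : (1 - (nval a)^-1) *: t = - x by rewrite -scaleNr opprB.
  by rewrite opE_N mulmx1.
have [c0|cnz] := eqVneq c 0; last by exists c^-1; rewrite Ec' scalerA mulVf // scale1r.
have e0 : e t = 0.
  by apply: (opW_cancel UA); rewrite -/(scalW a) Ec' c0 scale0r.
by exists 0; rewrite e0 mul0mx scale0r.
Qed.

(** The centralizer of the stabilizer of a block in the operators on that block
    consists of scalars of norm one: averaging over the stabilizer kills every
    Heisenberg operator except those that scalars provide. *)
Lemma block_centralizer t T : t \in P -> e t *m T = T -> T *m e t = T ->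
  (forall g, g \in coset_stab h j t -> T *m W g = W g *m T) -> scalar_span k t T.
Proof.
move=> Pt eT Te cT; pose G := coset_stab h j t.
pose avg M := \sum_(g in G) W (g^-1)%g *m M *m W g.
have GU g : g \in G -> g \in UV by case/setIdP.
have avgT : avg T = #|G|%:R *: T.
  rewrite /avg (eq_bigr (fun _ => T)) ?sumr_const ?scaler_nat // => g Gg.
  by rewrite -mulmxA cT // mulmxA opWVK ?GU // mul1mx.
have avg_shift g M : g \in G -> avg (W (g^-1)%g *m M *m W g) = avg M.
  move=> Gg; rewrite [RHS](reindex_inj (mulgI g)) /=; apply: eq_big => [x|x Gx].
    by rewrite (groupMl x Gg).
  have Ux := GU _ Gx; have Ug := GU _ Gg.
  by rewrite invMg !opWM ?groupV // !mulmxA.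
suff avgS u : u \in idealV m j -> scalar_span k t (avg (e t *m E u)).
  have [c Ec] := block_corner_span spanX t T ik kk.
  rewrite eT Te in Ec.
  have -> : T = #|G|%:R^-1 *: avg T.
    by rewrite avgT scalerA mulVf ?scale1r // pnatr_eq0 -lt0n cardG_gt0.
  apply: scalar_spanZ; rewrite Ec /avg.
  have -> : \sum_(g in G) W (g^-1)%g *m (\sum_(u in idealV m j) c u *: (e t *m E u)) *m W g
      = \sum_(u in idealV m j) c u *: avg (e t *m E u).
    rewrite /avg; under eq_bigr do rewrite mulmx_sumr mulmx_suml.
    rewrite exchange_big; apply: eq_bigr => u _; rewrite scaler_sumr.
    by apply: eq_bigr => g _; rewrite -scalemxAr -scalemxAl.
  by apply: scalar_span_sum => u ju; apply/scalar_spanZ/avgS.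
move=> ju.
have [/existsP[g /and3P[Gg kg nz]]|/existsPn good] := boolP [exists g in G,
     (g u - u \in idealV m k) && (mu2 (h (g u - u) t) != 1)].
  have Ug := GU _ Gg; have /setIdP[_ gt] := Gg.
  have : avg (e t *m E u) = mu2 (h (g u - u) t) *: avg (e t *m E u).
    rewrite -{1}(avg_shift g) // {1}mulmxA -(mulmxA _ (E u)) opEW // mulmxA.
    rewrite -(mulmxA _ (e t)) block_fixed // mulmxA opWVK // mul1mx.
    rewrite -{1}[g u](subrK u) block_translate // /avg scaler_sumr.
    by apply: eq_bigr => x _; rewrite -scalemxAr -scalemxAl.
  move/eqP; rewrite -{1}[avg _]scale1r -subr_eq0 -scalerBl scaler_eq0 subr_eq0 eq_sym (negPf nz) /=.
  by move/eqP->; apply: scalar_span0.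
have [|a0 Na0 ua] := @good_vector _ _ _ _ _ _ w k t u ik knz kk jj Pt ju.
  move=> g Gg kg; have := good g; rewrite Gg kg /= negbK => /eqP.
  by rewrite /mu2.
have [a Ea] : exists a : N, sgval a = a0 by apply: subg_scalar; case/setIdP: Na0.
have Na : sgval a \in unitary_scalars_congr j by rewrite Ea.
rewrite -Ea in ua; have [c Ec] := block_scalar t Na.
have jy : (1 - (nval a)^-1) *: t \in idealV m j.
  by rewrite -(idealVDr _ (idealVS kj ua)) addrC subrK.
have -> : e t *m E u = mu2 (h (u - (1 - (nval a)^-1) *: t) t) *: (c *: (e t *m scalW a)).
  by rewrite -Ec -block_translate // subrK.
have -> : avg (mu2 (h (u - (1 - (nval a)^-1) *: t) t) *: (c *: (e t *m scalW a)))
    = mu2 (h (u - (1 - (nval a)^-1) *: t) t) *: (c *: (#|G|%:R *: (e t *m scalW a))).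
  rewrite /avg scaler_nat -sumr_const !scaler_sumr; apply: eq_bigr => g Gg.
  have Ug := GU _ Gg; have /setIdP[_ gt] := Gg.
  have fixM : W (g^-1)%g *m (e t *m scalW a) *m W g = e t *m scalW a.
    rewrite -mulmxA -(mulmxA (e t)) scalW_comm // (mulmxA (e t)) block_fixed //.
    by rewrite -(mulmxA (W g)) mulmxA opWVK // mul1mx.
  by rewrite -!scalemxAr -!scalemxAl fixM.
by do 3 apply: scalar_spanZ; apply: scalar_span_scalW.
Qed.

Lemma card_ratio_neq0 : #|idealV m k|%:R / #|{: V}|%:R != 0 :> C.
Proof.
rewrite mulf_neq0 ?invr_eq0 ?card_neq0 // pnatr_eq0 -lt0n; apply/card_gt0P.
by exists 0.
Qed.

(** An operator commuting with the unitary group moves a primitive block only by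
    scalars of norm one, since the blocks have distinct characters otherwise. *)
Lemma block_commutant t T : t \in P -> (forall g, g \in UV -> T *m W g = W g *m T) ->
  scalar_span k t (e t *m T).
Proof.
move=> Pt cT; rewrite -[T]mulmx1 (block_sum X ik) -scalemxAr -scalemxAr; apply: scalar_spanZ.
rewrite !mulmx_sumr; apply: scalar_span_sum => v _; rewrite mulmxA.
have [/existsP[g /andP[Og ne]]|/existsPn same] := boolP
    [exists g in congruence_set h k, mu (h (g t) t) != mu (h (g v) v)].
  have Ug : g \in UV by case/setIdP: Og.
  have [c Ec] := block_congruence Og.
  suff -> : e t *m T *m e v = 0 by apply: scalar_span0.
  have [c0|cnz] := eqVneq c 0.
    have := Ec t; rewrite c0 mul0r scale0r => /(opW_cancel Ug) ->.
    by rewrite !mul0mx.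
  have : (c * mu (h (g t) t)) *: (e t *m T *m e v) = (c * mu (h (g v) v)) *: (e t *m T *m e v).
    have gv : g v - v \in idealV m j.
      by apply: (idealVS kj); have /setIdP[_ /forallP] := Og; apply.
    transitivity (e t *m W g *m T *m e v); first by rewrite Ec -!scalemxAl.
    transitivity (e t *m T *m (e v *m W g)); last by rewrite Ec -scalemxAr.
    by rewrite (@block_fixed v g) // mulmxA -(mulmxA (e t) (W g)) -cT // mulmxA.
  move/eqP; rewrite -subr_eq0 -scalerBl -mulrBr scaler_eq0 mulf_eq0 (negPf cnz) subr_eq0 (negPf ne).
  by move/eqP.
have [|a0 Na0 jv] := @alpha_separates _ _ _ _ _ _ w k t v ik knz kk Pt.
  by move=> g Og; have := same g; rewrite Og /= negbK => /eqP.
have [a Ea] := subg_scalar Na0; rewrite -Ea in jv.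
have UA := scalar_of_UV h a.
have -> : e v = e (scalar_of m a t) by rewrite scalar_ofE; apply: block_congr.
have eW : scalW a *m e (scalar_of m a t) = e t *m scalW a by rewrite block_unitary.
have -> : e t *m T *m e (scalar_of m a t) = e t *m T *m scalW (a^-1)%g *m e t *m scalW a.
  by rewrite -[RHS]mulmxA -eW mulmxA -[_ *m scalW a]mulmxA -scalWM mulVg /scalW scalar_of1 opW1 mulmx1.
apply: scalar_spanM; apply: block_centralizer => //.
- by rewrite !mulmxA block_idem.
- by rewrite -!mulmxA block_idem.
move=> g /setIdP[Ug gt].
rewrite -mulmxA block_fixed // mulmxA -(mulmxA _ (scalW _)) scalW_comm // mulmxA.
by rewrite -(mulmxA (e t) T (W g)) cT // mulmxA block_fixed // !mulmxA.
Qed.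

End Level.
End Key.

Section LinChar.
Variables (C : numClosedFieldType) (gT : finGroupType) (phi : {ffun gT -> C}).
Hypothesis Lphi : linear_character phi.

Lemma lin1 : phi 1%g = 1. Proof. by case: Lphi. Qed.
Lemma linM x y : phi (x * y)%g = phi x * phi y. Proof. by case: Lphi. Qed.

Lemma lin_neq0 x : phi x != 0.
Proof.
apply/eqP => x0; have /eqP := linM x x^-1; rewrite x0 mul0r mulgV lin1.
by rewrite oner_eq0.
Qed.

Lemma linV x : phi (x^-1)%g = (phi x)^-1.
Proof. by apply: (mulfI (lin_neq0 x)); rewrite -linM mulgV lin1 divff ?lin_neq0. Qed.

End LinChar.

Section Eigen.
Variables (C : numClosedFieldType) (O : involutive_dvr) (A : framed_ring O) (m : nat).
Variables (h : herm_space A m) (i : {set A}) (w : weil_data C h i).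
Variable X : weil_system w.
Local Notation V := 'rV[A]_m.
Local Notation UV := (unitary_group h).
Local Notation mu := (mu w).
Local Notation mu2 := (mu2 w).
Local Notation bar := (@star O A).
Local Notation sgn := (sgn A).
Local Notation E := (opE X).
Local Notation W := (opW X).
Local Notation N := (subg_of (unitary_scalars A)).
Local Notation P := (primitive_vectors A m).
Local Notation block := (block X).
Local Notation scalW := (scalW X).
Implicit Types (k n : {set A}) (u v x y z t : V) (M T Q : 'M[C]_(wdim X)).
Implicit Types (phi : {ffun N -> C}).

(** The projection onto the eigenspace of a character of the scalars. *)
Definition eigproj phi : 'M[C]_(wdim X) :=
  locked (#|N|%:R^-1 *: \sum_a (phi a)^-1 *: scalW a).

Lemma eigprojE phi : eigproj phi = #|N|%:R^-1 *: \sum_a (phi a)^-1 *: scalW a.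
Proof. by rewrite /eigproj -lock. Qed.

Lemma cardN_neq0 : #|{: N}|%:R != 0 :> C.
Proof. by rewrite pnatr_eq0 -lt0n; apply/card_gt0P; exists 1%g. Qed.

Lemma eigproj_scalW phi a : linear_character phi ->
  eigproj phi *m scalW a = phi a *: eigproj phi.
Proof.
move=> Lphi; rewrite !eigprojE -scalemxAl scalerA mulrC -scalerA; congr (_ *: _).
rewrite mulmx_suml scaler_sumr [RHS](reindex_inj (mulIg a)) /=.
apply: eq_bigr => b _; rewrite -scalemxAl -scalWM scalerA linM // invfM mulrCA divff ?mulr1 //.
exact: lin_neq0.
Qed.

Lemma eigproj_comm phi g : g \in UV -> eigproj phi *m W g = W g *m eigproj phi.
Proof.
move=> Ug; rewrite eigprojE -scalemxAl -scalemxAr mulmx_suml mulmx_sumr; congr (_ *: _).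
by apply: eq_bigr => a _; rewrite -scalemxAl -scalemxAr scalW_comm.
Qed.

Lemma eigproj_cent phi M : (forall g, g \in UV -> M *m W g = W g *m M) ->
  M *m eigproj phi = eigproj phi *m M.
Proof.
move=> cM; rewrite eigprojE -scalemxAl -scalemxAr mulmx_suml mulmx_sumr; congr (_ *: _).
by apply: eq_bigr => a _; rewrite -scalemxAl -scalemxAr cM ?scalar_of_UV.
Qed.

Lemma scalW_eigproj phi a : linear_character phi ->
  scalW a *m eigproj phi = phi a *: eigproj phi.
Proof. by move=> Lphi; rewrite -eigproj_comm ?eigproj_scalW // scalar_of_UV. Qed.

Lemma eigproj_fix phi p (M : 'M_(p, wdim X)) : linear_character phi ->
  (forall a, M *m scalW a = phi a *: M) -> M *m eigproj phi = M.
Proof.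
move=> Lphi HM; rewrite eigprojE -scalemxAr mulmx_sumr.
rewrite (eq_bigr (fun _ => M)) => [|a _].
  by rewrite sumr_const -scaler_nat scalerA mulVf ?scale1r // cardN_neq0.
by rewrite -scalemxAr HM scalerA mulVf ?scale1r // lin_neq0.
Qed.

Lemma eigproj_idem phi : linear_character phi -> eigproj phi *m eigproj phi = eigproj phi.
Proof. by move=> Lphi; apply: eigproj_fix => // a; apply: eigproj_scalW. Qed.

Lemma eigproj_orth phi psi : linear_character phi -> linear_character psi -> phi != psi ->
  eigproj phi *m eigproj psi = 0.
Proof.
move=> Lphi Lpsi ne; have /existsP[a na] : [exists a, phi a != psi a].
  by rewrite -negb_forall; apply: contra ne => /forallP H; apply/eqP/ffunP => a; apply/eqP.
apply/eqP; have : (phi a - psi a) *: (eigproj phi *m eigproj psi) == 0.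
  rewrite scalerBl {1}scalemxAl -eigproj_scalW // -mulmxA scalW_eigproj //.
  by rewrite -scalemxAr subrr.
by rewrite scaler_eq0 subr_eq0 (negPf na).
Qed.

Lemma mu_sym_skew k (D : A) : is_ideal k -> D = sgn * bar D ->
  (forall s, s \in k -> bar s = - s -> mu (s * D) = 1) -> D \in ann k.
Proof.
move=> ik SD H; apply: (two_in (ann_ideal _)); apply: (mu_ann (w := w)) => // x kx.
have := H (x - bar x); rewrite ideal_sub ?star_ideal // rmorphB barK opprB => /(_ isT (erefl _)).
move=> <-; rewrite mulrBl mulrCA mulr_natl mulr2n !muD; congr (_ * _).
by rewrite -mu_sgn_bar rmorphM barK mulrCA -SD.
Qed.

Lemma skew_scalar k (s : A) : is_ideal k -> {in k &, forall c d : A, c * d = 0} ->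
  s \in k -> bar s = - s -> exists2 a : N, nval a = 1 + s & sgval a \in unitary_scalars_congr k.
Proof.
move=> ik kk ks Ss; have [|u Nu Eu] := @norm_one_unit _ A (1 + s).
  rewrite rmorphD rmorph1 Ss mulrDl mul1r mulrBr mulr1 kk // subr0.
  by rewrite subrK.
have [a Ea] := subg_scalar Nu; exists a; first by rewrite /nval Ea.
by rewrite Ea; apply/setIdP; split; rewrite // Eu addrC addKr.
Qed.

Lemma mu_alpha_scalar a t : mu (h (scalar_of m a t) t) = mu ((nval a)^-1 * h t t).
Proof. by rewrite scalar_ofE hZl bar_nval. Qed.

Definition primproj n : 'M[C]_(wdim X) := 1%:M - block n 0.

Lemma rad_proper : principal (unif A) != [set 0].
Proof. by rewrite -[unif A]expr1 principal_power_eq0 -ltnNge len_gt1. Qed.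

Lemma minimal_ideal_ideal n : minimal_ideal n -> is_ideal n /\ n != [set 0].
Proof. by case/minsetP => /andP[]. Qed.

Lemma minimal_sq0 n : minimal_ideal n -> {in n &, forall c d : A, c * d = 0}.
Proof.
move=> Mn c d nc nd; have [in_ nnz] := minimal_ideal_ideal Mn.
have : d \in ann n by rewrite (ann_minimal Mn) (subsetP (minimal_sub Mn (rad_ideal A) rad_proper)).
by move/annP => /(_ c nc); rewrite mulrC.
Qed.

Lemma block_minimal k n v : is_ideal k -> k != [set 0] ->
    {in k &, forall c d : A, c * d = 0} -> minimal_ideal n ->
  block k v *m block n 0 = if v \in P then 0 else block k v.
Proof.
move=> ik knz kk Mn; have [in_ nnz] := minimal_ideal_ideal Mn.
rewrite (blockE X n) -scalemxAr mulmx_sumr.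
rewrite (eq_bigr (fun z => mu2 (h z v) *: block k v)) => [|z nz]; last first.
  by rewrite h0r oppr0 mu20 scale1r block_opE // (idealVS _ nz) // (minimal_sub Mn).
rewrite -scaler_suml form_char_sum // (ann_minimal Mn) primitive_rad.
by case: ifP => _; rewrite ?scale0r ?scaler0 // scalerA mulVf ?scale1r // card_neq0.
Qed.

Lemma primproj_sum k n : is_ideal k -> k != [set 0] ->
    {in k &, forall c d : A, c * d = 0} -> minimal_ideal n ->
  primproj n = (#|idealV m k|%:R / #|{: V}|%:R) *: \sum_(v in P) block k v.
Proof.
move=> ik knz kk Mn; rewrite -[primproj n]mul1mx (block_sum X ik) -scalemxAl; congr (_ *: _).
rewrite mulmx_suml [RHS]big_mkcond; apply: eq_bigr => v _.
by rewrite mulmxBr mulmx1 block_minimal //; case: ifP; rewrite ?subr0 ?subrr.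
Qed.

Lemma primproj_comm n g : g \in UV -> primproj n *m W g = W g *m primproj n.
Proof.
by move=> Ug; rewrite mulmxBl mulmxBr mul1mx mulmx1 block_unitary // (unitary0 Ug).
Qed.

Lemma primproj_idem n : minimal_ideal n -> primproj n *m primproj n = primproj n.
Proof.
move=> Mn; have [in_ _] := minimal_ideal_ideal Mn.
rewrite /primproj mulmxBl mul1mx mulmxBr mulmx1 block_idem ?subrr ?subr0 //.
exact: minimal_sq0.
Qed.

(** The endomorphisms of the module act by scalars on the part of its top that
    belongs to one character of the scalars. *)
Hypothesis spanX : spanning X.

Lemma eigen_commutant n phi T : minimal_ideal n -> linear_character phi ->
    (forall g, g \in UV -> T *m W g = W g *m T) ->
  exists c, primproj n *m eigproj phi *m T = c *: (primproj n *m eigproj phi).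
Proof.
move=> Mn Lphi cT; have [k [ik knz kk jj]] := half_ideal A.
have kjS : k \subset ann k by apply/subsetP => c kc; apply/annP => d; apply: kk.
have scal t : t \in P -> exists c, block k t *m eigproj phi *m T = c *: (block k t *m eigproj phi).
  move=> Pt; have [c Ec] := block_commutant spanX ik knz kk jj Pt cT.
  exists (\sum_a c a * phi a).
  have -> : block k t *m eigproj phi *m T = block k t *m T *m eigproj phi.
    rewrite -!mulmxA; congr (_ *m _); rewrite eigprojE -scalemxAl -scalemxAr; congr (_ *: _).
    rewrite mulmx_suml mulmx_sumr; apply: eq_bigr => a _.
    by rewrite -scalemxAl -scalemxAr cT // scalar_of_UV.
  rewrite Ec mulmx_suml scaler_suml; apply: eq_bigr => a _.
  by rewrite -scalemxAl -mulmxA scalW_eigproj // -scalemxAr scalerA.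
have same t v : t \in P -> v \in P -> block k t *m eigproj phi != 0 ->
    block k v *m eigproj phi != 0 ->
  exists2 g, g \in UV & g t - v \in idealV m (ann k).
  move=> Pt Pv nt nv; apply: witt_congr => //; [exact: ann_ideal | exact: ann_proper|].
  apply: mu_sym_skew => // [|s ks Ss].
    by rewrite rmorphB mulrBr -!h_sym.
  have Sms : bar (- s) = - - s by rewrite rmorphN Ss.
  have kms : - s \in k by apply: ideal_opp.
  have [a Ea Na] := skew_scalar ik kk kms Sms.
  have Va : (nval a)^-1 = 1 + s by rewrite -bar_nval Ea rmorphD rmorph1 rmorphN Ss opprK.
  have Og : scalar_of m a \in congruence_set h k.
    apply/setIdP; split; first exact: scalar_of_UV.
    apply/forallP => x; rewrite scalar_ofE Ea scalerDl scale1r addrC addKr.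
    exact: idealV_scale.
  have [c Ec] := block_congruence spanX ik kk Og.
  have phiE x : block k x *m eigproj phi != 0 -> phi a = c * mu (s * h x x).
    move=> nx; have := congr1 (mulmx^~ (eigproj phi)) (Ec x).
    rewrite /= -mulmxA -/(scalW a) scalW_eigproj // -scalemxAl -scalemxAr => /eqP.
    rewrite -subr_eq0 -scalerBl scaler_eq0 (negPf nx) orbF subr_eq0 => /eqP ->.
    by rewrite mu_alpha_scalar Va mulrDl mul1r muD mu_form mul1r.
  have cnz : c != 0.
    by have := lin_neq0 Lphi a; rewrite (phiE t nt) mulf_eq0 negb_or => /andP[].
  rewrite mulrBr muD muN; have := phiE v nv; rewrite (phiE t nt) => /(mulfI cnz) ->.
  by rewrite divff // mu_neq0.
suff [c Hc] : exists c, forall v, v \in P -> block k v *m eigproj phi *m T = c *: (block k v *m eigproj phi).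
  exists c; rewrite (primproj_sum ik knz kk Mn); move: (_ / _) => r; rewrite -!scalemxAl scalerA mulrC -scalerA; congr (_ *: _).
  rewrite !mulmx_suml scaler_sumr; apply: eq_bigr => v Pv; exact: Hc.
have [/existsP[t /andP[Pt nt]]|/existsPn none] := boolP [exists t in P, block k t *m eigproj phi != 0].
  have [c Hc] := scal t Pt; exists c => v Pv.
  have [v0|nv] := eqVneq (block k v *m eigproj phi) 0; first by rewrite v0 mul0mx scaler0.
  have [g Ug gt] := same t v Pt Pv nt nv.
  have Eg : block k t *m W g = W g *m block k v.
    by rewrite block_unitary // (block_congr X ik gt).
  have move_g : block k t *m eigproj phi *m W g = W g *m (block k v *m eigproj phi).
    by rewrite -mulmxA eigproj_comm // !mulmxA Eg.
  have Ev : block k v *m eigproj phi = W (g^-1)%g *m (block k t *m eigproj phi *m W g).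
    by rewrite move_g mulmxA opWVK // mul1mx.
  by rewrite Ev -[LHS]mulmxA -[_ *m W g *m T]mulmxA -cT // [_ *m (T *m _)]mulmxA Hc -scalemxAl -scalemxAr.
by exists 0 => v Pv; have := none v; rewrite Pv /= negbK => /eqP ->; rewrite mul0mx scaler0.
Qed.

End Eigen.

Section Affords.
Variables (F : fieldType) (gT : finGroupType) (G : {group gT}).
Local Notation reprG := (mx_representation F G).

(** The representation [r] is isomorphic to the one on the row space of [e]. *)
Definition affords n N (r : reprG n) (R : reprG N) (e : 'M[F]_N) : Prop :=
  exists psi : 'M_(n, N),
    [/\ row_free psi, forall g, g \in G -> r g *m psi = psi *m R g & (psi :=: e)%MS].

Lemma affords_submod N (R : reprG N) (U : 'M_N) (modU : mxmodule R U) :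
  affords (submod_repr modU) R U.
Proof.
exists (val_submod 1%:M); split.
- by rewrite /row_free val_submod1.
- by move=> g Gg; rewrite -val_submodE -val_submodJ // mul1mx.
- exact: val_submod1.
Qed.

Lemma affords_rsim n n' N (r : reprG n) (r' : reprG n') (R : reprG N) e :
  affords r R e -> affords r' R e -> mx_rsim r r'.
Proof.
move=> [psi [fr eq im]] [psi' [fr' eq' im']].
have Bpsi : psi *m pinvmx psi' *m psi' = psi by rewrite mulmxKpV // im im'.
exists (psi *m pinvmx psi').
- by rewrite -(eqP fr) -(eqP fr') im im'.
- by rewrite -row_leq_rank -{1}(eqP fr) -{1}Bpsi mxrankM_maxl.
move=> g Gg; apply: (row_free_inj fr'); rewrite -[LHS]mulmxA Bpsi.
by rewrite -[RHS]mulmxA eq' // [RHS]mulmxA Bpsi eq.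
Qed.

Lemma affords_irr n N (r : reprG n) (R : reprG N) e : affords r R e -> e != 0 ->
    (forall U : 'M_N, mxmodule R U -> (U <= e)%MS -> U != 0 -> (e <= U)%MS) ->
  mx_irreducible r.
Proof.
move=> [psi [fr eq im]] enz H; apply/mx_irrP; split=> [|U modU Unz].
  rewrite lt0n; apply: contraNneq enz => n0; rewrite -mxrank_eq0 -im -leqn0 -n0.
  exact: rank_leq_row.
have Up : (<<U *m psi>> :=: U *m psi)%MS by apply: genmxE.
have /H : mxmodule R <<U *m psi>>%MS.
  apply/mxmoduleP => g Gg; rewrite (eqmxMr _ Up) Up -mulmxA -eq // mulmxA submxMr //.
  exact: (mxmoduleP modU).
rewrite -sub1mx -(submxMfree _ _ fr) mul1mx !Up im; apply.
  by rewrite (submx_trans (submxMl _ _)) // im.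
by rewrite -mxrank_eq0 Up mxrankMfree // mxrank_eq0.
Qed.

Lemma affords_eqmx n N (r : reprG n) (R : reprG N) e e' :
  (e :=: e')%MS -> affords r R e -> affords r R e'.
Proof. by move=> ee [psi [fr eq im]]; exists psi; split=> //; apply: eqmx_trans im ee. Qed.

Lemma rank_orth_idem (I : eqType) (s : seq I) N (e : I -> 'M[F]_N) : uniq s ->
    {in s &, forall i j, e i *m e j = if i == j then e i else 0} ->
  \rank (\sum_(i <- s) e i)%MS = (\sum_(i <- s) \rank (e i))%N.
Proof.
elim: s => [|i s IHs] /=; first by rewrite !big_nil mxrank0.
case/andP => nis us orth; rewrite !big_cons mxrank_disjoint_sum.
  by rewrite IHs // => j l js ls; apply: orth; rewrite inE ?js ?ls orbT.
apply/eqP; rewrite -submx0; apply/rV_subP => v; rewrite sub_capmx => /andP[/submxP[u vi] vs].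
have v0 : v *m e i = 0.
  apply/eqP; rewrite -sub_kermx; apply: submx_trans vs _.
  rewrite big_seq; elim/big_rec: _ => [|j f js IH]; first exact: sub0mx.
  rewrite addsmx_sub IH andbT sub_kermx orth ?mem_head ?inE ?js ?orbT //.
  by rewrite ifN //; apply: contraNneq nis => <-.
have -> : v = v *m e i by rewrite vi -mulmxA orth ?mem_head // eqxx.
by rewrite v0 sub0mx.
Qed.

(** Orthogonal idempotents that commute with the group and sum to a projection
    decompose any representation isomorphic to the image of that projection. *)
Lemma affords_direct_sum (I : eqType) (s : seq I) n N (r : reprG n) (R : reprG N)
    (eta : 'M_N) (e : I -> 'M_N) (k : I -> nat) (rI : forall i, reprG (k i)) :
    uniq s -> affords r R eta -> eta = \sum_(i <- s) e i ->
    {in s &, forall i j, e i *m e j = if i == j then e i else 0} ->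
    (forall i g, g \in G -> e i *m R g = R g *m e i) ->
    (forall i, i \in s -> affords (rI i) R (e i)) ->
  is_direct_sum r s rI.
Proof.
move=> us [psi [fr eq im]] Eeta orth comm aff.
have e_eta i : i \in s -> e i *m eta = e i.
  move=> si; rewrite Eeta mulmx_sumr (bigD1_seq i) //= orth // eqxx.
  rewrite big_seq_cond big1 ?addr0 // => j /andP[sj ji].
  by rewrite orth // eq_sym (negPf ji).
have eta_e i : i \in s -> eta *m e i = e i.
  move=> si; rewrite Eeta mulmx_suml (bigD1_seq i) //= orth // eqxx.
  rewrite big_seq_cond big1 ?addr0 // => j /andP[sj ji].
  by rewrite orth // (negPf ji).
have eta2 : eta *m eta = eta.
  by rewrite {2}Eeta mulmx_sumr [RHS]Eeta big_seq [RHS]big_seq; apply: eq_bigr => i; apply: eta_e.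
have eta_comm g : g \in G -> eta *m R g = R g *m eta.
  by move=> Gg; rewrite Eeta mulmx_suml mulmx_sumr; apply: eq_bigr => i _; apply: comm.
have psi_eta : psi *m eta = psi.
  have : (psi <= eta)%MS by rewrite im.
  by case/submxP => D ->; rewrite -mulmxA eta2.
pose W i := psi *m e i *m eta *m pinvmx psi.
have Wpsi i : W i *m psi = psi *m e i *m eta by rewrite mulmxKpV // im submxMl.
have Wcomm i g : g \in G -> W i *m r g = r g *m W i.
  move=> Gg; apply: (row_free_inj fr); transitivity (psi *m R g *m e i *m eta).
    rewrite -[LHS]mulmxA eq // [LHS]mulmxA Wpsi -[LHS]mulmxA eta_comm // [LHS]mulmxA.
    by rewrite -(mulmxA psi) comm // mulmxA.
  by rewrite -[RHS]mulmxA Wpsi !mulmxA eq.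
have modW i : mxmodule r (W i).
  by apply/mxmoduleP => g Gg; rewrite Wcomm // submxMl.
have Worth : {in s &, forall i j, W i *m W j = if i == j then W i else 0}.
  move=> i j si sj; apply: (row_free_inj fr); rewrite -mulmxA Wpsi !mulmxA Wpsi.
  rewrite -(mulmxA psi) e_eta // -(mulmxA psi) orth //; case: eqP => _; last first.
    by rewrite mulmx0 !mul0mx.
  by rewrite Wpsi.
have Wsum : \sum_(i <- s) W i = 1%:M.
  apply: (row_free_inj fr); rewrite mul1mx mulmx_suml -[RHS]psi_eta.
  rewrite [in RHS]Eeta mulmx_sumr big_seq [RHS]big_seq; apply: eq_bigr => i si.
  by rewrite Wpsi -mulmxA e_eta.
exists W, modW; split=> [||i si].
- by rewrite mxdirectE /=; apply/eqP; rewrite rank_orth_idem.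
- apply/eqmxP; rewrite submx1 /= -Wsum.
  have Wbig (t : seq I) : ((\sum_(i <- t) W i)%R <= \sum_(i <- t) W i)%MS.
    elim: t => [|j t IH]; first by rewrite big_nil sub0mx.
    rewrite [X in (X <= _)%MS]big_cons [X in (_ <= X)%MS]big_cons.
    exact: addmx_sub_adds (submx_refl _) IH.
  exact: Wbig.
have Wim : (W i *m psi :=: e i)%MS.
  apply/eqmxP; rewrite Wpsi -mulmxA e_eta // submxMl /=.
  by rewrite -{1}(eta_e i si) submxMr // im.
apply: (@affords_rsim _ _ _ _ _ r (W i)); last exact: affords_submod.
have [phi [frp eqp imp]] := aff i si.
have Bphi : phi *m pinvmx psi *m psi = phi.
  by rewrite mulmxKpV // im imp -(e_eta i si) submxMl.
exists (phi *m pinvmx psi); split.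
- by rewrite -row_leq_rank -{1}(eqP frp) -{1}Bphi mxrankM_maxl.
- move=> g Gg; apply: (row_free_inj fr).
  by rewrite -[LHS]mulmxA Bphi eqp // -[RHS]mulmxA eq // [RHS]mulmxA Bphi.
by apply/eqmxP; rewrite -!(submxMfree _ _ fr) Bphi !Wim !imp submx_refl.
Qed.

End Affords.

Lemma rank_sums_leq (F : fieldType) (I : finType) p (M : I -> 'M[F]_p) c :
  (forall l, \rank (M l) <= c)%N -> (\rank (\sum_l M l)%MS <= #|I| * c)%N.
Proof.
move=> H; rewrite -sum_nat_const; elim/big_rec2: _ => [|l k N _ IH].
  by rewrite mxrank0.
by apply: leq_trans (mxrank_adds_leqif _ _) _; rewrite leq_add.
Qed.

Section Induced.
Variables (F : fieldType) (gT : finGroupType) (G H : {group gT}).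
Variables (n : nat) (rH : mx_representation F H n).
Hypothesis sHG : H \subset G.
Local Notation rI := (ind_repr rH sHG).
Local Notation dimI := (\sum_(i < #|rcosets H G|) n)%N.

Lemma dim_ind : dimI = (#|G : H| * n)%N.
Proof. by rewrite sum_nat_const card_ord. Qed.

Let incl i : 'M[F]_(n, dimI) := submxcol (p_ := fun=> n) 1%:M i.

Let incl_mul p (M : 'M[F]_(dimI, p)) i : incl i *m M = submxcol (p_ := fun=> n) M i.
Proof. by rewrite /incl submxcol_mul mul1mx. Qed.

Let incl_ind i g l : (coset_rep i * g)%g \in (H :* coset_rep l)%g ->
  incl i *m rI g = rH (coset_rep i * g * (coset_rep l)^-1)%g *m incl l.
Proof.
rewrite mem_rcoset => Hy; rewrite incl_mul /= /ind_mx mxblockEv mxcolK.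
rewrite -[LHS]mulmx1 -[1%:M](submxcolK (p_ := fun=> n)) mul_mxrow_mxcol [LHS](bigD1 l) //= Hy.
rewrite [X in _ + X = _]big1 ?addr0 // => j jl; rewrite (coset_rep_in sHG) ifN ?mul0mx //.
rewrite (coset_rep_in sHG) in Hy.
by rewrite (eqP Hy) (inj_eq enum_val_inj) eq_sym.
Qed.

Let coset_index x : x \in G -> exists l : 'I_#|rcosets H G|, x \in (H :* coset_rep l)%g.
Proof.
move=> Gx; have Cx : (H :* x)%g \in rcosets H G by rewrite mem_rcosets mulSGid.
exists (enum_rank_in Cx (H :* x)%g).
have [_ <-] := coset_repP sHG (enum_rank_in Cx (H :* x)%g).
by rewrite enum_rankK_in // rcoset_refl.
Qed.

(** Frobenius reciprocity: the induced module is generated by a copy of the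
    inducing one, and is universal among modules that contain such a copy. *)
Lemma ind_frobenius : exists B : 'M[F]_(n, dimI),
  [/\ row_free B, forall x, x \in H -> B *m rI x = rH x *m B,
      (1%:M <= \sum_(l < #|rcosets H G|) <<B *m rI (coset_rep l)>>)%MS
    & forall p (rG : mx_representation F G p) (D : 'M_(n, p)),
        (forall x, x \in H -> D *m rG x = rH x *m D) ->
      exists2 Phi : 'M_(dimI, p), forall x, x \in G -> rI x *m Phi = Phi *m rG x & B *m Phi = D].
Proof.
have [l0] := coset_index (group1 G); rewrite mem_rcoset mul1g => H0i.
have H0 : coset_rep l0 \in H by rewrite -groupV.
pose B := rH (coset_rep l0)^-1%g *m incl l0; exists B.
have GH x : x \in H -> x \in G := subsetP sHG x.
have Grep (l : 'I_#|rcosets H G|) : coset_rep l \in G by case: (coset_repP sHG l).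
have BE x (l : 'I_#|rcosets H G|) : x \in G -> x \in (H :* coset_rep l)%g -> B *m rI x = rH (x * (coset_rep l)^-1)%g *m incl l.
  rewrite mem_rcoset => Gx Hx; have Hy : (coset_rep l0 * x)%g \in (H :* coset_rep l)%g.
    by rewrite mem_rcoset -mulgA groupM.
  rewrite /B -mulmxA (incl_ind Hy) mulmxA -(mulgA _ x) (repr_mxM rH H0 Hx) mulmxA.
  by rewrite -repr_mxM ?groupV // mulVg repr_mx1 mul1mx.
split=> [|x Hx||p rG D HD].
- apply/row_freeP; exists (\mxcol_l (if l == l0 then rH (coset_rep l0) else 0) : 'M_(dimI, n)).
  rewrite /B -mulmxA incl_mul mxcolK eqxx -repr_mxM ?groupV //.
  by rewrite mulVg repr_mx1.
- rewrite (BE _ l0) ?GH //; last by rewrite mem_rcoset groupM.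
  by rewrite repr_mxM // mulmxA.
- rewrite -[X in (X <= _)%MS](submxcolK (p_ := fun=> n)) eqmx_col; apply/sumsmx_subP => l _.
  rewrite genmxE (sumsmx_sup l) // genmxE (BE _ l) ?rcoset_refl //.
  by rewrite mulgV repr_mx1 mul1mx.
pose Phi := \mxcol_i (D *m rG (coset_rep i)) : 'M_(dimI, p).
have Phi_incl l : incl l *m Phi = D *m rG (coset_rep l) by rewrite incl_mul mxcolK.
exists Phi => [x Gx|]; last first.
  rewrite /B -mulmxA Phi_incl mulmxA -HD ?groupV // -mulmxA -repr_mxM ?groupV //.
  by rewrite mulVg repr_mx1 mulmx1.
apply/(mxcolP (p_ := fun=> n)) => l; rewrite -!incl_mul !mulmxA Phi_incl.
have [l' Hl'] := coset_index (groupM (Grep l) Gx).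
rewrite (incl_ind Hl') -mulmxA Phi_incl mulmxA -HD; last by rewrite -mem_rcoset.
rewrite -!mulmxA -!repr_mxM ?groupM ?groupV //.
by rewrite mulgKV.
Qed.

(** A copy of the inducing module whose translates by the cosets other than the
    subgroup are killed by an operator [f] fixing the copy generates the induced
    module. *)
Lemma ind_embed p (rG : mx_representation F G p) (D : 'M_(n, p)) (f : 'M_p) :
    row_free D -> (forall x, x \in H -> D *m rG x = rH x *m D) ->
    D *m f = D -> (forall x, x \in G -> x \notin H -> D *m rG x *m f = 0) ->
  affords rI rG (\sum_(x in G) <<D *m rG x>>)%MS.
Proof.
move=> frD HD Df Dx0; have [B [_ BH Bgen univ]] := ind_frobenius.
have [Phi PhiG BPhi] := univ p rG D HD.
have Grep (l : 'I_#|rcosets H G|) : coset_rep l \in G by case: (coset_repP sHG l).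
have BrPhi x : x \in G -> B *m rI x *m Phi = D *m rG x.
  by move=> Gx; rewrite -mulmxA PhiG // mulmxA BPhi.
exists Phi; split=> //.
  rewrite -kermx_eq0; apply/eqP/row_matrixP => r; rewrite row0.
  set v := row r _; have vPhi : v *m Phi = 0 by rewrite -row_mul mulmx_ker row0.
  have /sub_sumsmxP[K EK] := submx_trans (submx1 v) Bgen.
  rewrite EK [LHS]big1 // => l0 _.
  have /submxP[k Ek] : (K l0 *m <<B *m rI (coset_rep l0)>> <= B *m rI (coset_rep l0))%MS.
    by rewrite (submx_trans (submxMl _ _)) // genmxE.
  suff -> : K l0 *m <<B *m rI (coset_rep l0)>>%MS = 0 by [].
  have Gl0 := Grep l0.
  have := congr1 (mulmx^~ (rG (coset_rep l0)^-1%g *m f)) vPhi.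
  rewrite /= mul0mx {1}EK mulmx_suml mulmx_suml [LHS](bigD1 l0) //= [X in _ + X]big1 ?addr0 => [|l ll0].
    rewrite Ek -[k *m _ *m Phi]mulmxA BrPhi // -!mulmxA (mulmxA (rG _)) -repr_mxM ?groupV //.
    rewrite mulgV repr_mx1 mul1mx Df => kD0.
    have k0 : k = 0 by apply: (row_free_inj frD); rewrite mul0mx.
    by rewrite k0 mul0mx.
  have /submxP[k' ->] : (K l *m <<B *m rI (coset_rep l)>> <= B *m rI (coset_rep l))%MS.
    by rewrite (submx_trans (submxMl _ _)) // genmxE.
  rewrite -[k' *m _ *m Phi]mulmxA BrPhi // -!mulmxA (mulmxA (rG _)) -repr_mxM ?groupV //.
  have nH : (coset_rep l * (coset_rep l0)^-1)%g \notin H.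
    rewrite (coset_rep_in sHG); have [_ <-] := coset_repP sHG l.
    by rewrite (inj_eq enum_val_inj).
  by rewrite (mulmxA D) (Dx0 _ _ nH) ?mulmx0 // groupM ?groupV.
apply/eqmxP/andP; split.
  rewrite -[Phi]mul1mx; apply: submx_trans (submxMr _ Bgen) _; rewrite sumsmxMr_gen.
  apply/sumsmx_subP => l _; rewrite genmxE (eqmxMr _ (genmxE _)) BrPhi //.
  by rewrite (sumsmx_sup (coset_rep l)) // genmxE.
by apply/sumsmx_subP => x Gx; rewrite genmxE -BrPhi // submxMl.
Qed.

(** Inducing is faithful on submodules, so an irreducible induced module comes
    from an irreducible one. *)
Lemma ind_irr : mx_irreducible rI -> mx_irreducible rH.
Proof.
case/mx_irrP => dim0 irr; have [B [frB BH Bgen _]] := ind_frobenius.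
have n0 : (0 < n)%N by move: dim0; rewrite dim_ind muln_gt0 => /andP[].
apply/mx_irrP; split=> // U modU Unz.
have Grep (l : 'I_#|rcosets H G|) : coset_rep l \in G by case: (coset_repP sHG l).
pose S := (\sum_(l < #|rcosets H G|) <<U *m B *m rI (coset_rep l)>>)%MS.
have subS x : x \in G -> (U *m B *m rI x <= S)%MS.
  move=> Gx; have [l] := coset_index Gx; rewrite mem_rcoset => Hx.
  rewrite (sumsmx_sup l) // genmxE -[x](mulgKV (coset_rep l)) (repr_mxM rI) ?Grep //.
    rewrite mulmxA submxMr // -mulmxA BH // mulmxA submxMr //.
    exact: (mxmoduleP modU).
  by rewrite groupM ?groupV.
have modS : mxmodule rI S.
  apply/mxmoduleP => x Gx; rewrite sumsmxMr; apply/sumsmx_subP => l _.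
  by rewrite (eqmxMr _ (genmxE _)) -mulmxA -repr_mxM // subS // groupM.
have Snz : S != 0.
  apply: contraNneq Unz => S0; have := subS 1%g (group1 G).
  rewrite S0 submx0 repr_mx1 mulmx1 => /eqP UB0.
  by apply/eqP/(row_free_inj frB); rewrite mul0mx.
have := irr S modS Snz; rewrite /row_full eqn_leq rank_leq_col /= => le; rewrite /row_full eqn_leq rank_leq_col /=.
have idx0 : (0 < #|G : H|)%N by apply: indexg_gt0.
rewrite -(leq_pmul2l idx0) -dim_ind.
apply: leq_trans le _; rewrite -[#|G : H|]card_ord; apply: rank_sums_leq => l.
by rewrite mxrank_gen -mulmxA mxrankM_maxl.
Qed.

End Induced.

Section Model.
Variables (C : numClosedFieldType) (O : involutive_dvr) (A : framed_ring O) (m : nat).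
Variables (h : herm_space A m) (i : {set A}) (w : weil_data C h i).
Local Notation V := 'rV[A]_m.
Local Notation UV := (unitary_group h).
Local Notation R := (fixed_ring (@star O A)).
Local Notation mu := (mu w).
Local Notation J := (jacobi h).
Local Notation s1 := (sdpair1 (heis_groupAction h)).
Local Notation s2 := (sdpair2 (heis_groupAction h)).
Local Notation X := (Xrep w).
Local Notation Z := (Zrep w).
Implicit Types (u v : V) (x y : heis h) (r : R).

Lemma pair_sdpair1 x : pair_of_sd (s1 x) = (1%g, x).
Proof. by apply: insubdK; rewrite inE group1 inE. Qed.

Lemma pair_sdpair2 g : g \in UV -> pair_of_sd (s2 g) = (g, 1%g).
Proof. by move=> Ug; apply: insubdK; rewrite inE Ug inE. Qed.

Lemma mem_jacobi_sub1 x : x.2 \in Uperp m i -> s1 x \in jacobi_sub h (ann i).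
Proof. by move=> Ux; rewrite inE pair_sdpair1 inE. Qed.

Lemma mem_jacobi_sub2 g : g \in UV -> s2 g \in jacobi_sub h (ann i).
Proof. by move=> Ug; rewrite inE pair_sdpair2 // inE idealV0. Qed.

Lemma Zrep1 x : Z (s1 x) = Srep w x.
Proof. by rewrite /= /Zmx pair_sdpair1 /= morph1 (repr_mx1 (Wrep w)) mul1mx. Qed.

Lemma Zrep2 g : g \in UV -> Z (s2 g) = Wrep w (restr_perm (Uperp m i) g).
Proof. by move=> Ug; rewrite /= /Zmx pair_sdpair2 //= (repr_mx1 (Srep w)) mulmx1. Qed.

Lemma XM (x y : J) : X x *m X y = X (x * y)%g.
Proof. by rewrite (repr_mxM X) ?inE. Qed.

Lemma s1M x y : (s1 x * s1 y)%g = s1 (heis_law y x).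
Proof. by rewrite -morphM ?inE. Qed.

Lemma s1s2 x g : g \in UV -> (s1 x * s2 g)%g = (s2 g * s1 (heis_act x g))%g.
Proof.
move=> Ug; rewrite -[heis_act x g]/(heis_groupAction h x g) sdpair_act ?in_setT //.
by rewrite conjgE mulKVg.
Qed.

Definition hE v := X (s1 (0, v)).

Lemma s1_split r v : s1 (r, v) = (s1 (r, 0) * s1 (0, v))%g.
Proof. by rewrite s1M /heis_law /= fform0r !addr0 add0r. Qed.

Lemma jacobi_split (x : J) : exists2 g, g \in UV & exists y, x = (s2 g * s1 y)%g.
Proof.
exists (pair_of_sd x).1; first by case: x => [[g y] gx] /=; have /setXP[] := gx.
by exists (pair_of_sd x).2; apply: sdpairE.
Qed.

Lemma center_s1 r (x : J) : (x * s1 (r, 0) = s1 (r, 0) * x)%g.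
Proof.
have [g Ug [y ->]] := jacobi_split x.
rewrite -mulgA s1M [RHS]mulgA s1s2 // -mulgA s1M.
congr (_ * s1 _)%g; rewrite /heis_law /heis_act /= (unitary0 Ug).
by rewrite fform0l fform0r !addr0 add0r addrC.
Qed.

(** The copy of the inducing module inside the Weil module. *)
Lemma base_block : exists B : 'M[C]_(zdim w, _),
  [/\ row_free B, forall u, u \in Uperp m i -> B *m hE u = Srep w ((0, u) : heis h) *m B,
      forall g, g \in UV -> B *m weil_repr w g = Wrep w (restr_perm (Uperp m i) g) *m B,
      forall r, X (s1 (r, 0)) = (lambda w r)%:M
    & (1%:M <= \sum_v <<B *m hE v>>)%MS].
Proof.
have [B [frB BH Bgen _]] := ind_frobenius Z (subsetT _).
have Bc r : B *m X (s1 (r, 0)) = lambda w r *: B.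
  rewrite BH; last by apply: mem_jacobi_sub1; apply: idealV0.
  by rewrite Zrep1 Srep_scalar ?idealV0 // mul_scalar_mx.
have cent r : X (s1 (r, 0)) = (lambda w r)%:M.
  apply/eqP; rewrite -subr_eq0 -[_ - _]mul1mx -submx0.
  apply: submx_trans (submxMr _ Bgen) _; rewrite sumsmxMr; apply/sumsmx_subP => l _; move: (coset_rep l) => x.
  rewrite (eqmxMr _ (genmxE _)) submx0 mulmxBr -mulmxA XM center_s1 -XM mulmxA.
  by rewrite Bc -scalemxAl mul_mx_scalar subrr.
exists B; split=> // [u Uu|g Ug|].
- by rewrite BH ?Zrep1 // mem_jacobi_sub1.
- by rewrite /= /weil_mx BH ?Zrep2 // mem_jacobi_sub2.
apply: submx_trans Bgen _; apply/sumsmx_subP => l _; move: (coset_rep l) => x; rewrite genmxE.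
have [g Ug [[r v] ->]] := jacobi_split x.
rewrite s1_split -XM mulmxA BH ?mem_jacobi_sub2 // -XM cent.
rewrite mul_scalar_mx -scalemxAr -mulmxA scalemx_sub // (submx_trans (submxMl _ _)) //.
by rewrite (sumsmx_sup v) // genmxE.
Qed.

Lemma hE0 : hE 0 = 1%:M.
Proof. by rewrite /hE -[(0, 0)]/(1%g : heis h) morph1 (repr_mx1 X). Qed.

Lemma hED u v : hE u *m hE v = mu (h v u) *: hE (u + v).
Proof.
have [_ [_ _ _ cent _]] := base_block.
have EL : heis_law ((0, v) : heis h) ((0, u) : heis h) = (fform h v u, u + v).
  by rewrite /heis_law /= !add0r addrC.
by rewrite /hE XM s1M EL s1_split -XM cent mul_scalar_mx.
Qed.

Lemma hEW g v : g \in UV -> hE v *m weil_repr w g = weil_repr w g *m hE (g v).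
Proof. by move=> Ug; rewrite /= /weil_mx /hE !XM s1s2. Qed.

(** The Weil module as a system of Heisenberg and unitary operators. *)
Definition Xsys : weil_system w := WeilSystem hE0 hED hEW.

Lemma base_blockX : exists B : 'M[C]_(zdim w, wdim Xsys),
  [/\ row_free B, forall u, u \in Uperp m i -> B *m opE Xsys u = Srep w ((0, u) : heis h) *m B,
      forall g, g \in UV -> B *m opW Xsys g = Wrep w (restr_perm (Uperp m i) g) *m B
    & (1%:M <= \sum_v <<B *m opE Xsys v>>)%MS].
Proof. by have [B [fB BE BW _ Bg]] := base_block; exists B; split; [exact: fB|exact: BE|exact: BW|exact: Bg]. Qed.

End Model.

Local Opaque Xsys.

Section Model.
Variables (C : numClosedFieldType) (O : involutive_dvr) (A : framed_ring O) (m : nat).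
Variables (h : herm_space A m) (i : {set A}) (w : weil_data C h i).
Local Notation V := 'rV[A]_m.
Local Notation UV := (unitary_group h).
Local Notation R := (fixed_ring (@star O A)).
Local Notation mu := (mu w).
Local Notation J := (jacobi h).
Local Notation s1 := (sdpair1 (heis_groupAction h)).
Local Notation s2 := (sdpair2 (heis_groupAction h)).
Local Notation X := (Xrep w).
Local Notation Z := (Zrep w).
Implicit Types (u v : V) (x y : heis h) (r : R).

Local Notation Xsys := (Xsys w).
Local Notation E := (opE Xsys).
Local Notation "'e_' v" := (block Xsys i v) (at level 8, v at level 2).

Lemma Srep_split r u : u \in Uperp m i -> Srep w ((r, u) : heis h) = lambda w r *: Srep w ((0, u) : heis h).
Proof.
move=> Uu; have -> : ((r, u) : heis h) = (((r, 0) : heis h) * ((0, u) : heis h))%g.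
  by rewrite heis_mulE /heis_law /= fform0r !addr0 add0r.
rewrite (repr_mxM (Srep w)) ?inE ?idealV0 // Srep_scalar ?idealV0 //.
by rewrite mul_scalar_mx.
Qed.

Section IdealHyps.
Hypotheses (ii : is_ideal i) (inz : i != [set 0]) (i2 : {in i &, forall c d : A, c * d = 0}).

Lemma ideal_sub_ann : i \subset ann i.
Proof. by apply/subsetP => c ic; apply/annP => d; apply: i2. Qed.

(** The copy of the inducing module is the block of the zero vector. *)
Lemma base_block0 : exists B : 'M[C]_(zdim w, wdim Xsys),
  [/\ row_free B, forall u, u \in Uperp m i -> B *m E u = Srep w ((0, u) : heis h) *m B,
      forall g, g \in UV -> B *m opW Xsys g = Wrep w (restr_perm (Uperp m i) g) *m B
    & (B :=: e_ 0)%MS].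
Proof.
have [B [frB BE BW Bgen]] := base_blockX w; exists B; split; [exact: frB | exact: BE | exact: BW | ].
have Uj u : u \in idealV m i -> u \in Uperp m i := idealVS ideal_sub_ann.
have Bz z : z \in idealV m i -> B *m E z = B.
  by move=> iz; rewrite BE ?Uj // Srep_scalar // lambda0 mul1mx.
have Be : B *m e_ 0 = B.
  rewrite blockE -scalemxAr mulmx_sumr (eq_bigr (fun _ => B)) => [|z iz].
    by rewrite sumr_const -scaler_nat scalerA mulVf ?scale1r // card_neq0.
  by rewrite h0r oppr0 mu20 -scalemxAr scale1r Bz.
apply/eqmxP; rewrite -{1}Be submxMl /= -[e_ 0]mul1mx.
apply: submx_trans (submxMr _ Bgen) _; rewrite sumsmxMr; apply/sumsmx_subP => v _.
rewrite (eqmxMr _ (genmxE _)) -{1}Be -[B *m e_ 0 *m E v]mulmxA block_shift add0r -!mulmxA.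
rewrite block_mul // subr0; case: ifP => jv; last by rewrite !mulmx0 sub0mx.
by rewrite -[block _ _ v](block_congr Xsys ii (_ : 0 - v \in _)) ?sub0r ?idealVN // -block_opE_comm // mulmxA Be BE // submxMl.
Qed.

Lemma Srep_span (M : 'M[C]_(zdim w)) : exists c : V -> C,
  M = \sum_(u in Uperp m i) c u *: Srep w ((0, u) : heis h).
Proof.
have : mx_absolutely_irreducible (Srep w) by apply: group_closure_closed_field; apply: Srep_irr.
case/mx_abs_irrP => _ [a Ha].
exists (fun u => \sum_(x in heis_sub h (Uperp m i) | x.2 == u) a x M * lambda w x.1).
rewrite {1}(Ha M) (partition_big (fun x : heis h => x.2) (mem (Uperp m i))) /=; last first.
  by move=> x; rewrite inE.
apply: eq_bigr => u Uu; rewrite scaler_suml; apply: eq_bigr => [[r v]] /= /andP[_ /eqP Ev].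
by rewrite Ev Srep_split // scalerA.
Qed.

Let comb (M : 'M[C]_(wdim Xsys)) := exists c : V -> C, M = \sum_v c v *: E v.

Let combE u : comb (E u).
Proof.
exists (fun v => (v == u)%:R); rewrite (bigD1 u) //= eqxx scale1r big1 ?addr0 //.
by move=> v /negPf->; rewrite scale0r.
Qed.

Let combD M M' : comb M -> comb M' -> comb (M + M').
Proof.
move=> [c ->] [d ->]; exists (fun v => c v + d v).
by rewrite -big_split; apply: eq_bigr => v _; rewrite scalerDl.
Qed.

Let combZ c M : comb M -> comb (c *: M).
Proof.
move=> [d ->]; exists (fun v => c * d v).
by rewrite scaler_sumr; apply: eq_bigr => v _; rewrite scalerA.
Qed.

Let comb_sum (I : Type) (r : seq I) (Pr : pred I) F :
  (forall l, Pr l -> comb (F l)) -> comb (\sum_(l <- r | Pr l) F l).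
Proof.
move=> H; apply: (big_ind comb) => [|M M'|l Pl]; [ | exact: combD | exact: H].
by have := combZ 0 (combE 0); rewrite scale0r.
Qed.

Let combM M M' : comb M -> comb M' -> comb (M *m M').
Proof.
move=> [c ->] [d ->]; rewrite mulmx_suml; apply: comb_sum => u _.
rewrite mulmx_sumr; apply: comb_sum => v _; rewrite -scalemxAl -scalemxAr.
by do 2 apply: combZ; rewrite opED; apply: combZ.
Qed.

Lemma Xsys_spanning : spanning Xsys.
Proof.
have [B [_ BE _ Bim]] := base_block0.
have corner M : comb (e_ 0 *m M *m e_ 0).
  have /submxP[Y EY] : (e_ 0 <= B)%MS by rewrite Bim.
  have [c Ec] := Srep_span (B *m M *m Y).
  have -> : e_ 0 *m M *m e_ 0 = Y *m (B *m M *m Y) *m B by rewrite {1 2}EY !mulmxA.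
  rewrite Ec mulmx_sumr mulmx_suml; apply: comb_sum => u Uu.
  rewrite -scalemxAr -scalemxAl -mulmxA -BE // mulmxA -EY.
  apply: combZ; apply: combM => //; rewrite blockE.
  by apply/combZ/comb_sum => z _; apply/combZ.
move=> M; rewrite -/(comb M) -[M]mul1mx -[1%:M *m M]mulmx1 (block_sum Xsys ii).
rewrite -!scalemxAl -scalemxAr; do 2 apply: combZ.
rewrite mulmx_suml mulmx_suml; apply: comb_sum => v _.
rewrite mulmx_sumr; apply: comb_sum => u _.
have Ee v' : e_ v' = E (- v') *m e_ 0 *m E v'.
  by rewrite -mulmxA block_shift add0r mulmxA opE_NK mul1mx.
rewrite (Ee v) (Ee u).
have -> : E (- v) *m e_ 0 *m E v *m M *m (E (- u) *m e_ 0 *m E u)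
    = E (- v) *m (e_ 0 *m (E v *m M *m E (- u)) *m e_ 0) *m E u by rewrite !mulmxA.
by apply: combM => //; apply: combM.
Qed.

End IdealHyps.
End Model.

Lemma mul_delta_entry (F : fieldType) n (X Y : 'M[F]_n) a b c d :
  (X *m delta_mx b c *m Y) a d = X a b * Y c d.
Proof.
rewrite mxE (bigD1 c) //= big1 ?addr0 => [|l lr].
  rewrite mxE (bigD1 b) //= big1 ?addr0 => [|l lb]; first by rewrite mxE !eqxx mulr1.
  by rewrite mxE (negPf lb) mulr0.
by rewrite mxE big1 ?mul0r // => l' _; rewrite mxE (negPf lr) andbF mulr0.
Qed.

Lemma mxtrace_idem (F : fieldType) n (e : 'M[F]_n) : e *m e = e -> \tr e = (\rank e)%:R.
Proof.
move=> ee; rewrite -{1}(mulmx_base e) mxtrace_mulC.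
suff -> : row_base e *m col_base e = 1%:M by rewrite mxtrace1.
have /row_fullP[K] := col_base_full e; have := row_base_free e.
have : col_base e *m row_base e *m (col_base e *m row_base e) = col_base e *m row_base e.
  by rewrite mulmx_base.
move: (col_base e) (row_base e) => c r cc fr Kc; apply: (row_free_inj fr); rewrite mul1mx.
transitivity (K *m (c *m r *m (c *m r))); first by rewrite !mulmxA Kc mul1mx.
by rewrite cc mulmxA Kc mul1mx.
Qed.

Section Inducing.
Variables (C : numClosedFieldType) (O : involutive_dvr) (A : framed_ring O) (m : nat).
Variables (h : herm_space A m) (i : {set A}) (w : weil_data C h i).
Hypotheses (ii : is_ideal i) (inz : i != [set 0]) (i2 : {in i &, forall c d : A, c * d = 0}).
Local Notation V := 'rV[A]_m.
Local Notation UV := (unitary_group h).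
Local Notation R := (fixed_ring (@star O A)).
Local Notation bar := (@star O A).
Local Notation mu := (mu w).
Local Notation mu2 := (mu2 w).
Local Notation N := (subg_of (unitary_scalars A)).
Local Notation P := (primitive_vectors A m).
Local Notation j := (ann i).
Implicit Types (u v t : V).

Let S u := Srep w ((0, u) : heis h).

Lemma zdim_gt0 : (0 < zdim w)%N.
Proof. by case/mx_irrP: (Srep_irr w). Qed.

Lemma SrepD u v : u \in Uperp m i -> v \in Uperp m i -> S u *m S v = mu (h v u) *: S (u + v).
Proof.
move=> Uu Uv; rewrite /S -(repr_mxM (Srep w)) ?inE // heis_mulE /heis_law /= !add0r.
by rewrite Srep_split ?idealVD // [v + u]addrC.
Qed.

Lemma Srep0 : S 0 = 1%:M. Proof. exact: (repr_mx1 (Srep w)). Qed.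

Lemma SrepN u : u \in Uperp m i -> S u *m S (- u) = 1%:M.
Proof. by move=> Uu; rewrite SrepD ?idealVN // subrr Srep0 hNl muN mu_form invr1 scale1r. Qed.

Lemma SrepNK u : u \in Uperp m i -> S (- u) *m S u = 1%:M.
Proof. by move=> Uu; have := SrepN (idealVN Uu); rewrite opprK. Qed.

Lemma SrepC u v : u \in Uperp m i -> v \in Uperp m i ->
  S u *m S v = mu2 (h v u) *: (S v *m S u).
Proof.
move=> Uu Uv; rewrite !SrepD // scalerA mu2E (muC w v u) -mulrA -muD subrr mu0 mulr1.
by rewrite [v + u]addrC.
Qed.

Lemma SrepU z : z \in Usub m i -> S z = 1%:M.
Proof. by move=> Uz; rewrite /S Srep_scalar // lambda0. Qed.

Lemma Srep_schur (T : 'M_(zdim w)) :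
  (forall u, u \in Uperp m i -> T *m S u = S u *m T) -> exists c, T = c%:M.
Proof.
move=> cT; have [|||c ->] := @central_corner C _ 1%:M T; rewrite ?mulmx1 ?mul1mx //.
  move=> M; rewrite mulmx1 mul1mx; have [c ->] := Srep_span M.
  rewrite mulmx_sumr mulmx_suml; apply: eq_bigr => u Uu.
  by rewrite -scalemxAr -scalemxAl cT.
by exists c; rewrite scalemx1.
Qed.

Lemma pairing_nondeg (k : {set A}) x : is_ideal k ->
  (forall z, z \in idealV m k -> mu2 (h z x) = 1) -> x \in idealV m (ann k).
Proof.
move=> ik H; have := form_char_sum w x ik; case: ifP => // _.
rewrite (eq_bigr (fun _ => 1)) ?sumr_const // => /eqP.
by rewrite pnatr_eq0 -leqn0 leqNgt cardG_gt0.
Qed.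

Lemma Srep_trace0 u : u \in Uperp m i -> u \notin Usub m i -> \tr (S u) = 0.
Proof.
move=> Uu nU; have ij := ann_ideal i.
have [/existsP[v /andP[Uv nv]]|/existsPn triv] := boolP [exists v in Uperp m i, mu2 (h v u) != 1].
  apply/eqP; have : (mu2 (h v u) - 1) * \tr (S u) == 0.
    have E : \tr (S u) = mu2 (h v u) * \tr (S u).
      rewrite -{1}[S u]mulmx1 -(SrepN Uv) mulmxA SrepC // -scalemxAl mxtraceZ.
      by rewrite -mulmxA mxtrace_mulC -mulmxA SrepNK // mulmx1.
    by rewrite mulrBl mul1r -E subrr.
  by rewrite mulf_eq0 subr_eq0 (negPf nv).
case/negP: nU; rewrite -[i in Usub m i](annK ii); apply: pairing_nondeg => // v Uv.
by have := triv v; rewrite Uv /= negbK => /eqP.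
Qed.

(** Schur orthogonality for the Heisenberg group of the quotient of Uperp by U. *)
Lemma zdim_sq : (zdim w)%:R * (zdim w)%:R * #|Usub m i|%:R = #|Uperp m i|%:R :> C.
Proof.
pose T (b c : 'I_(zdim w)) := \sum_(u in Uperp m i) S u *m delta_mx b c *m S (- u).
have Tscal b c : exists x, T b c = x%:M.
  apply: Srep_schur => v Uv; rewrite /T mulmx_suml mulmx_sumr.
  rewrite [RHS](reindex_inj (addrI (- v))) /=; apply: eq_big => [u|u Uu].
    by rewrite addrC idealVDr ?idealVN.
  have Uvu : - v + u \in Uperp m i by rewrite idealVD ?idealVN.
  rewrite !mulmxA SrepD // opprD opprK -[S _ *m _ *m _ *m S v]mulmxA SrepD ?idealVN //.
  rewrite addrA subrr add0r -!scalemxAl -scalemxAr [v - u]addrC; congr (_ *: _).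
  have -> : mu (h (- v + u) v) = mu (h u v) by rewrite hDl hNl muD muN mu_form invr1 mul1r.
  by rewrite hNr -muC.
have Ttr b c x : T b c = x%:M -> x * (zdim w)%:R = #|Uperp m i|%:R * (b == c)%:R.
  move/(congr1 mxtrace); rewrite mxtrace_scalar mulr_natr => <-.
  rewrite raddf_sum /= (eq_bigr (fun _ => (b == c)%:R)) ?sumr_const ?mulr_natl // => u Uu.
  rewrite -mulmxA mxtrace_mulC -mulmxA SrepNK // mulmx1.
  rewrite /mxtrace; have [->|bc] := eqVneq b c.
    by rewrite (bigD1 c) //= big1 ?addr0 => [|l /negPf lc]; rewrite mxE ?eqxx ?lc.
  by rewrite big1 // => l _; rewrite mxE; case: eqP => //= ->; rewrite (negPf bc).
pose c0 := Ordinal zdim_gt0.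
have [x Ex] := Tscal c0 c0.
have sumx : \sum_(u in Uperp m i) \tr (S u) * S (- u) c0 c0 = x.
  transitivity (\sum_a T a c0 a c0).
    rewrite (eq_bigr (fun u => \sum_a S u a a * S (- u) c0 c0)) => [|u _]; last by rewrite mulr_suml.
    rewrite exchange_big; apply: eq_bigr => a _; rewrite /T summxE.
    by apply: eq_bigr => u _; rewrite mul_delta_entry.
  rewrite (bigD1 c0) //= big1 ?addr0 => [|a ac]; first by rewrite Ex mxE eqxx mulr1n.
  by have [y ->] := Tscal a c0; rewrite mxE (negPf ac) mulr0n.
have := Ttr c0 c0 x Ex; rewrite eqxx mulr1 => <-; rewrite -sumx.
have UjU z : z \in Usub m i -> z \in Uperp m i by apply/idealVS/ideal_sub_ann.
have -> : \sum_(u in Uperp m i) \tr (S u) * S (- u) c0 c0 = \sum_(u in Usub m i) (zdim w)%:R.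
  rewrite big_mkcond [RHS]big_mkcond; apply: eq_bigr => u _.
  case: (boolP (u \in Uperp m i)) => Uu; case: (boolP (u \in Usub m i)) => Us //.
  - by rewrite !SrepU ?idealVN // mxtrace1 mxE eqxx mulr1n mulr1.
  - by rewrite Srep_trace0 // mul0r.
  - by case/negP: Uu; apply: UjU.
by rewrite sumr_const -[X in _ = X * _]mulr_natr [RHS]mulrAC.
Qed.

Lemma card_perfect (k : {set A}) : is_ideal k -> #|{: V}|%:R = #|idealV m k|%:R * #|idealV m (ann k)|%:R :> C.
Proof.
move=> ik; have iT : is_ideal [set: A] by apply/is_idealP; split=> *; rewrite inE.
transitivity (\sum_(z in idealV m k) \sum_(v : V) mu2 (h z v)).
  transitivity (\sum_(z in idealV m k) if z == 0 then #|{: V}|%:R else 0 : C).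
    rewrite -big_mkcondr (big_pred1 0) // => z; rewrite -[pred1 0 z]/(z == 0).
    by case: eqP => [->|_]; rewrite ?idealV0 ?andbF.
  apply: eq_bigr => z _; case: eqVneq => [->|nz].
    by rewrite (eq_bigr (fun _ => 1)) ?sumr_const // => v _; rewrite h0l mu20.
  rewrite (eq_bigr (fun v => mu2 (- h v z))) => [|v _]; last by rewrite !mu2E muC.
  rewrite (reindex_inj oppr_inj) /=.
  rewrite (eq_bigr (fun v => mu2 (h v z))) => [|v _]; last by rewrite hNl opprK.
  have := form_char_sum w z iT; case: ifPn => [jz|_ H0]; last first.
    by rewrite -{1}H0; apply: eq_bigl => v; rewrite idealV_setT.
  case/eqP: nz; apply/rowP => l; rewrite mxE.
  have /(idealVP _ (ann_ideal _))/(_ l)/annP/(_ 1) := jz.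
  by rewrite inE mulr1; apply.
rewrite exchange_big /= (eq_bigr (fun x => if x \in idealV m (ann k) then #|idealV m k|%:R else 0)) => [|v _]; last exact: form_char_sum.
by rewrite -big_mkcond sumr_const /= mulr_natr.
Qed.

Lemma zdim_sqrt : (zdim w)%:R = sqrtC #|Uperp m i : Usub m i|%g%:R :> C.
Proof.
have US : Usub m i \subset Uperp m i by apply/subsetP => z; apply/idealVS/ideal_sub_ann.
rewrite -divgS // natf_div; last exact: cardSg.
by rewrite -zdim_sq mulfK ?card_neq0 // -expr2 sqrCK // ler0n.
Qed.

Local Notation Wp g := (Wrep w (restr_perm (Uperp m i) g)).

Lemma Wt_mxE t g : Wt_mx w t g = Wp g *m Srep w ((fform h (g t) t, g t - t) : heis h).
Proof. by []. Qed.

(** The congruence subgroup acts on the inducing module through [alpha]. *)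
Lemma Wt_congruence t g : g \in congruence_set h i -> Wt_mx w t g = (alpha w t g)%:M.
Proof.
move=> Og; have /setIdP[Ug /forallP gi] := Og.
have -> : Wt_mx w t g = 1%:M *m (alpha w t g)%:M; last by rewrite mul1mx.
rewrite Wt_mxE; congr (_ *m _); last exact: Srep_scalar.
have -> : restr_perm (Uperp m i) g = 1%g; last exact: (repr_mx1 (Wrep w)).
apply/permP => u; rewrite perm1; have [Uu|nU] := boolP (u \in Uperp m i).
  by rewrite restr_permE ?(unitary_norm _ Ug) // (fixes_ann ii Og).
exact: (out_perm (restr_perm_on _ _)).
Qed.

Lemma alpha_mu t g : alpha w t g = mu (h (g t) t). Proof. by []. Qed.

Lemma scalar_congruence (a : N) : sgval a \in unitary_scalars_congr i ->
  scalar_of m a \in congruence_set h i.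
Proof.
move=> /setIdP[_ ia]; apply/setIdP; split; first exact: scalar_of_UV.
by apply/forallP => v; rewrite scalar_ofE -{2}[v]scale1r -scalerBl idealV_scale.
Qed.

(** A scalar congruent to 1 modulo the annihilator only is conjugate, under the
    Heisenberg group, to a nontrivial multiple of itself. *)
Lemma Wt_trace0 t (a : N) : t \in P -> nval a - 1 \in j -> nval a - 1 \notin i ->
  \tr (Wt_mx w t (scalar_of m a)) = 0.
Proof.
move=> Pt ja nia; have ij := ann_ideal i; have UA := scalar_of_UV h a.
have Ua : nval a \is a GRing.unit := valP (sgval a).
pose b := bar (nval a - 1).
have Eb : nval a - 1 = - (nval a * b).
  by rewrite /b rmorphB rmorph1 bar_nval mulrBr mulrV // mulr1 opprB.
have nib : b \notin i by apply: contra nia => ib; rewrite Eb ideal_opp // ideal_mull.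
have [c jc [ibc nbc]] : exists2 c, c \in j & b * c \in i /\ b * c != 0.
  have [/existsP[c /and3P[jc ibc nbc]]|/existsPn none] := boolP [exists c in j, (b * c \in i) && (b * c != 0)].
    by exists c.
  case/negP: nib; rewrite -(annK ii); apply/annP => c jc.
  apply/eqP/negPn/negP => nbc.
  have [k /andP[kl ik] Ei] : exists2 k, (k < len A)%N && (unif A ^+ k \in i) & true.
    have [k kl E] := ideal_powerP ii; exists k => //; apply/andP; split.
      by rewrite ltnNge -principal_power_eq0 -E.
    by rewrite E; apply/principalP; exists 1; rewrite mul1r.
  have [l [u Uu El]] := unif_factor nbc.
  have ll : (l < len A)%N by rewrite ltnNge -(unit_unif_eq0 _ Uu) -El.
  have := none (c * unif A ^+ ((len A).-1 - l)); rewrite ideal_mulr //= mulrA El.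
  rewrite -mulrA -exprD subnKC; last by rewrite -ltnS prednK // (leq_ltn_trans _ ll).
  have -> : u * unif A ^+ (len A).-1 \in i.
    apply: ideal_mull => //; rewrite -(subnK (_ : k <= (len A).-1)%N); last first.
      by rewrite -ltnS prednK // (leq_ltn_trans _ ll).
    by rewrite exprD ideal_mull.
  by rewrite unit_unif_eq0 // negbK leqNgt ltn_predL (leq_ltn_trans _ ll).
have [x nx] : exists x, mu2 (h ((nval a - 1) *: t) (c *: x)) != 1.
  have [/existsP[x Hx]|/existsPn triv] := boolP [exists x, mu2 (h ((nval a - 1) *: t) (c *: x)) != 1].
    by exists x.
  case/eqP: nbc; have [w0 hw0] := primitive_dual h Pt; have htw := hC1 hw0.
  have : 2%:R * (b * c) \in ann [set: A].
    apply: (mu_ann (w := w)) => [|y _]; first by apply/is_idealP; split=> *; rewrite inE.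
    have := triv ((y * sgn A) *: w0); rewrite negbK => /eqP <-; congr (mu _).
    by rewrite hZl !hZr htw -/b; ring: (sgnK A).
  move/annP/(_ 1); rewrite inE mulr1 => /(_ isT) E.
  by apply: (mulrI (two_unit A)); rewrite mulr0.
pose u := c *: x; have Uu : u \in Uperp m i by rewrite idealV_scale.
have Uau : (nval a - 1) *: u \in Usub m i.
  rewrite /u scalerA idealV_scale // Eb mulNr ideal_opp // -mulrA ideal_mull //.
pose y := (nval a - 1) *: t; have Uy : y \in Uperp m i by rewrite idealV_scale.
apply/eqP; have : (mu2 (h y u) - 1) * \tr (Wp (scalar_of m a) *m S y) == 0.
  have Scomm : S u *m Wp (scalar_of m a) = Wp (scalar_of m a) *m S u.
    rewrite (@WrepJ _ _ _ _ _ _ w _ ((0, u) : heis h) UA Uu); congr (_ *m _).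
    rewrite /heis_act /= -[Srep w _]/(S (scalar_of m a u)) scalar_ofE.
    have -> : nval a *: u = (nval a - 1) *: u + u by rewrite scalerBl scale1r subrK.
    have Ujau : (nval a - 1) *: u \in Uperp m i by apply: (idealVS (k := i)) Uau; exact: ideal_sub_ann.
    have := SrepD Ujau Uu; rewrite SrepU // mul1mx.
    by rewrite (h_ann_idealV h ii) // mu0 scale1r => <-.
  rewrite mulrBl mul1r subr_eq0; apply/eqP; rewrite -mxtraceZ scalemxAr.
  transitivity (\tr (S u *m (Wp (scalar_of m a) *m S y) *m S (- u))); last first.
    by rewrite -mulmxA mxtrace_mulC -[_ *m S (- u) *m S u]mulmxA SrepNK // mulmx1.
  rewrite [S u *m _]mulmxA Scomm -[_ *m S u *m S y]mulmxA SrepC // -[in RHS]scalemxAr -[in RHS]scalemxAl.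
  by rewrite [_ *m (S y *m S u)]mulmxA -[_ *m S u *m S (- u)]mulmxA SrepN // mulmx1 scalemxAr.
rewrite mulf_eq0 subr_eq0 (negPf nx) /= => /eqP tr0.
have Ey : nval a *: t - t = y by rewrite /y scalerBl scale1r.
rewrite Wt_mxE scalar_ofE Ey Srep_split //.
by rewrite -scalemxAr mxtraceZ tr0 mulr0.
Qed.

Lemma congr_group_set (k : {set A}) : is_ideal k -> group_set (unitary_scalars_congr k).
Proof.
move=> ik; apply/group_setP; split=> [|x y].
  by apply/setIdP; split; rewrite ?group1 //= subrr ideal_zero.
move=> /setIdP[Nx kx] /setIdP[Ny ky]; apply/setIdP; split; first exact: groupM.
have -> : val (x * y)%g - 1 = val x * (val y - 1) + (val x - 1).
  by rewrite FinRing.val_unitM mulrBr mulr1 addrA subrK.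
by rewrite ideal_add // ideal_mull.
Qed.

Lemma card_congr (k : {set A}) : #|[set a : N | sgval a \in unitary_scalars_congr k]| = #|unitary_scalars_congr k|.
Proof.
rewrite -(card_imset _ (@subg_inj _ (unitary_scalars A))); congr #|pred_of_set _|.
apply/setP => x; apply/imsetP/idP => [[a]|kx]; first by rewrite in_set => ka ->.
have /setIdP[Nx _] := kx; have [a Ea] := subg_scalar Nx.
by exists a; rewrite // in_set Ea.
Qed.

Section Eigenspace.
Variables (t : V) (phi : {ffun N -> C}).
Hypothesis Lphi : linear_character phi.
Let Bs := [set a : N | sgval a \in unitary_scalars_congr j].
Let r (a : N) := Wt_repr w t (scalar_of m a).

Let BsE a : (a \in Bs) = (sgval a \in unitary_scalars_congr j).
Proof. by rewrite in_set. Qed.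

Let r_mul a b : a \in Bs -> b \in Bs -> r (a * b)%g = r a *m r b.
Proof.
rewrite !BsE => ja jb; rewrite /r scalar_ofM (repr_mxM (Wt_repr w t)) //; exact: scalar_of_coset_stab.
Qed.

Let BsM a b : a \in Bs -> (b * a \in Bs)%g = (b \in Bs).
Proof.
have cg := congr_group_set (ann_ideal i).
rewrite !BsE => ja; rewrite sgvalM ?in_setT //.
exact: (@groupMr _ (Group cg)).
Qed.

Let Bs1 : 1%g \in Bs.
Proof. rewrite BsE morph1; exact: (group1 (Group (congr_group_set (ann_ideal i)))). Qed.

Definition Zt_proj := #|Bs|%:R^-1 *: \sum_(a in Bs) (phi a)^-1 *: r a.

Lemma card_Bs_neq0 : #|Bs|%:R != 0 :> C.
Proof. by rewrite pnatr_eq0 -lt0n; apply/card_gt0P; exists 1%g. Qed.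

Lemma Zt_proj_mul a : a \in Bs -> Zt_proj *m r a = phi a *: Zt_proj.
Proof.
move=> ja; rewrite /Zt_proj -scalemxAl scalerA mulrC -scalerA; congr (_ *: _).
rewrite mulmx_suml scaler_sumr [RHS](reindex_inj (mulIg a)) /=.
apply: eq_big => [b|b jb]; first by rewrite BsM.
rewrite -scalemxAl r_mul // scalerA linM // invfM mulrCA divff ?mulr1 //.
exact: lin_neq0.
Qed.

Lemma Zt_proj_fix p (M : 'M_(p, zdim w)) : (forall a, a \in Bs -> M *m r a = phi a *: M) ->
  M *m Zt_proj = M.
Proof.
move=> HM; rewrite /Zt_proj -scalemxAr mulmx_sumr (eq_bigr (fun _ => M)) => [|a ja].
  by rewrite sumr_const -scaler_nat scalerA mulVf ?scale1r // card_Bs_neq0.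
by rewrite -scalemxAr HM // scalerA mulVf ?scale1r // lin_neq0.
Qed.

Lemma Zt_proj_idem : Zt_proj *m Zt_proj = Zt_proj.
Proof. by apply: Zt_proj_fix => a; apply: Zt_proj_mul. Qed.

Lemma Zt_eigenspaceP p (M : 'M_(p, zdim w)) :
  reflect (forall a, a \in Bs -> M *m r a = phi a *: M) (M <= Zt_eigenspace w t phi)%MS.
Proof.
apply: (iffP sub_bigcapmxP) => H a ja; first exact/eigenspaceP/H.
exact/eigenspaceP/H.
Qed.

Lemma Zt_proj_eq : (Zt_eigenspace w t phi :=: Zt_proj)%MS.
Proof.
apply/eqmxP/andP; split; last exact/Zt_eigenspaceP/Zt_proj_mul.
by rewrite -[X in (X <= _)%MS]Zt_proj_fix ?submxMl //; apply/Zt_eigenspaceP/submx_refl.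
Qed.

End Eigenspace.

Lemma rank_Zt t phi : t \in P -> extends_alpha w t phi ->
  (\rank (Zt_eigenspace w t phi))%:R = sqrtC #|Uperp m i : Usub m i|%g%:R
     / #|unitary_scalars_congr j : unitary_scalars_congr i|%g%:R :> C.
Proof.
move=> Pt [Lphi ext]; rewrite -zdim_sqrt (Zt_proj_eq t Lphi) -mxtrace_idem; last exact: Zt_proj_idem.
have cj := congr_group_set (ann_ideal i); have ci := congr_group_set ii.
have sub : Group ci \subset Group cj.
  by apply/subsetP => x /setIdP[Nx ix]; apply/setIdP; split=> //; apply: (subsetP (ideal_sub_ann i2)).
have -> : #|unitary_scalars_congr j : unitary_scalars_congr i|%g = (#|Group cj| %/ #|Group ci|)%N.
  by rewrite divgS.
rewrite natf_div; last exact: cardSg.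
rewrite invf_div /Zt_proj card_congr linearZ /= raddf_sum /=.
pose F (a : N) : C := if sgval a \in unitary_scalars_congr i then (zdim w)%:R else 0.
rewrite (eq_bigr F) => [|a ja].
  rewrite -big_mkcondr /= (eq_bigl (fun a => a \in [set a : N | sgval a \in unitary_scalars_congr i])).
    by rewrite sumr_const card_congr -[_ *+ #|unitary_scalars_congr i|]mulr_natr [LHS]mulrC mulrA.
  move=> a; rewrite [X in X && _]in_set [RHS]in_set; apply/andP/idP => [[]//|ia]; split=> //.
  exact: (subsetP sub).
rewrite /F linearZ /=; case: ifPn => ia.
  rewrite Wt_congruence ?scalar_congruence // mxtrace_scalar ext //.
  rewrite -[_ *+ zdim w]mulr_natr mulKf // -ext //; exact: lin_neq0.
rewrite Wt_trace0 ?mulr0 //.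
  by move: ja; rewrite in_set => /setIdP[].
by apply: contra ia => ia; apply/setIdP; split=> //; apply: subgP.
Qed.

End Inducing.

Lemma pchar0_group (C : numClosedFieldType) (gT : finGroupType) (G : {group gT}) :
  [pchar C]^'.-group G.
Proof. by apply/pgroupP => p _ _; rewrite inE /= pchar_num. Qed.

Lemma affords_sub (F : fieldType) (gT : finGroupType) (G : {group gT}) n N
    (r : mx_representation F G n) (R : mx_representation F G N) e e' (U : 'M_n)
    (modU : mxmodule r U) :
  affords r R e ->
  (forall psi : 'M_(n, N), row_free psi -> (forall g, g \in G -> r g *m psi = psi *m R g) ->
     (psi :=: e)%MS -> (U *m psi :=: e')%MS) ->
  affords (submod_repr modU) R e'.
Proof.
move=> [psi [fr eq im]] H; have [phi [frp eqp imp]] := affords_submod modU.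
exists (phi *m psi); split.
- by rewrite /row_free mxrankMfree.
- by move=> g Gg; rewrite [LHS]mulmxA eqp // -[LHS]mulmxA eq // [LHS]mulmxA.
by apply: eqmx_trans (H psi fr eq im); apply/eqmxP; rewrite !submxMr // imp.
Qed.

Section Regions.
Variables (C : numClosedFieldType) (O : involutive_dvr) (A : framed_ring O) (m : nat).
Variables (h : herm_space A m) (i : {set A}) (w : weil_data C h i).
Variable X : weil_system w.
Hypotheses (ii : is_ideal i) (i2 : {in i &, forall c d : A, c * d = 0}).
Local Notation V := 'rV[A]_m.
Local Notation UV := (unitary_group h).
Local Notation j := (ann i).
Local Notation W := (opW X).
Local Notation "'e_' v" := (block X i v) (at level 8, v at level 2).
Implicit Types (S : {set V}) (u v t : V).

Definition saturated S : Prop := forall u v, u - v \in idealV m j -> (u \in S) = (v \in S).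

(** The sum of the blocks of a region that is a union of cosets of (ann i)V. *)
Definition regproj S : 'M[C]_(wdim X) :=
  locked ((#|idealV m i|%:R / #|{: V}|%:R) *: \sum_(v in S) e_ v).

Lemma regprojE S : regproj S = (#|idealV m i|%:R / #|{: V}|%:R) *: \sum_(v in S) e_ v.
Proof. by rewrite /regproj -lock. Qed.

Lemma card_coset v : #|[set u | v - u \in idealV m j]| = #|idealV m j|.
Proof.
rewrite -(card_imset (mem (idealV m j)) (subrI v)); apply: eq_card => u.
rewrite inE; apply/idP/imsetP => [ju|[z jz ->]]; last by rewrite opprB addrC subrK.
by exists (v - u); rewrite // opprB addrC subrK.
Qed.

Lemma ratio_card : #|idealV m i|%:R / #|{: V}|%:R * #|idealV m j|%:R = 1 :> C.
Proof.
have := card_perfect w ii; rewrite mulrAC => <-; rewrite divff // pnatr_eq0 -lt0n.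
by apply/card_gt0P; exists 0.
Qed.

Lemma coset_mult v S (M : 'M[C]_(wdim X)) : saturated S ->
  (#|idealV m i|%:R / #|{: V}|%:R) *: \sum_(u in S) (if v - u \in idealV m j then M else 0)
    = if v \in S then M else 0.
Proof.
move=> satS; rewrite -big_mkcondr sumr_const.
have -> : #|[pred u | (u \in S) && (v - u \in idealV m j)]|
    = (if v \in S then #|idealV m j| else 0)%N.
  have [Sv|nSv] := boolP (v \in S).
    rewrite -(card_coset v); apply: eq_card => u; rewrite inE [RHS]in_set.
    by apply: andb_idl => vu; rewrite -(satS _ _ vu).
  apply: eq_card0 => u; rewrite inE.
  by apply: contraNF nSv => /andP[Su vu]; rewrite (satS _ _ vu).
case: (v \in S); last by rewrite mulr0n scaler0.
by rewrite -scaler_nat scalerA ratio_card scale1r.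
Qed.

Lemma block_regproj v S : saturated S -> e_ v *m regproj S = if v \in S then e_ v else 0.
Proof.
move=> satS; rewrite regprojE -scalemxAr mulmx_sumr -(coset_mult v _ satS).
by congr (_ *: _); apply: eq_bigr => u _; apply: block_mul.
Qed.

Lemma regproj_block v S : saturated S -> regproj S *m e_ v = if v \in S then e_ v else 0.
Proof.
move=> satS; rewrite regprojE -scalemxAl mulmx_suml -(coset_mult v _ satS).
congr (_ *: _); apply: eq_bigr => u _.
rewrite block_mul // idealVBC; case: ifP => // vu.
by rewrite (block_congr X ii vu).
Qed.

Lemma block_ext (M M' : 'M[C]_(wdim X)) : (forall v, e_ v *m M = e_ v *m M') -> M = M'.
Proof.
move=> H; rewrite -[M]mul1mx -[M']mul1mx (block_sum X ii) -!scalemxAl; congr (_ *: _).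
by rewrite !mulmx_suml; apply: eq_bigr => v _.
Qed.

Lemma regproj_mul S S' : saturated S -> saturated S' ->
  regproj S *m regproj S' = regproj (S :&: S').
Proof.
move=> sS sS'; apply: block_ext => v; rewrite mulmxA !block_regproj //; last first.
  by move=> u u' uu; rewrite !inE (sS _ _ uu) (sS' _ _ uu).
by rewrite inE; case: ifP; rewrite ?mul0mx //= block_regproj.
Qed.

Lemma regproj_comm S g : g \in UV -> (forall v, (g v \in S) = (v \in S)) ->
  regproj S *m W g = W g *m regproj S.
Proof.
move=> Ug gS; rewrite regprojE -scalemxAl -scalemxAr; congr (_ *: _).
rewrite mulmx_suml mulmx_sumr [RHS](reindex_inj (@perm_inj _ g)) /=.
by apply: eq_big => [v|v _]; [rewrite gS | rewrite block_unitary].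
Qed.

Lemma regproj0 : regproj set0 = 0.
Proof. by rewrite regprojE big_set0 scaler0. Qed.

Definition orbit_of t : {set V} := [set v | [exists g in UV, g t - v \in idealV m j]].

Lemma orbit_ofP t v : reflect (exists2 g, g \in UV & g t - v \in idealV m j) (v \in orbit_of t).
Proof.
rewrite in_set; apply: (iffP existsP) => [[g /andP[Ug gt]]|[g Ug gt]]; exists g => //.
by rewrite Ug.
Qed.

Lemma orbit_of_saturated t : saturated (orbit_of t).
Proof.
move=> u v uv; apply/orbit_ofP/orbit_ofP => [[g Ug gt]|[g Ug gt]]; exists g => //.
  by rewrite -(subrK u (g t)) -addrA idealVD.
by rewrite -(subrK v (g t)) -addrA idealVD // idealVBC.
Qed.

Lemma orbit_of_stable t g v : g \in UV -> (g v \in orbit_of t) = (v \in orbit_of t).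
Proof.
move=> Ug; apply/orbit_ofP/orbit_ofP => [[x Ux xt]|[x Ux xt]].
  have Ug' : (g^-1)%g \in UV by rewrite groupV.
  exists (x * g^-1)%g; first exact: groupM.
  rewrite permM -[v](permK g) -(unitaryB _ _ Ug').
  by rewrite (unitary_idealV _ _ Ug').
exists (x * g)%g; first exact: groupM.
by rewrite permM -(unitaryB _ _ Ug) (unitary_idealV _ _ Ug).
Qed.

Lemma orbit_of_refl t : t \in orbit_of t.
Proof. by apply/orbit_ofP; exists 1%g; rewrite ?group1 // perm1 subrr idealV0. Qed.

Definition orbproj t := regproj (orbit_of t).

Lemma orbproj_comm t g : g \in UV -> orbproj t *m W g = W g *m orbproj t.
Proof. by move=> Ug; apply: regproj_comm => // v; apply: orbit_of_stable. Qed.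

Section Representatives.
Variable T : {set V}.
Hypothesis Trep : orbit_representatives h (ann i) T.
Hypothesis inz : i != [set 0].

Let jr : j \subset principal (unif A). Proof. exact: ann_proper. Qed.

Lemma rep_unique t t' v : t \in T -> t' \in T -> v \in orbit_of t -> v \in orbit_of t' -> t = t'.
Proof.
move=> Tt Tt' /orbit_ofP vt /orbit_ofP vt'; have [t0 [_ uniq]] := Trep v.
by rewrite -(uniq t) // -(uniq t').
Qed.

Lemma orbit_primitive t v : v \in orbit_of t ->
  (v \in primitive_vectors A m) = (t \in primitive_vectors A m).
Proof.
move=> /orbit_ofP[g Ug gt]; rewrite -(primitive_congr (ann_ideal i) jr gt).
by rewrite (unitary_primitive _ Ug).
Qed.

Lemma rep_exists v : v \in primitive_vectors A m ->
  exists2 t, t \in primitive_reps T & v \in orbit_of t.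
Proof.
move=> Pv; have [t [[Tt [g Ug gt]] _]] := Trep v.
have vt : v \in orbit_of t by apply/orbit_ofP; exists g.
by exists t => //; apply/setIP; rewrite -(orbit_primitive vt).
Qed.

Lemma orbproj_orth t t' : t \in T -> t' \in T ->
  orbproj t *m orbproj t' = if t == t' then orbproj t else 0.
Proof.
move=> Tt Tt'; rewrite regproj_mul; try exact: orbit_of_saturated.
case: eqP => [->|ne]; first by rewrite setIid.
rewrite (_ : _ :&: _ = set0) ?regproj0 //; apply/setP => v; rewrite in_setI in_set0.
apply/negP => /andP[vt vt']; case: ne; exact: rep_unique vt vt'.
Qed.

Lemma primproj_orbits n : minimal_ideal n ->
  primproj X n = \sum_(t in primitive_reps T) orbproj t.
Proof.
move=> Mn; apply: block_ext => v; rewrite mulmxBr mulmx1 block_minimal // mulmx_sumr.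
rewrite (eq_bigr (fun t => if v \in orbit_of t then e_ v else 0)) => [|t _]; last first.
  exact/block_regproj/orbit_of_saturated.
rewrite -big_mkcondr /=; have [Pv|nPv] := boolP (v \in primitive_vectors A m).
  have [t Tt vt] := rep_exists Pv; rewrite (big_pred1 t) ?subr0 // => t'.
  apply/andP/eqP => [[Tt' vt']|->//]; have /setIP[Tt1 _] := Tt; have /setIP[Tt2 _] := Tt'.
  exact: rep_unique vt' vt.
rewrite subrr big_pred0 // => t; apply: contraNF nPv => /andP[/setIP[_ Pt] vt].
by rewrite (orbit_primitive vt).
Qed.

End Representatives.
End Regions.

Lemma affords_from_rsim (F : fieldType) (gT : finGroupType) (G : {group gT}) n n' N
  (r : mx_representation F G n) (r' : mx_representation F G n') (R : mx_representation F G N) e :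
  mx_rsim r r' -> affords r' R e -> affords r R e.
Proof.
case=> B nn' frB HB [psi [fr eq im]]; exists (B *m psi); split.
- by rewrite /row_free mxrankMfree.
- by move=> g Gg; rewrite [LHS]mulmxA HB // -[LHS]mulmxA eq // [LHS]mulmxA.
apply: eqmx_trans im; apply: eqmxMfull.
by rewrite /row_full (eqP frB) nn'.
Qed.

(** An idempotent whose image is, up to scalars, only acted on trivially by the
    commutant has irreducible image, by complete reducibility. *)
Lemma scalar_commutant_simple (C : numClosedFieldType) (gT : finGroupType) (G : {group gT}) N
    (R : mx_representation C G N) (e U : 'M[C]_N) :
  e *m e = e ->
  (forall T, (forall g, g \in G -> T *m R g = R g *m T) -> exists c, e *m T = c *: e) ->
  mxmodule R U -> (U <= e)%MS -> U != 0 -> (e <= U)%MS.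
Proof.
move=> ee comm modU Ue Unz.
have [U' modU' addU dxU] := mx_Maschke_pchar R (pchar0_group C G) modU (submx1 U).
have dx0 : (U :&: U' = 0)%MS by apply/mxdirect_addsP.
have [|c Ec] := comm (proj_mx U U').
  have hom1 : (1%:M <= dom_hom_mx R (proj_mx U U'))%MS.
    by apply: submx_trans (proj_mx_hom dx0 modU modU'); rewrite addU.
  move=> g Gg; have /hom_mxP/(_ g Gg) := hom1.
  by rewrite !mul1mx => ->.
have UE : U *m e = U by case/submxP: Ue => D ->; rewrite -mulmxA ee.
have : c *: U = U by rewrite -{1}UE scalemxAr -Ec mulmxA UE proj_mx_id.
move/eqP; rewrite -subr_eq0 -{2}[U]scale1r -scalerBl scaler_eq0 (negPf Unz) orbF subr_eq0.
move=> /eqP c1; rewrite c1 scale1r in Ec.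
by rewrite -Ec proj_mx_sub.
Qed.

(** A stable subspace of the restriction, given by a basis. *)
Lemma stable_repr (F : fieldType) (gT : finGroupType) (G H : {group gT}) n N
    (R : mx_representation F G N) (psi : 'M[F]_(n, N)) :
    H \subset G -> row_free psi -> (forall x, x \in H -> (psi *m R x <= psi)%MS) ->
  exists r : mx_representation F H n, forall x, x \in H -> r x *m psi = psi *m R x.
Proof.
move=> sHG fr stab; pose f x := psi *m R x *m pinvmx psi.
have fE x : x \in H -> f x *m psi = psi *m R x by move=> Hx; rewrite mulmxKpV ?stab.
have fR : mx_repr H f.
  split=> [|x y Hx Hy]; apply: (row_free_inj fr).
    by rewrite fE ?group1 // repr_mx1 mulmx1 mul1mx.
  rewrite fE ?groupM // -[RHS]mulmxA fE // [RHS]mulmxA fE // -mulmxA -repr_mxM //.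
    exact: (subsetP sHG).
  exact: (subsetP sHG).
by exists (MxRepresentation fR).
Qed.

Section Constituents.
Variables (C : numClosedFieldType) (O : involutive_dvr) (A : framed_ring O) (m : nat).
Variables (h : herm_space A m) (i : {set A}) (w : weil_data C h i).
Variable X : weil_system w.
Hypotheses (ii : is_ideal i) (inz : i != [set 0]) (i2 : {in i &, forall c d : A, c * d = 0}).
Hypothesis spanX : spanning X.
Local Notation V := 'rV[A]_m.
Local Notation UV := (unitary_group h).
Local Notation N := (subg_of (unitary_scalars A)).
Local Notation P := (primitive_vectors A m).
Local Notation j := (ann i).
Local Notation W := (opW X).
Local Notation E := (opE X).
Local Notation scalW := (scalW X).
Local Notation eigproj := (eigproj X).
Local Notation "'e_' v" := (block X i v) (at level 8, v at level 2).
Implicit Types (S : {set V}) (u v t : V) (phi : {ffun N -> C}).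

(** The copy of Z_t in the Weil module is the block of t. *)
Definition has_copies : Prop := forall t, exists D : 'M[C]_(zdim w, wdim X),
  [/\ row_free D, forall g, g \in coset_stab h j t -> D *m W g = Wt_mx w t g *m D
    & (D :=: e_ t)%MS].
Hypothesis copies : has_copies.

Definition topproj n phi := primproj X n *m eigproj phi.

Lemma topproj_idem n phi : minimal_ideal n -> linear_character phi ->
  topproj n phi *m topproj n phi = topproj n phi.
Proof.
move=> Mn Lphi; rewrite /topproj mulmxA -(mulmxA (primproj X n)).
suff -> : eigproj phi *m primproj X n = primproj X n *m eigproj phi.
  by rewrite !mulmxA primproj_idem // -!mulmxA eigproj_idem.
by rewrite eigproj_cent // => g; apply: primproj_comm.
Qed.

Lemma topproj_comm n phi g : g \in UV -> topproj n phi *m W g = W g *m topproj n phi.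
Proof.
by move=> Ug; rewrite /topproj -mulmxA eigproj_comm // !mulmxA primproj_comm.
Qed.

Lemma topproj_simple n phi (U : 'M_(wdim X)) : minimal_ideal n -> linear_character phi ->
  mxmodule W U -> (U <= topproj n phi)%MS -> U != 0 -> (topproj n phi <= U)%MS.
Proof.
move=> Mn Lphi; apply: scalar_commutant_simple; first exact: topproj_idem.
by move=> T; apply: eigen_commutant.
Qed.

Lemma block_neq0 t : e_ t != 0.
Proof.
have [D [frD _ im]] := copies t; rewrite -mxrank_eq0 -im (eqP frD) -lt0n.
exact: zdim_gt0.
Qed.

(** The congruence subgroup of i acts on the block of t through alpha_t. *)
Lemma block_alpha t g : g \in Omega h i -> e_ t *m W g = alpha w t g *: e_ t.
Proof.
move=> Og; have [D [frD DW im]] := copies t.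
have /submxP[Y ->] : (e_ t <= D)%MS by rewrite im.
rewrite -mulmxA DW ?Wt_congruence // ?mul_scalar_mx ?scalemxAr //.
have /setIdP[Ug /forallP gi] := Og; apply/setIdP; split=> //.
exact/idealVS/gi/ideal_sub_ann.
Qed.

Lemma alpha_congr t u g : g \in Omega h i -> t - u \in idealV m j -> alpha w t g = alpha w u g.
Proof.
move=> Og tu; have := block_alpha u Og; rewrite -(block_congr X ii tu) block_alpha // => /eqP.
rewrite -subr_eq0 -scalerBl scaler_eq0 (negPf (block_neq0 t)) orbF subr_eq0.
by move/eqP.
Qed.

Lemma alpha_scale t (a : N) g : g \in Omega h i -> alpha w (nval a *: t) g = alpha w t g.
Proof.
move=> Og; have Ug : g \in UV by case/setIdP: Og.
have aUV := scalar_of_UV h a; have H := block_unitary X i t aUV; rewrite scalar_ofE in H.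
have : e_ t *m W (scalar_of m a) *m W g = alpha w t g *: (e_ t *m W (scalar_of m a)).
  by rewrite -mulmxA [W _ *m W g]scalW_comm // mulmxA block_alpha // scalemxAl.
rewrite H -mulmxA block_alpha // -scalemxAr => /eqP; rewrite -subr_eq0 -scalerBl scaler_eq0.
case/orP => [|/eqP W0]; first by rewrite subr_eq0 => /eqP.
have/eqP := block_neq0 (nval a *: t); case.
by rewrite -[e_ _]mul1mx -(opWVK X aUV) -mulmxA W0 mulmx0.
Qed.

(** The blocks that meet an eigenspace of the scalars. *)
Lemma block_eigen_extends t phi : linear_character phi -> e_ t *m eigproj phi != 0 ->
  extends_alpha w t phi.
Proof.
move=> Lphi nz; split=> // a ia; have Oa := scalar_congruence h ii ia.
have : e_ t *m eigproj phi *m scalW a = phi a *: (e_ t *m eigproj phi).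
  by rewrite -mulmxA eigproj_scalW // scalemxAr.
rewrite -mulmxA eigproj_comm ?scalar_of_UV // mulmxA [e_ t *m _]block_alpha // -scalemxAl.
move/eqP; rewrite -subr_eq0 -scalerBl scaler_eq0 (negPf nz) orbF subr_eq0.
by move/eqP.
Qed.

Lemma primitive_scale t c k : is_ideal k -> t \in P -> (c *: t \in idealV m k) = (c \in k).
Proof.
move=> ik Pt; apply/idP/idP => [kc|kc]; last exact: idealV_scale.
have [x xt] := primitive_dual h Pt.
by have := h_idealVr h x ik kc; rewrite hZr xt mulr1.
Qed.

Lemma coset_stab_scalar t (a : N) : t \in P ->
  (scalar_of m a \in coset_stab h j t) = (sgval a \in unitary_scalars_congr j).
Proof.
move=> Pt; apply/setIdP/setIdP => [[_]|[_ ja]].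
  rewrite scalar_ofE -{2}[t]scale1r -scalerBl primitive_scale ?ann_ideal // => ja.
  by split=> //; apply: subgP.
split; first exact: scalar_of_UV.
by rewrite scalar_ofE -{2}[t]scale1r -scalerBl primitive_scale ?ann_ideal.
Qed.

(** On Z_t, followed by the projection on a block of t after the one on the
    eigenspace of phi, only the scalars congruent to 1 modulo j survive. *)
Lemma Zt_eigen_corner t phi (D : 'M_(zdim w, wdim X)) p (M : 'M_(p, zdim w)) :
    t \in P -> linear_character phi ->
    (forall g, g \in coset_stab h j t -> D *m W g = Wt_mx w t g *m D) -> (D :=: e_ t)%MS ->
    (M <= Zt_eigenspace w t phi)%MS ->
  M *m D *m eigproj phi *m e_ t
    = (#|[set a : N | sgval a \in unitary_scalars_congr j]|%:R / #|N|%:R) *: (M *m D).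
Proof.
move=> Pt Lphi DW im /Zt_eigenspaceP HM; set Bs := [set a | _].
have De : D *m e_ t = D.
  have /submxP[Y ->] : (D <= e_ t)%MS by rewrite im.
  by rewrite -mulmxA block_idem.
rewrite eigprojE -scalemxAr -scalemxAl mulrC -scalerA; congr (_ *: _).
rewrite mulmx_sumr mulmx_suml.
rewrite (eq_bigr (fun a => if a \in Bs then M *m D else 0)) => [|a _].
  by rewrite -big_mkcond sumr_const scaler_nat.
rewrite -scalemxAr -scalemxAl; case: ifP => [ja|nja].
  have Ga : scalar_of m a \in coset_stab h j t.
    by rewrite coset_stab_scalar //; move: ja; rewrite in_set.
  rewrite -(mulmxA M) [D *m _]DW // mulmxA HM // -!scalemxAl scalerA mulVf ?lin_neq0 //.
  by rewrite scale1r -mulmxA De.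
rewrite -{1}De mulmxA -(mulmxA _ (e_ t)) [e_ t *m _]block_unitary ?scalar_of_UV //.
rewrite -!mulmxA block_mul // ifN ?mulmx0 ?scaler0 //.
apply: contraFN nja => tt; rewrite in_set -(coset_stab_scalar a Pt); apply/setIdP.
by split=> //; apply: scalar_of_UV.
Qed.

Lemma Zt_eigenspace_neq0 t phi : t \in P -> extends_alpha w t phi ->
  Zt_eigenspace w t phi != 0.
Proof.
move=> Pt ext; rewrite -mxrank_eq0 -(@pnatr_eq0 C) (rank_Zt ii inz i2 Pt ext).
rewrite -(zdim_sqrt w ii i2) mulf_neq0 ?invr_eq0 ?pnatr_eq0 -?lt0n ?zdim_gt0 //.
exact: (@indexg_gt0 _ (Group (congr_group_set (ann_ideal i))) (Group (congr_group_set ii))).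
Qed.

Lemma Bs_ratio_neq0 : #|[set a : N | sgval a \in unitary_scalars_congr j]|%:R / #|N|%:R != 0 :> C.
Proof. by rewrite mulf_neq0 ?invr_eq0 ?card_Bs_neq0 ?cardN_neq0. Qed.

Lemma extends_block_eigen t phi : t \in P -> extends_alpha w t phi ->
  e_ t *m eigproj phi != 0.
Proof.
move=> Pt ext; have [Lphi _] := ext; have [D [frD DW im]] := copies t.
have := Zt_eigen_corner Pt Lphi DW im (submx_refl _).
have /submxP[Y DY] : (D <= e_ t)%MS by rewrite im.
move=> H; apply: contraNneq (Zt_eigenspace_neq0 Pt ext) => z.
move: H; rewrite {1}DY -!mulmxA (mulmxA (e_ t)) z mul0mx !mulmx0 => /esym/eqP.
rewrite scaler_eq0 (negPf Bs_ratio_neq0) /= => /eqP ZD.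
by apply/eqP/(row_free_inj frD); rewrite mul0mx.
Qed.

Lemma orbproj_block t : orbproj X t *m e_ t = e_ t.
Proof. by rewrite /orbproj regproj_block ?orbit_of_refl //; apply: orbit_of_saturated. Qed.

Lemma block_orbproj t : e_ t *m orbproj X t = e_ t.
Proof. by rewrite /orbproj block_regproj ?orbit_of_refl //; apply: orbit_of_saturated. Qed.

Lemma orbproj_eigen0 t phi : e_ t *m eigproj phi = 0 -> orbproj X t *m eigproj phi = 0.
Proof.
move=> e0.
rewrite /orbproj regprojE -scalemxAl mulmx_suml big1 ?scaler0 // => v /orbit_ofP[g Ug gt].
rewrite -(block_congr X ii gt); have Ug' : (g^-1)%g \in UV by rewrite groupV.
apply: (opW_cancel Ug'); rewrite -mulmxA eigproj_comm // mulmxA block_unitary // permK.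
by rewrite -mulmxA e0 mulmx0.
Qed.

Lemma block_primproj n v : minimal_ideal n -> v \in P -> e_ v *m primproj X n = e_ v.
Proof. by move=> Mn Pv; rewrite mulmxBr mulmx1 block_minimal // Pv subr0. Qed.

Section Orbit.
Variables (T : {set V}) (n : {set A}).
Hypotheses (Trep : orbit_representatives h j T) (Mn : minimal_ideal n).

Lemma primproj_orbproj t : t \in primitive_reps T -> primproj X n *m orbproj X t = orbproj X t.
Proof.
move=> Pt; rewrite (primproj_orbits X ii i2 Trep inz Mn) mulmx_suml (bigD1 t) //=.
have Tt : t \in T by have /setIP[] := Pt.
rewrite (orbproj_orth X ii i2 Trep) // eqxx [X in _ + X]big1 ?addr0 // => u /andP[/setIP[Tu _] ut].
by rewrite (orbproj_orth X ii i2 Trep) // (negPf ut).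
Qed.

(** The part of an orbit in an eigenspace of the scalars is all of that
    eigenspace, because the latter is simple. *)
Lemma orbproj_eigen t phi : t \in primitive_reps T -> extends_alpha w t phi ->
  (orbproj X t *m eigproj phi :=: topproj n phi)%MS.
Proof.
move=> Tt ext; have Pt : t \in P by have /setIP[] := Tt.
have [Lphi _] := ext.
have comm g : g \in UV -> orbproj X t *m W g = W g *m orbproj X t by apply: orbproj_comm.
have op : orbproj X t *m primproj X n = orbproj X t.
  rewrite (primproj_orbits X ii i2 Trep inz Mn) mulmx_sumr (bigD1 t) //=.
  have Tt' : t \in T by have /setIP[] := Tt.
  rewrite (orbproj_orth X ii i2 Trep) // eqxx [X in _ + X]big1 ?addr0 // => u /andP[/setIP[Tu _] ut].
  by rewrite (orbproj_orth X ii i2 Trep) // eq_sym (negPf ut).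
have sub : (orbproj X t *m eigproj phi <= topproj n phi)%MS.
  by rewrite -op -mulmxA submxMl.
apply/eqmxP/andP; split=> //; apply: topproj_simple => //.
  apply/mxmoduleP => g Ug; rewrite -mulmxA eigproj_comm // mulmxA comm // -mulmxA.
  exact: submxMl.
apply: contraNneq (extends_block_eigen Pt ext) => z.
by rewrite -(block_orbproj t) -mulmxA z mulmx0.
Qed.

Lemma topproj_neq0 t phi : t \in primitive_reps T -> extends_alpha w t phi -> topproj n phi != 0.
Proof.
move=> Tt ext; rewrite -mxrank_eq0 -(orbproj_eigen Tt ext) mxrank_eq0.
have Pt : t \in P by have /setIP[] := Tt.
apply: contraNneq (extends_block_eigen Pt ext) => z.
by rewrite -(block_orbproj t) -mulmxA z mulmx0.
Qed.

Lemma topproj_N_tilde phi : linear_character phi -> topproj n phi != 0 -> N_tilde w T phi.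
Proof.
move=> Lphi nz; have [/existsP[t /andP[Tt et]]|/existsPn none] :=
    boolP [exists t in primitive_reps T, e_ t *m eigproj phi != 0].
  by exists t => //; apply: block_eigen_extends.
case/eqP: nz; rewrite /topproj (primproj_orbits X ii i2 Trep inz Mn) mulmx_suml big1 // => t Tt.
by apply: orbproj_eigen0; apply/eqP; have := none t; rewrite Tt /= negbK.
Qed.

Lemma copy_orbit t (D : 'M_(zdim w, wdim X)) : (D :=: e_ t)%MS ->
  (\sum_(x in UV) <<D *m W x>> :=: orbproj X t)%MS.
Proof.
move=> im; have imx x : x \in UV -> (D *m W x :=: e_ (x t))%MS.
  move=> Ux; apply: eqmx_trans (eqmxMr _ im) _; rewrite block_unitary //.
  apply: eqmxMfull; rewrite row_full_unit; exact: repr_mx_unit.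
apply/eqmxP/andP; split.
  apply/sumsmx_subP => x Ux; rewrite genmxE imx //.
  rewrite (_ : e_ (x t) = e_ (x t) *m orbproj X t) ?submxMl //.
  rewrite /orbproj block_regproj ?orbit_of_stable ?orbit_of_refl //; exact: orbit_of_saturated.
rewrite /orbproj regprojE scalemx_sub // summx_sub // => v /orbit_ofP[x Ux xt].
by rewrite (sumsmx_sup x) // genmxE imx // (block_congr X ii xt).
Qed.

Lemma ind_Wt_affords t : affords (ind_Wt w t) W (orbproj X t).
Proof.
have [D [frD DW im]] := copies t.
have De : D *m e_ t = D.
  have /submxP[Y ->] : (D <= e_ t)%MS by rewrite im.
  by rewrite -mulmxA block_idem.
apply: affords_eqmx (copy_orbit im) _; apply: (ind_embed (rH := Wt_repr w t) _ frD DW De).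
move=> x Ux nx; rewrite -{1}De -(mulmxA D) block_unitary // -!mulmxA block_mul //.
rewrite ifN ?mulmx0 //; apply: contra nx => xt; exact/setIdP.
Qed.

End Orbit.

Section Entering.
Variables (T : {set V}) (n : {set A}).
Hypotheses (Trep : orbit_representatives h j T) (Mn : minimal_ideal n).

Lemma affords_scalar p (r : mx_representation C UV p) phi (a : N) : linear_character phi ->
  affords r W (topproj n phi) -> r (scalar_of m a) = (phi a)%:M.
Proof.
move=> Lphi [psi [fr eq im]]; apply: (row_free_inj fr); rewrite eq ?scalar_of_UV //.
have /submxP[Y ->] : (psi <= topproj n phi)%MS by rewrite im.
by rewrite -[LHS]mulmxA /topproj -[_ *m W _]mulmxA eigproj_scalW // -!scalemxAr mul_scalar_mx.
Qed.

Lemma alpha_enters_top t phi p (r : mx_representation C UV p) : t \in primitive_reps T ->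
  extends_alpha w t phi -> affords r W (topproj n phi) -> alpha_enters w t r.
Proof.
move=> Tt ext [psi [fr eq im]]; have Pt : t \in P by have /setIP[] := Tt.
have nz := extends_block_eigen Pt ext.
have /rowV0Pn[y ye ynz] := nz.
have /submxP[v Ev] : (y <= psi)%MS.
  rewrite im; apply: submx_trans ye _; rewrite -(block_primproj Mn Pt) -mulmxA.
  exact: submxMl.
exists v => [|g Og].
  by apply: contraNneq ynz => v0; rewrite Ev v0 mul0mx.
have Ug : g \in UV by case/setIdP: Og.
apply: (row_free_inj fr); rewrite -mulmxA eq // mulmxA -Ev -scalemxAl -Ev.
have /submxP[z ->] := ye; rewrite -!mulmxA eigproj_comm // (mulmxA (e_ t)) block_alpha //.
by rewrite -scalemxAl -scalemxAr.
Qed.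

Lemma alpha_enters_unique t t' phi p (r : mx_representation C UV p) :
    t \in primitive_reps T -> t' \in primitive_reps T ->
  extends_alpha w t phi -> affords r W (topproj n phi) -> alpha_enters w t' r -> t' = t.
Proof.
move=> Tt Tt' ext [psi [fr eq im]] [v vnz Hv].
have Pt' : t' \in P by have /setIP[] := Tt'.
have [TT TT'] : t \in T /\ t' \in T by move: Tt Tt' => /setIP[? _] /setIP[? _].
pose y := v *m psi.
have ynz : y != 0 by apply: contraNneq vnz => y0; apply/eqP/(row_free_inj fr); rewrite mul0mx.
have yW g : g \in Omega h i -> y *m W g = alpha w t' g *: y.
  by move=> Og; have Ug : g \in UV by [case/setIdP: Og]; rewrite -mulmxA -eq // mulmxA Hv // scalemxAl.
have yorb : y *m orbproj X t = y.
  have /submxP[z ->] : (y <= orbproj X t *m eigproj phi)%MS.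
    by rewrite (orbproj_eigen Trep Mn Tt ext) -im submxMl.
  rewrite eigproj_cent; last by move=> g; apply: orbproj_comm.
  by rewrite -!mulmxA /orbproj regproj_mul ?setIid //; apply: orbit_of_saturated.
have [/existsP[u /andP[ou yu]]|/existsPn none] := boolP [exists u in orbit_of h i t, y *m e_ u != 0].
  have [g gO | a Na au] := @alpha_separates _ _ _ _ h i w i t' u ii inz i2 Pt'.
    have Ug : g \in UV by case/setIdP: (gO).
    have Og : g \in Omega h i := gO.
    have : y *m W g *m e_ u = y *m e_ u *m W g.
      rewrite -!mulmxA block_unitary // (@block_congr _ _ _ _ _ _ _ X i (g u) u) //.
      by have /setIdP[_ /forallP gi] := Og; apply/idealVS/gi/ideal_sub_ann.
    rewrite yW // -(mulmxA y (e_ u)) block_alpha // -scalemxAl -scalemxAr => /eqP.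
    by rewrite -subr_eq0 -scalerBl scaler_eq0 (negPf yu) orbF subr_eq0 => /eqP.
  apply: (rep_unique Trep TT' TT _ ou).
  have [b Eb] := subg_scalar Na; apply/orbit_ofP; exists (scalar_of m b).
    exact: scalar_of_UV.
  by rewrite scalar_ofE idealVBC /nval Eb.
case/eqP: ynz; rewrite -yorb /orbproj regprojE -scalemxAr mulmx_sumr big1 ?scaler0 // => u ou.
by apply/eqP; have := none u; rewrite ou /= negbK.
Qed.

Lemma alpha_conj t g x : g \in UV -> alpha w t (x ^ g)%g = alpha w ((g^-1)%g t) x.
Proof.
move=> Ug; rewrite /alpha /conjg !permM -{2}[t](permKV g).
by rewrite (unitary_fform _ _ Ug).
Qed.

Lemma alpha_stabilizerE t : t \in P -> alpha_stabilizer w t = coset_stabN h j t.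
Proof.
move=> Pt; apply/setP => g; apply/setIdP/mulsgP => [[Ug /forall_inP Hg]|].
  have Ug' : (g^-1)%g \in UV by rewrite groupV.
  have [x Ox|a Na au] := @alpha_separates _ _ _ _ h i w i t ((g^-1)%g t) ii inz i2 Pt.
    by have := Hg x Ox; rewrite (alpha_conj _ _ Ug) => /eqP/esym.
  have [b Eb] := subg_scalar Na.
  exists (g * scalar_of m b)%g (scalar_of m b^-1).
  - apply/setIdP; split; first by rewrite groupM ?scalar_of_UV.
    rewrite permM scalar_ofE -(unitary_idealV _ _ Ug') (unitaryB _ _ Ug') .
    rewrite -[nval b *: _]addr0 (unitary_linear Ug') (unitary0 Ug') addr0 permK.
    by rewrite idealVBC /nval Eb.
  - apply/imsetP; exists (sgval b^-1)%g => //; exact: subgP.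
  by rewrite scalar_ofV mulgK.
case=> x _ /setIdP[Ux xt] /imsetP[c Nc ->] ->.
have [b Eb] := subg_scalar Nc; have -> : homothety m c = scalar_of m b by rewrite /scalar_of Eb.
have Ug : (x * scalar_of m b)%g \in UV by rewrite groupM ?scalar_of_UV.
split=> //; apply/forall_inP => y Oy; apply/eqP; rewrite (alpha_conj _ _ Ug).
have Ux' : (x^-1)%g \in UV by rewrite groupV.
rewrite invMg permM -scalar_ofV scalar_ofE -{1}[_ *: t]addr0 (unitary_linear Ux') (unitary0 Ux') addr0.
rewrite alpha_scale //; apply: alpha_congr => //.
by rewrite -(unitary_idealV _ _ Ux) (unitaryB _ _ Ux) permKV idealVBC.
Qed.

End Entering.

Section Inducing.
Variables (T : {set V}) (n : {set A}).
Hypotheses (Trep : orbit_representatives h j T) (Mn : minimal_ideal n).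

Lemma Zt_phi_induced t phi : t \in primitive_reps T -> extends_alpha w t phi ->
  exists rY : mx_representation C (coset_stabN h j t) (\rank (Zt_eigenspace w t phi)),
    Zt_phi_extension rY /\ affords (ind_GtN rY) W (topproj n phi).
Proof.
move=> Tt ext; have [Lphi _] := ext; have Pt : t \in P by have /setIP[] := Tt.
have [D [frD DW im]] := copies t.
have De : D *m e_ t = D.
  have /submxP[Y ->] : (D <= e_ t)%MS by rewrite im.
  by rewrite -mulmxA block_idem.
have [M EM] : exists M, M = row_base (Zt_eigenspace w t phi) by eexists.
have MZ : (M <= Zt_eigenspace w t phi)%MS by rewrite EM eq_row_base.
have frMD : row_free (M *m D) by rewrite /row_free mxrankMfree // -/(row_free _) EM row_base_free.
have [psi Epsi] : exists psi, psi = M *m D *m eigproj phi by exists (M *m D *m eigproj phi).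
have corner := Zt_eigen_corner Pt Lphi DW im MZ; rewrite -Epsi in corner.
have fr : row_free psi.
  rewrite -row_leq_rank -{1}(eqP frMD) -(eqmx_scale _ Bs_ratio_neq0) -corner.
  exact: mxrankM_maxl.
have MW g : g \in coset_stab h j t -> M *m D *m W g = M *m Wt_mx w t g *m D.
  by move=> Gg; rewrite -mulmxA DW // mulmxA.
have stabG g : g \in coset_stab h j t ->
  psi *m W g = M *m Wt_mx w t g *m D *m eigproj phi.
  by move=> Gg; have /setIdP[Ug _] := Gg; rewrite Epsi -mulmxA eigproj_comm // mulmxA MW.
have stabN (a : N) : psi *m W (scalar_of m a) = phi a *: psi.
  by rewrite Epsi -mulmxA eigproj_scalW // scalemxAr.
have stab x : x \in coset_stabN h j t -> (psi *m W x <= psi)%MS.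
  case/mulsgP=> g _ Gg /imsetP[c Nc ->] ->; have [b Eb] := subg_scalar Nc.
  have -> : homothety m c = scalar_of m b by rewrite /scalar_of Eb.
  have /setIdP[Ug _] := Gg; rewrite opWM ?scalar_of_UV // mulmxA stabG //.
  have /submxP[K ->] : (M *m Wt_mx w t g <= M)%MS.
    rewrite EM !eq_row_base (eqmxMr _ (eq_row_base _)).
    exact: (mxmoduleP (Zt_eigenspace_module w t phi)).
  by rewrite -(mulmxA K) -(mulmxA K) -Epsi -mulmxA stabN -scalemxAr scalemx_sub ?submxMl.
have [rY rYE] := stable_repr (coset_stabN_sub h j t) fr stab.
have GtN g : g \in coset_stab h j t -> g \in coset_stabN h j t.
  move=> Gg; apply/mulsgP; exists g 1%g; rewrite ?mulg1 //.
  by apply/imsetP; exists 1%g; rewrite ?group1 //; apply/permP => v; rewrite perm1 permE scale1r.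
have NGtN (a : N) : scalar_of m a \in coset_stabN h j t.
  apply/mulsgP; exists 1%g (scalar_of m a); rewrite ?group1 ?mul1g //.
  by apply/imsetP; exists (sgval a) => //; apply: subgP.
exists rY; split.
  split=> [g Gg|a]; apply: (row_free_inj fr).
    have VJ : Zt_phi w t phi g *m M = M *m Wt_mx w t g.
      have := val_submodJ (Zt_eigenspace_module w t phi) 1%:M Gg.
      by rewrite EM /val_submod /= !mul1mx.
    rewrite rYE ?GtN // stabG // Epsi; move: VJ; rewrite -!(mulmxA M) => VJ.
    by rewrite [RHS]mulmxA VJ !mulmxA.
  by rewrite (rYE _ (NGtN a)) stabN mul_scalar_mx.
pose S := [set v : V | [exists a : N, v - nval a *: t \in idealV m j]].
have SP v : reflect (exists a : N, v - nval a *: t \in idealV m j) (v \in S).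
  by rewrite in_set; apply: existsP.
have satS : saturated i S.
  move=> u v uv; apply/SP/SP => [[a Ha]|[a Ha]]; exists a.
    by rewrite -(subrK u v) -addrA idealVD // idealVBC.
  by rewrite -(subrK v u) -addrA idealVD.
have psiE x : x \in UV -> psi *m W x *m regproj X S
    = if x \in coset_stabN h j t then psi *m W x else 0.
  move=> Ux; have -> : (x \in coset_stabN h j t) = (x t \in S).
    apply/idP/SP => [/mulsgP[g _ /setIdP[Ug tg] /imsetP[c Nc ->] ->]|[a xa]].
      have [b Eb] := subg_scalar Nc; exists b; rewrite permM /nval Eb.
      have -> : homothety m c = scalar_of m b by rewrite /scalar_of Eb.
      by rewrite !scalar_ofE /nval Eb -scalerBr idealVZ.
    apply/mulsgP; exists (x * scalar_of m (a^-1))%g (scalar_of m a).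
    - apply/setIdP; split; first by rewrite groupM ?scalar_of_UV.
      rewrite permM -(unitary_idealV _ _ (scalar_of_UV h a)) (unitaryB _ _ (scalar_of_UV h a)).
      by rewrite -permM -scalar_ofM mulVg scalar_of1 perm1 scalar_ofE.
    - by apply/imsetP; exists (sgval a) => //; apply: subgP.
    by rewrite -mulgA -scalar_ofM mulVg scalar_of1 mulg1.
  have term (a : N) : M *m D *m scalW a *m W x *m regproj X S
      = if x t \in S then M *m D *m scalW a *m W x else 0.
    have Uy : (scalar_of m a * x)%g \in UV by rewrite groupM ?scalar_of_UV.
    have -> : M *m D *m scalW a *m W x = M *m D *m W (scalar_of m a * x)%g.
      by rewrite opWM ?scalar_of_UV // mulmxA.
    have -> : (x t \in S) = ((scalar_of m a * x)%g t \in S).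
      rewrite (scalar_of_comm a Ux) permM scalar_ofE.
      apply/SP/SP => [[b Hb]|[b Hb]].
        by exists (a * b)%g; rewrite nvalM -scalerA -scalerBr idealVZ.
      exists (a^-1 * b)%g; rewrite nvalM -scalerA nvalV -[x t]scale1r.
      by rewrite -(mulVr (valP (sgval a) : nval a \is a GRing.unit)) -scalerA -scalerBr idealVZ.
    move: (scalar_of m a * x)%g Uy => y Uy.
    have KE : M *m D = M *m D *m e_ t by rewrite -mulmxA De.
    move: (M *m D) KE => K KE.
    rewrite {1}KE -[K *m _ *m W y]mulmxA block_unitary // -!mulmxA block_regproj //.
    by case: ifP => _; rewrite ?mulmx0 // -block_unitary // mulmxA -KE.
  rewrite Epsi eigprojE -!(scalemxAr, scalemxAl) !(mulmx_sumr, mulmx_suml).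
  case: ifP => xt.
    congr (_ *: _); apply: eq_bigr => a _; rewrite -!(scalemxAr, scalemxAl).
    by rewrite term xt.
  by rewrite big1 ?scaler0 // => a _; rewrite -!(scalemxAr, scalemxAl) term xt scaler0.
have psi1 : psi *m regproj X S = psi.
  by have := psiE _ (group1 UV); rewrite group1 repr_mx1 mulmx1.
have aff : affords (ind_GtN rY) W (\sum_(x in UV) <<psi *m W x>>)%MS.
  apply: (ind_embed (rH := rY) _ fr _ psi1); first by move=> x Hx; rewrite rYE.
  by move=> x Ux nx; rewrite psiE // (negPf nx).
have psiT : psi = M *m D *m topproj n phi.
  have DP : D *m primproj X n = D by rewrite -De -mulmxA block_primproj.
  by rewrite Epsi /topproj [RHS]mulmxA -[X in _ = X *m _]mulmxA DP.
have psiW x : x \in UV -> (psi *m W x <= topproj n phi)%MS.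
  by move=> Ux; rewrite psiT -mulmxA topproj_comm // [X in (X <= _)%MS]mulmxA submxMl.
apply: affords_eqmx aff; apply/eqmxP/andP; split.
  by apply/sumsmx_subP => x Ux; rewrite genmxE psiW.
apply: topproj_simple => //.
- apply/mxmoduleP => g Ug; rewrite sumsmxMr; apply/sumsmx_subP => x Ux.
  rewrite (eqmxMr _ (genmxE _)) -mulmxA -opWM // (sumsmx_sup (x * g)%g) ?groupM //.
  by rewrite genmxE.
- by apply/sumsmx_subP => x Ux; rewrite genmxE psiW.
have rk : \rank (Zt_eigenspace w t phi) != 0%N by rewrite mxrank_eq0 Zt_eigenspace_neq0.
apply: contraNneq rk => s0; rewrite -(eqP fr) mxrank_eq0 -submx0 -s0.
by rewrite (sumsmx_sup 1%g) ?group1 // genmxE repr_mx1 mulmx1.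
Qed.

End Inducing.
End Constituents.

Local Transparent Xsys.

Section Model.
Variables (C : numClosedFieldType) (O : involutive_dvr) (A : framed_ring O) (m : nat).
Variables (h : herm_space A m) (i : {set A}) (w : weil_data C h i).
Local Notation V := 'rV[A]_m.
Local Notation UV := (unitary_group h).
Local Notation N := (subg_of (unitary_scalars A)).
Local Notation j := (ann i).
Local Notation s1 := (sdpair1 (heis_groupAction h)).


Local Notation X := (Xsys w).

Lemma opE_Xsys v : opE X v = Xrep w (s1 ((0, v) : heis h)). Proof. by []. Qed.

Lemma block_fix n p (M : 'M_(p, wdim X)) :
  (forall z, z \in idealV m n -> M *m opE X z = M) -> M *m block X n 0 = M.
Proof.
move=> HM; rewrite blockE -scalemxAr mulmx_sumr.
rewrite (eq_bigr (fun _ => M)) => [|z nz]; last by rewrite -scalemxAr HM // h0r oppr0 mu20 scale1r.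
by rewrite sumr_const -scaler_nat scalerA mulVf ?scale1r //; exact: card_neq0.
Qed.

(** [Bot] is the block of the zero vector for the minimal ideal. *)
Lemma Bot_block n : minimal_ideal n -> (Bot w n :=: block X n 0)%MS.
Proof.
move=> Mn; have [In _] := minimal_ideal_ideal Mn; apply/eqmxP/andP; split.
  have H : (Bot w n : 'M_(_, wdim X)) *m block X n 0 = Bot w n.
    apply: block_fix => z nz; apply: (rfix_mx_id (Xrep w)).
    by apply/imsetP; exists z.
  rewrite -{1}H; exact: submxMl.
apply/(@rfix_mxP _ _ _ _ (Xrep w)) => _ /imsetP[v nv ->].
have := block_opE X 0 In (minimal_sq0 Mn) nv; rewrite h0r mu20 scale1r.
by rewrite opE_Xsys.
Qed.

Local Opaque Xsys.

Lemma Top_affords n : minimal_ideal n -> affords (Top_repr w n) (opW X) (primproj X n).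
Proof.
move=> Mn; have [In _] := minimal_ideal_ideal Mn.
have b2 := block_idem X 0 In (minimal_sq0 Mn).
have modP : mxmodule (opW X) (primproj X n).
  by apply/mxmoduleP => g Ug; rewrite primproj_comm // submxMl.
apply: affords_from_rsim (affords_submod modP).
apply: (mx_rsim_factmod modP (Bot_module w n)).
  apply/eqmxP; rewrite submx1 /= -[1%:M](subrK (block X n 0)) addmx_sub_adds //.
  by rewrite Bot_block.
apply/mxdirect_addsP/eqP; rewrite -submx0; apply/rV_subP => v.
rewrite sub_capmx (Bot_block Mn) => /andP[/submxP[a Ea] /submxP[b Eb]].
have : v *m block X n 0 = v by rewrite Eb -mulmxA b2.
by rewrite Ea -mulmxA mulmxBl mul1mx b2 subrr mulmx0 => <-; apply: sub0mx.
Qed.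

Lemma Top_phi_affords n phi : minimal_ideal n -> linear_character phi ->
  affords (Top_phi w n phi) (opW X) (topproj X n phi).
Proof.
move=> Mn Lphi; apply: affords_sub (Top_affords Mn) _ => psi fr eq im.
apply/eqmxP/andP; split.
  have Up : (psi <= primproj X n)%MS by rewrite im.
  have H : Top_eigenspace w n phi *m psi *m eigproj X phi = Top_eigenspace w n phi *m psi.
    apply: eigproj_fix => // a; rewrite -mulmxA -eq ?scalar_of_UV // mulmxA scalemxAl.
    congr (_ *m _); apply/eigenspaceP.
    by have /sub_bigcapmxP/(_ a (in_setT a)) := submx_refl (Top_eigenspace w n phi).
  rewrite -H; case/submxP: Up => Y ->.
  by rewrite !mulmxA -[X in (X <= _)%MS]mulmxA submxMl.
have pe : topproj X n phi = eigproj X phi *m primproj X n.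
  by apply: eigproj_cent => g; apply: primproj_comm.
have /submxP[Y EY] : (topproj X n phi <= psi)%MS by rewrite im pe submxMl.
rewrite EY submxMr //; apply/sub_bigcapmxP => a _; apply/eigenspaceP.
apply: (row_free_inj fr); rewrite -mulmxA eq ?scalar_of_UV // mulmxA -scalemxAl -EY.
by rewrite /topproj -mulmxA eigproj_scalW // scalemxAr.
Qed.

Section Copies.
Hypotheses (ii : is_ideal i) (inz : i != [set 0]) (i2 : {in i &, forall c d : A, c * d = 0}).

Lemma Xsys_copies : has_copies X.
Proof.
move=> t; have [B [frB BE BW im]] := base_block0 w ii i2.
have Bb : B *m block X i 0 = B.
  have /submxP[Y ->] : (B <= block X i 0)%MS by rewrite im.
  by rewrite -mulmxA block_idem.
have Euniv : opE X (- t) *m opE X t = 1%:M by apply: opE_NK.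
have Et : opE X t \in unitmx by case/mulmx1_unit: Euniv.
have shift : B *m opE X t = B *m opE X t *m block X i t.
  by rewrite -{1}Bb -[LHS]mulmxA -[RHS]mulmxA block_shift add0r.
exists (B *m opE X t); split.
- by rewrite /row_free mxrankMfree // row_free_unit.
- move=> g /setIdP[Ug tg]; rewrite -mulmxA opEW // [LHS]mulmxA BW // [RHS]mulmxA -[LHS]mulmxA.
  rewrite -[RHS]mulmxA /Wt_mx -[RHS]mulmxA; congr (_ *m _).
  have := opED X (g t - t) t; rewrite subrK => H.
  have -> : opE X (g t) = mu w (h (g t) t) *: (opE X (g t - t) *m opE X t).
    rewrite H scalerA -[LHS]scale1r; congr (_ *: _).
    by rewrite hBr muD muN mu_form invr1 mulr1 (muC w (g t) t) -muD subrr mu0.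
  by rewrite -scalemxAr [B *m (_ *m _)]mulmxA BE // [in RHS]Srep_split // -scalemxAl -mulmxA.
apply/eqmxP; rewrite {1}shift submxMl /=.
have -> : block X i t = opE X (- t) *m block X i 0 *m opE X t.
  by rewrite -[_ *m opE X t]mulmxA block_shift add0r mulmxA Euniv mul1mx.
have /submxP[Y ->] : (block X i 0 <= B)%MS by rewrite im.
by rewrite [_ *m (Y *m B)]mulmxA -[_ *m B *m _]mulmxA submxMl.
Qed.

End Copies.
End Model.

Local Opaque Xsys.

Section Duality.
Variables (C : numClosedFieldType) (gT : finGroupType).
Hypothesis gTC : forall x y : gT, (x * y = y * x)%g.
Implicit Types (phi psi : {ffun gT -> C}) (K : {group gT}) (x y : gT).

Lemma sum_character K (chi : gT -> C) phi : linear_character phi ->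
    chi 1%g = 1 -> {in K &, forall x y, chi (x * y)%g = chi x * chi y} ->
  \sum_(x in K) phi x / chi x = if [forall x in K, phi x == chi x] then #|K|%:R else 0.
Proof.
move=> Lphi chi1 chiM.
have chinz x : x \in K -> chi x != 0.
  move=> Kx; apply/eqP => x0; have := chiM x (x^-1)%g Kx; rewrite groupV mulgV chi1 x0 mul0r.
  by move/(_ Kx)/eqP; rewrite oner_eq0.
case: ifP => [/forall_inP ext|/forallPn[x]].
  rewrite (eq_bigr (fun _ => 1)) ?sumr_const // => x Kx.
  by rewrite (eqP (ext x Kx)) divff ?chinz.
rewrite negb_imply => /andP[Kx ne]; set S := \sum_(y in K) _.
have : phi x / chi x * S = S.
  rewrite /S mulr_sumr [RHS](reindex_inj (mulgI x)) /=; apply: eq_big => [y|y Ky].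
    by rewrite groupMl.
  by rewrite (linM Lphi) chiM // mulrACA -invfM.
move/eqP; rewrite -subr_eq0 -{2}[S]mul1r -mulrBl mulf_eq0 subr_eq0 => /orP[/eqP E|/eqP //].
by case/eqP: ne; rewrite -[phi x](divfK (chinz x Kx)) E mul1r.
Qed.

(** A finite commutative group has as many linear characters as elements: they
    are the irreducible representations over the algebraically closed field. *)
Lemma dual_exists : exists s : seq {ffun gT -> C},
  enumerates s (@linear_character C gT) /\ size s = #|gT|.
Proof.
pose G := [set: gT]%G; have sG : irrType C G := DecSocleType (regular_repr C G).
have F'G := pchar0_group C G.
have splitG : group_splitting_field C G by apply: group_closure_closed_field.
have cGG : abelian G by apply/centsP => x _ y _; apply: gTC.
have card_sG : #|sG| = #|gT|.
  have := card_classes_abelian G; rewrite cGG => /esym/eqP E.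
  by rewrite card_irr_pchar // E cardsT.
have linX := irr_degree_abelian splitG cGG (_ : sG).
pose r (W : sG) : {ffun gT -> C} := [ffun x => irr_mode W x].
have scalX W x : irr_repr W x = (r W x)%:M.
  by rewrite ffunE; apply: (irr_center_scalar splitG); rewrite (center_idP cGG) in_setT.
have inj_r : injective r.
  move=> V W eqVW; rewrite -(irr_reprK_pchar F'G V) -(irr_reprK_pchar F'G W).
  move: (irr_repr V) (irr_repr W) (scalX V) (scalX W).
  rewrite !linX {}eqVW => rV rW rVx rWx; apply: irr_comp_rsim_pchar => //.
  exists 1%:M; rewrite ?row_free_unit ?unitmx1 // => x _.
  by rewrite mulmx1 mul1mx rVx rWx.
exists [seq r W | W <- enum sG]; split; last by rewrite size_map -cardE.
split=> [|phi]; first by rewrite map_inj_uniq ?enum_uniq.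
split=> [/mapP[W _ ->]|Lphi].
  by split=> [|a b]; rewrite !ffunE ?irr_mode1 // (irr_modeM splitG) // (center_idP cGG) in_setT.
have phiR : mx_repr G (fun x => (phi x)%:M : 'M_1).
  split=> [|x y _ _]; first by rewrite (lin1 Lphi).
  by rewrite (linM Lphi) scalar_mxM.
pose rG := MxRepresentation phiR.
have irrG : mx_irreducible rG by apply/mx_abs_irrW/linear_mx_abs_irr.
have [B n1 frB HB] := rsim_irr_comp_pchar sG F'G irrG.
apply/mapP; exists (irr_comp sG rG); first by rewrite mem_enum.
apply/ffunP => x; have := HB x (in_setT x); rewrite scalX /= mul_scalar_mx mul_mx_scalar.
move/eqP; rewrite -subr_eq0 -scalerBl scaler_eq0 subr_eq0 => /orP[/eqP //|/eqP B0].
by move: frB; rewrite /row_free B0 mxrank0.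
Qed.

(** Column orthogonality: a square matrix with orthogonal rows. *)
Lemma dual_column s x : enumerates s (@linear_character C gT) ->
  \sum_(phi <- s) phi x = if x == 1%g then #|gT|%:R else 0.
Proof.
move=> [us Es]; have [s' [[us' Es'] sz]] := dual_exists.
have ss' : perm_eq s s'.
  by apply: uniq_perm => // phi; apply/idP/idP => [/Es/Es'|/Es'/Es].
rewrite (perm_big _ ss') /= => {s us Es ss'}.
pose z : {ffun gT -> C} := [ffun=> 0].
pose f (i : 'I_#|gT|) := nth z s' i.
have Lf i : linear_character (f i) by apply/Es'/mem_nth; rewrite sz.
have gt0 : #|gT|%:R != 0 :> C by rewrite pnatr_eq0 -lt0n; apply/card_gt0P; exists 1%g.
pose Tm : 'M[C]_#|gT| := \matrix_(i, j) f i (enum_val j).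
pose Tm' : 'M[C]_#|gT| := \matrix_(j, i) ((f i (enum_val j))^-1 / #|gT|%:R).
have TT : Tm *m Tm' = 1%:M.
  apply/matrixP => a b; rewrite !mxE.
  under eq_bigr do rewrite !mxE mulrA.
  rewrite -mulr_suml -(big_enum_val (fun x => f a x / f b x)) /=.
  rewrite (eq_bigl (mem [set: gT])) => [|y]; last by rewrite !inE.
  rewrite sum_character ?(lin1 (Lf b)) //; last by move=> ? ? _ _; apply: linM (Lf b) _ _.
  rewrite cardsT; case: (eqVneq a b) => [->|ne].
    by rewrite ifT ?divff //; apply/forall_inP.
  rewrite ifF ?mul0r //; apply: contraNF ne => /forall_inP E.
  have : f a = f b by apply/ffunP => y; apply/eqP/E; rewrite in_setT.
  by move/eqP; rewrite nth_uniq ?sz.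
have := mulmx1C TT => /matrixP/(_ (enum_rank 1%g) (enum_rank x)).
rewrite mxE [RHS]mxE (inj_eq enum_rank_inj) eq_sym.
have TE l : Tm' (enum_rank 1%g) l * Tm l (enum_rank x) = f l x / #|gT|%:R.
  by rewrite mulrC; congr (_ * _); rewrite mxE enum_rankK // (lin1 (Lf l)) invr1 mul1r.
rewrite (eq_bigr _ (fun l _ => TE l)).
rewrite -mulr_suml => H; rewrite (big_nth z) sz big_mkord.
rewrite -[LHS](divfK gt0) H; case: ifP => _; rewrite ?mul1r ?mul0r //.
Qed.

Lemma card_extensions K (chi : gT -> C) : chi 1%g = 1 ->
    {in K &, forall x y, chi (x * y)%g = chi x * chi y} ->
  exists2 s : seq {ffun gT -> C},
    enumerates s (fun phi => linear_character phi /\ forall x, x \in K -> phi x = chi x)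
  & size s = #|[set: gT] : K|%g.
Proof.
move=> chi1 chiM; have [s [Ls sz]] := dual_exists; have [us Es] := Ls.
pose ext phi := [forall x in K, phi x == chi x].
exists [seq phi <- s | ext phi].
  split=> [|phi]; first exact: filter_uniq.
  rewrite mem_filter; split=> [/andP[/forall_inP E /Es Lphi]|[Lphi E]].
    by split=> // x Kx; apply/eqP/E.
  by apply/andP; split; [apply/forall_inP => x Kx; apply/eqP/E|apply/Es].
have K0 : #|K|%:R != 0 :> C by rewrite pnatr_eq0 -lt0n cardG_gt0.
apply/eqP; rewrite -(eqr_nat C) -divgS ?subsetT // natf_div; last exact/cardSg/subsetT.
rewrite size_filter -sum1_count natr_sum big_mkcond /= cardsT; apply/eqP.
apply: (mulIf K0); rewrite divfK // mulr_suml.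
transitivity (\sum_(phi <- s) \sum_(x in K) phi x / chi x).
  rewrite big_seq [RHS]big_seq; apply: eq_bigr => phi /Es Lphi.
  by rewrite sum_character // /ext; case: ifP; rewrite ?mul1r ?mul0r.
rewrite exchange_big /=; under eq_bigr do rewrite -mulr_suml dual_column //.
rewrite (bigD1 1%g) //= eqxx chi1 divr1 big1 ?addr0 // => x /andP[_ /negPf->].
by rewrite mul0r.
Qed.

End Duality.

Lemma enumerates_perm (I : eqType) (s s' : seq I) (P : I -> Prop) :
  enumerates s P -> enumerates s' P -> perm_eq s s'.
Proof.
move=> [us Es] [us' Es']; apply: uniq_perm => // x.
by apply/idP/idP => [/Es/Es'|/Es'/Es].
Qed.

Section Assembly.
Variables (C : numClosedFieldType) (O : involutive_dvr) (A : framed_ring O) (m : nat).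
Variables (h : herm_space A m) (i n : {set A}) (w : weil_data C h i) (T : {set 'rV[A]_m}).
Hypotheses (ii : is_ideal i) (inz : i != [set 0]) (i2 : {in i &, forall c d : A, c * d = 0}).
Hypotheses (Mn : minimal_ideal n) (Trep : orbit_representatives h (ann i) T).
Local Notation V := 'rV[A]_m.
Local Notation UV := (unitary_group h).
Local Notation N := (subg_of (unitary_scalars A)).
Local Notation P := (primitive_vectors A m).
Local Notation j := (ann i).
Local Notation X := (Xsys w).
Local Notation W := (opW X).
Local Notation eigproj := (eigproj X).
Local Notation topproj := (topproj X n).
Local Notation "'e_' v" := (block X i v) (at level 8, v at level 2).
Implicit Types (t v : V) (phi psi : {ffun N -> C}) (a b : N).

Let spanX : spanning X. Proof. exact: Xsys_spanning. Qed.
Let copies : has_copies X. Proof. exact: Xsys_copies. Qed.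

Lemma sum_eigproj (s : seq {ffun N -> C}) : enumerates s (@linear_character C N) ->
  \sum_(phi <- s) eigproj phi = 1%:M.
Proof.
move=> Es; have [_ Ls] := Es; under eq_bigr do rewrite eigprojE.
rewrite -scaler_sumr exchange_big /=.
transitivity (#|N|%:R^-1 *: \sum_a (\sum_(phi <- s) phi (a^-1)%g) *: scalW X a).
  congr (_ *: _); apply: eq_bigr => a _; rewrite scaler_suml big_seq [RHS]big_seq.
  by apply: eq_bigr => phi /Ls Lphi; rewrite (linV Lphi).
rewrite (bigD1 1%g) //= [X in _ + X]big1 ?addr0 => [|a na].
  rewrite (dual_column (@scalarC _ _) _ Es) invg_eq1.
  by rewrite eqxx scalerA mulVf ?cardN_neq0 // scale1r /scalW scalar_of1 repr_mx1.
by rewrite (dual_column (@scalarC _ _) _ Es) invg_eq1 (negPf na) scale0r.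
Qed.

Lemma topproj_orth phi psi : linear_character phi -> linear_character psi ->
  topproj phi *m topproj psi = if phi == psi then topproj phi else 0.
Proof.
move=> Lphi Lpsi; case: eqP => [->|/eqP ne]; first exact: topproj_idem.
have -> : topproj psi = eigproj psi *m primproj X n.
  by apply: eigproj_cent => g; apply: primproj_comm.
by rewrite /topproj mulmxA -(mulmxA (primproj X n)) eigproj_orth // mulmx0 mul0mx.
Qed.

Lemma N_tilde_topproj phi : N_tilde w T phi -> linear_character phi /\ topproj phi != 0.
Proof.
move=> [t Tt ext]; split; first by case: ext.
exact: (topproj_neq0 ii inz i2 spanX copies Trep Mn Tt ext).
Qed.

Lemma Top_phi_irr phi : N_tilde w T phi -> mx_irreducible (Top_phi w n phi).
Proof.
move=> Nphi; have [Lphi nz] := N_tilde_topproj Nphi.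
apply: affords_irr (Top_phi_affords w Mn Lphi) nz _ => U.
exact: topproj_simple.
Qed.

Lemma Top_phi_inj phi psi : N_tilde w T phi -> N_tilde w T psi -> phi != psi ->
  ~ mx_rsim (Top_phi w n phi) (Top_phi w n psi).
Proof.
move=> Nphi Npsi ne [B _ frB HB].
have [[Lphi _] [Lpsi _]] := (N_tilde_topproj Nphi, N_tilde_topproj Npsi).
have /mx_irrP[dim0 _] := Top_phi_irr Nphi.
have Bnz : B != 0.
  by apply: contraTneq frB => ->; rewrite /row_free mxrank0 eq_sym -lt0n.
case/eqP: ne; apply/ffunP => a; have := HB _ (scalar_of_UV h a).
rewrite (affords_scalar a Lphi (Top_phi_affords w Mn Lphi)).
rewrite (affords_scalar a Lpsi (Top_phi_affords w Mn Lpsi)) mul_scalar_mx mul_mx_scalar => /eqP.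
by rewrite -subr_eq0 -scalerBl scaler_eq0 (negPf Bnz) orbF subr_eq0 => /eqP.
Qed.

Lemma alphaM t a b : sgval a \in unitary_scalars_congr i -> sgval b \in unitary_scalars_congr i ->
  alpha w t (scalar_of m (a * b)%g) = alpha w t (scalar_of m a) * alpha w t (scalar_of m b).
Proof.
move=> ia ib; have iab : sgval (a * b)%g \in unitary_scalars_congr i.
  by rewrite sgvalM ?in_setT //; exact: (@groupM _ (Group (congr_group_set ii)) _ _ ia ib).
have Oa c (H : sgval c \in unitary_scalars_congr i) := scalar_congruence h ii H.
apply/eqP; have nz := block_neq0 copies t; rewrite -subr_eq0.
have : (alpha w t (scalar_of m (a * b)%g) - alpha w t (scalar_of m a) * alpha w t (scalar_of m b))
   *: e_ t = 0.
  rewrite scalerBl -(block_alpha ii i2 copies t (Oa _ iab)) scalar_ofM opWM ?scalar_of_UV //.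
  rewrite mulmxA (block_alpha ii i2 copies t (Oa _ ia)) -scalemxAl.
  by rewrite (block_alpha ii i2 copies t (Oa _ ib)) scalerA subrr.
by move/eqP; rewrite scaler_eq0 (negPf nz) orbF.
Qed.

Lemma part_b : exists2 s, enumerates s (N_tilde w T)
  & is_mult_free_sum (Top_repr w n) s (Top_phi w n).
Proof.
have [s0 [Es0 _]] := @dual_exists C N (@scalarC _ _).
have [us0 Ls0] := Es0.
have Es : enumerates [seq phi <- s0 | topproj phi != 0] (N_tilde w T).
  split=> [|phi]; first exact: filter_uniq.
  rewrite mem_filter; split=> [/andP[nz /Ls0 Lphi]|/N_tilde_topproj[Lphi nz]].
    exact: (topproj_N_tilde ii inz i2 copies Trep Mn).
  by rewrite nz; apply/Ls0.
exists [seq phi <- s0 | topproj phi != 0] => //; have [us Ls] := Es.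
have Lin phi : phi \in [seq phi <- s0 | topproj phi != 0] -> linear_character phi.
  by move/Ls/N_tilde_topproj => [].
split; first last.
- by move=> phi psi /Ls Nphi /Ls Npsi; apply: Top_phi_inj.
- by move=> phi /Ls Nphi; apply: Top_phi_irr.
apply: (affords_direct_sum us (Top_affords w Mn) (e := topproj)).
- rewrite -[LHS]mulmx1 -(sum_eigproj Es0) mulmx_sumr big_filter [RHS]big_mkcond /=.
  by apply: eq_bigr => phi _; case: eqP.
- by move=> phi psi /Lin Lphi /Lin Lpsi; apply: topproj_orth.
- by move=> phi g Ug; apply: topproj_comm.
by move=> phi /Lin Lphi; apply: Top_phi_affords.
Qed.

Lemma part_c : is_direct_sum (Top_repr w n) (enum (primitive_reps T)) (ind_Wt w).
Proof.
apply: (affords_direct_sum (enum_uniq _) (Top_affords w Mn) (e := orbproj X)).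
- by rewrite (primproj_orbits X ii i2 Trep inz Mn) big_enum.
- move=> t t'; rewrite !mem_enum => /setIP[Tt _] /setIP[Tt' _].
  exact: (orbproj_orth X ii i2 Trep).
- by move=> t g Ug; apply: orbproj_comm.
by move=> t _; apply: ind_Wt_affords.
Qed.

Lemma cardN : #|{: N}| = #|unitary_scalars A|.
Proof.
rewrite -(card_imset _ (@subg_inj _ (unitary_scalars A))); apply: eq_card => x.
apply/imsetP/idP => [[a _ ->]|Nx]; first exact: subgP.
by have [a Ea] := subg_scalar Nx; exists a.
Qed.

Lemma part_d t : t \in primitive_reps T -> exists s, [/\ enumerates s (extends_alpha w t),
  size s = #|unitary_scalars A : unitary_scalars_congr i|%g
  & is_mult_free_sum (ind_Wt w t) s (Top_phi w n)].
Proof.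
move=> Tt; have Pt : t \in P by have /setIP[] := Tt.
have [s0 [Es0 _]] := @dual_exists C N (@scalarC _ _).
have [us0 Ls0] := Es0; set s := [seq phi <- s0 | e_ t *m eigproj phi != 0].
have Es : enumerates s (extends_alpha w t).
  split=> [|phi]; first exact: filter_uniq.
  rewrite mem_filter; split=> [/andP[nz /Ls0 Lphi]|ext].
    exact: (block_eigen_extends ii i2 copies).
  by have [Lphi _] := ext; rewrite (extends_block_eigen ii inz i2 copies) //; apply/Ls0.
have [us Ls] := Es.
have Nt phi : phi \in s -> N_tilde w T phi by move/Ls => ext; exists t.
have Lin phi : phi \in s -> linear_character phi by move/Ls => [].
exists s; split=> //.
  pose K0 := [set a : N | sgval a \in unitary_scalars_congr i].
  have K0P a : (a \in K0) = (sgval a \in unitary_scalars_congr i) by rewrite in_set.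
  have K0g : group_set K0.
    apply/group_setP; split=> [|a b]; rewrite ?K0P.
      exact: (@group1 _ (Group (congr_group_set ii))).
    by move=> ia ib; rewrite sgvalM ?in_setT //; exact: (@groupM _ (Group (congr_group_set ii)) _ _ ia ib).
  have [||s' Es' sz] := @card_extensions C N (@scalarC _ _) (Group K0g) (fun a => alpha w t (scalar_of m a)).
  - by rewrite scalar_of1 /alpha perm1 fform_alt lambda0.
  - by move=> a b; rewrite !K0P; apply: alphaM.
  have ss' : perm_eq s s'.
    apply: enumerates_perm Es _; case: Es' => us' Es'; split=> // phi.
    split=> [/Es'[Lphi H]|[Lphi H]]; last by apply/Es'; split=> // a; rewrite K0P; apply: H.
    by split=> // a ia; apply: H; rewrite K0P.
  rewrite (perm_size ss') sz -divgS ?subsetT // cardsT card_congr.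
  rewrite -(@divgS _ (unitary_scalars A) (Group (congr_group_set ii))) /=.
    by congr (_ %/ _)%N; exact: cardN.
  by apply/subsetP => a /setIdP[].
have orb_sum : orbproj X t = \sum_(phi <- s) orbproj X t *m eigproj phi.
  rewrite -[LHS]mulmx1 -(sum_eigproj Es0) mulmx_sumr big_filter [RHS]big_mkcond /=.
  by apply: eq_bigr => phi _; case: eqP => // /(orbproj_eigen0 ii).
split; first last.
- by move=> phi psi /Nt Nphi /Nt Npsi; apply: Top_phi_inj.
- by move=> phi /Nt Nphi; apply: Top_phi_irr.
apply: (affords_direct_sum us (ind_Wt_affords ii i2 copies t) orb_sum).
- move=> phi psi /Lin Lphi /Lin Lpsi.
  have ce chi : orbproj X t *m eigproj chi = eigproj chi *m orbproj X t.
    by apply: eigproj_cent => g; apply: orbproj_comm.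
  have oo : orbproj X t *m orbproj X t = orbproj X t.
    by have /setIP[Tt' _] := Tt; rewrite (orbproj_orth X ii i2 Trep Tt' Tt') eqxx.
  rewrite {1}ce -mulmxA (mulmxA (orbproj X t)) oo ce mulmxA.
  case: eqP => [->|/eqP ne]; first by rewrite eigproj_idem // ce.
  by rewrite eigproj_orth // mul0mx.
- by move=> phi g Ug; rewrite -mulmxA eigproj_comm // !mulmxA orbproj_comm.
move=> phi /[dup] /Lin Lphi /Ls ext.
apply: affords_eqmx (Top_phi_affords w Mn Lphi).
by apply: eqmx_sym; apply: (orbproj_eigen ii inz i2 spanX copies Trep Mn).
Qed.

Lemma part_e phi : N_tilde w T phi ->
  exists t, [/\ t \in primitive_reps T,
       alpha_enters w t (Top_phi w n phi),
       (forall t', t' \in primitive_reps T ->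
          alpha_enters w t' (Top_phi w n phi) -> t' = t),
       alpha_stabilizer w t = coset_stabN h (ann i) t
     & (forall a, (scalar_of m a \in coset_stab h (ann i) t)
                  = (sgval a \in unitary_scalars_congr (ann i)))
       /\ exists rY : mx_representation C (coset_stabN h (ann i) t)
                         (\rank (Zt_eigenspace w t phi)),
          [/\ Zt_phi_extension rY,
            mx_rsim (Top_phi w n phi) (ind_GtN rY),
            mx_irreducible rY
          & (\rank (Zt_eigenspace w t phi))%:R
              = sqrtC #|Uperp m i : Usub m i|%g%:R
                / #|unitary_scalars_congr (ann i) : unitary_scalars_congr i|%g%:R :> C]].
Proof.
move=> Nphi; have [t Tt ext] := Nphi; have [Lphi _] := ext.
have Pt : t \in P by have /setIP[] := Tt.
have aff := Top_phi_affords w Mn Lphi.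
exists t; split=> //.
- exact: (alpha_enters_top ii inz i2 copies Mn Tt ext aff).
- by move=> t' Tt'; apply: (alpha_enters_unique ii inz i2 spanX copies Trep Mn Tt Tt' ext aff).
- exact: (alpha_stabilizerE ii inz i2 copies Pt).
split=> [a|]; first exact: coset_stab_scalar.
have [rY [ext_rY aff_rY]] := Zt_phi_induced ii inz i2 spanX copies Mn Tt ext.
have sim := affords_rsim aff aff_rY.
exists rY; split=> //; last exact: rank_Zt.
exact: ind_irr (mx_rsim_irr sim (Top_phi_irr Nphi)).
Qed.

End Assembly.

(** In a finite field of odd characteristic more than half of the elements are
    squares, so that the values of two nondegenerate binary terms meet. *)
Lemma two_squares (F : finFieldType) (K : {set F}) a b d : 2%:R != 0 :> F ->
    0 \in K -> {in K &, forall x y, x - y \in K} -> {in K &, forall x y, x * y \in K} ->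
    a \in K -> b \in K -> d \in K -> a != 0 -> b != 0 ->
  exists x y, [/\ x \in K, y \in K & a * x ^+ 2 + b * y ^+ 2 = d].
Proof.
move=> two0 K0 KB KM Ka Kb Kd anz bnz; pose S := [set x ^+ 2 | x in K].
have K2 x : x \in K -> x ^+ 2 \in K by move=> Kx; rewrite expr2 KM.
have S0 : 0 \in S by apply/imsetP; exists 0; rewrite // expr0n.
have cardS : (#|K| < 2 * #|S|)%N.
  rewrite -sum1_card (partition_big_imset (fun x => x ^+ 2)) /= -/S (bigD1 0) //=.
  rewrite (cardsD1 0 S) S0 mulnDr muln1 -addSn; apply: leq_add.
    rewrite ltnS sum1dep_card; have := @subset_leq_card _ [set x in K | x ^+ 2 == 0] [set 0].
    rewrite cards1; apply; apply/subsetP => x.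
    by rewrite in_set => /andP[_]; rewrite sqrf_eq0 in_set1.
  rewrite mulnC -sum_nat_const.
  rewrite [X in (X <= _)%N](eq_bigl (fun y => y \in S :\ 0)) => [|y]; last by rewrite !inE andbC.
  apply: leq_sum => y /setD1P[_ /imsetP[x Kx ->]].
  rewrite sum1dep_card; have := @subset_leq_card _ [set z in K | z ^+ 2 == x ^+ 2] [set x; - x].
  rewrite cards2 => H; apply: leq_trans (H _) _; last by case: eqP.
  apply/subsetP => z.
  by rewrite in_set => /andP[_]; rewrite eqf_sqr in_set2.
pose S1 := [set a * y | y in S]; pose S2 := [set d - b * y | y in S].
have sub1 : S1 \subset K.
  by apply/subsetP => _ /imsetP[_ /imsetP[x Kx ->] ->]; rewrite KM ?K2.
have sub2 : S2 \subset K.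
  by apply/subsetP => _ /imsetP[_ /imsetP[x Kx ->] ->]; rewrite KB // KM ?K2.
have c1 : #|S1| = #|S| by apply/card_imset/mulfI.
have c2 : #|S2| = #|S| by apply: card_imset => x y /subrI/(mulfI bnz).
have /set0Pn[z /setIP[/imsetP[_ /imsetP[x Kx ->] ->] /imsetP[_ /imsetP[y Ky ->] E]]] : S1 :&: S2 != set0.
  apply: contraTneq cardS => I0; rewrite -leqNgt mul2n -addnn -{1}c1 -c2 -cardsUI I0 cards0 addn0.
  by apply: subset_leq_card; rewrite subUset sub1.
by exists x, y; rewrite E subrK.
Qed.

Section Residues.
Variables (O : involutive_dvr) (A : dvr_quotient O).
Local Notation bar := (@star O A).
Local Notation rad := (principal (unif A)).

Lemma fixed_two_squares a b d : bar a = a -> bar b = b -> bar d = d ->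
    a \is a GRing.unit -> b \is a GRing.unit ->
  exists x y, [/\ bar x = x, bar y = y & a * x ^+ 2 + b * y ^+ 2 - d \in rad].
Proof.
move=> Fa Fb Fd Ua Ub; pose K := [set residueA x | x in [pred x | bar x == x]].
have KP x : bar x = x -> residueA x \in K by move=> Fx; apply/imsetP; exists x; rewrite // inE Fx.
have nz x : x \is a GRing.unit -> residueA x != 0 by rewrite residueA_eq0 mem_rad negbK.
have [|||||||||k [l [/imsetP[x Fx ->] /imsetP[y Fy ->] E]]] :=
    @two_squares _ K (residueA a) (residueA b) (residueA d).
- by rewrite -(rmorph_nat (@residueA O A)) nz // two_unit.
- by rewrite -(rmorph0 (@residueA O A)) KP // rmorph0.
- move=> _ _ /imsetP[x Fx ->] /imsetP[y Fy ->]; rewrite -rmorphB KP // rmorphB.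
  by rewrite !inE in Fx Fy; rewrite (eqP Fx) (eqP Fy).
- move=> _ _ /imsetP[x Fx ->] /imsetP[y Fy ->]; rewrite -rmorphM KP // rmorphM.
  by rewrite !inE in Fx Fy; rewrite (eqP Fx) (eqP Fy).
- exact: KP.
- exact: KP.
- exact: KP.
- exact: nz.
- exact: nz.
rewrite !inE in Fx Fy; exists x, y; split; try exact/eqP.
by rewrite -residueA_eq0 !(rmorphB, rmorphD, rmorphM, rmorphXn) /= E subrr.
Qed.

End Residues.

Section Form.
Variables (C : numClosedFieldType) (O : involutive_dvr) (A : framed_ring O) (m : nat).
Variables (h : herm_space A m) (i : {set A}) (w : weil_data C h i).
Hypotheses (ii : is_ideal i) (i2 : {in i &, forall c d : A, c * d = 0}).
Local Notation bar := (@star O A).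
Local Notation sgn := (sgn A).
Local Notation mu := (mu w).
Local Notation N := (subg_of (unitary_scalars A)).

(** The characters of the additive group of A are the translates of mu. *)
Lemma additive_character (theta : {ffun A -> C}) : linear_character theta ->
  exists b, forall x, theta x = mu (x * b).
Proof.
move=> Lt; pose psi (b : A) : {ffun A -> C} := [ffun x => mu (x * b)].
have Lpsi b : linear_character (psi b).
  by split=> [|x y]; rewrite !ffunE ?mul0r ?mu0 // -muD -mulrDl.
have [|s [[us Es] sz]] := @dual_exists C A.
  by move=> x y; apply: addrC.
have inj : injective psi.
  move=> b c E; apply/eqP; rewrite -subr_eq0; have iT : is_ideal [set: A].
    by apply/is_idealP; split=> *; rewrite in_setT.
  have /annP/(_ 1 (in_setT _)) : b - c \in ann [set: A].
    apply: (mu_ann (w := w)) => // x _; rewrite mulrBr muD muN.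
    have := congr1 (fun f : {ffun A -> C} => f x) E; rewrite !ffunE => ->.
    by rewrite mulfV // mu_neq0.
  by rewrite mulr1 => /eqP.
have us1 : uniq [seq psi b | b <- enum A] by rewrite map_inj_uniq ?enum_uniq.
have sub : {subset [seq psi b | b <- enum A] <= s} by move=> _ /mapP[b _ ->]; apply/Es.
have [|_ H] := uniq_min_size us1 sub; first by rewrite size_map sz -cardE.
have /mapP[b _ Eb] : theta \in [seq psi b | b <- enum A] by rewrite H; apply/Es.
by exists b => x; rewrite Eb ffunE.
Qed.

Lemma nval_inj : injective (@nval O A).
Proof. by move=> a b E; apply/subg_inj/val_inj. Qed.

(** A character of N is given on the scalars congruent to 1 modulo i by an
    element that is symmetric up to the sign of the form. *)
Lemma character_form (phi : {ffun N -> C}) : linear_character phi ->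
  exists2 D, D = sgn * bar D &
    forall a : N, sgval a \in unitary_scalars_congr i -> phi a = mu (- (nval a - 1) * D).
Proof.
move=> Lphi; pose K := [set s in i | bar s == - s].
have KP s : reflect (s \in i /\ bar s = - s) (s \in K).
  by rewrite in_set; apply: (iffP andP) => [[? /eqP]|[? ->]].
have Kg : group_set K.
  apply/group_setP; split=> [|s r /KP[Is Ss] /KP[Ir Sr]]; apply/KP.
    by rewrite rmorph0 oppr0 ideal_zero.
  by rewrite rmorphD Ss Sr opprD; split=> //; apply: ideal_add.
pose chi s := if [pick a : N | nval a == 1 + s] is Some a then phi a else 1.
have chiE a : chi (nval a - 1) = phi a.
  rewrite /chi; case: pickP => [b /eqP|/(_ a)]; last by rewrite addrC subrK eqxx.
  by rewrite addrC subrK => /nval_inj ->.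
have K1 s : s \in K -> exists2 a : N, s = nval a - 1 & phi a = chi s.
  move=> /KP[Is Ss]; have [a Ea _] := skew_scalar ii i2 Is Ss.
  by exists a; rewrite ?Ea -?chiE ?Ea [1 + s]addrC addrK.
have [|||s Es sz] := @card_extensions C A _ (Group Kg) chi.
- by move=> x y; apply: addrC.
- by have := chiE 1%g; rewrite -[nval 1%g]/(1 : A) subrr (lin1 Lphi).
- move=> x y Kx Ky; have [[a Ea <-] [b Eb <-]] := (K1 x Kx, K1 y Ky).
  have [/KP[Ix _] /KP[Iy _]] := (Kx, Ky).
  rewrite -(linM Lphi) -chiE nvalM; congr chi.
  have -> : nval a * nval b - 1 = (nval a - 1) + (nval b - 1) + (nval a - 1) * (nval b - 1) by ring.
  by rewrite -Ea -Eb i2 // addr0.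
have : (0 < size s)%N by rewrite sz indexg_gt0.
case: s Es {sz} => // theta s [_ Es] _.
have /Es[Ltheta Etheta] : theta \in theta :: s by apply: mem_head.
have [b Eb] := additive_character Ltheta.
exists (- (2%:R^-1 * (b + sgn * bar b))).
  rewrite rmorphN rmorphM bar_half rmorphD rmorphM bar_sgn barK mulrN; congr (- _).
  by rewrite [RHS]mulrCA; congr (_ * _); rewrite [RHS]mulrDr [X in _ = _ + X]mulrA sgnK mul1r addrC.
move=> a /setIdP[Na ia]; rewrite -/(nval a) in ia.
have Sa : nval a - 1 \in K.
  apply/KP; split=> //; have := nvalN a; set r := nval a - 1.
  have -> : nval a = 1 + r by rewrite addrC subrK.
  rewrite rmorphD rmorph1 mulrDl mul1r mulrDr mulr1 (i2 ia) ?star_ideal // addr0 -addrA => /eqP.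
  by rewrite -subr_eq0 addrAC subrr add0r addr_eq0 => /eqP.
have Sa' : bar (nval a - 1) = - (nval a - 1) by have /KP[] := Sa.
rewrite -chiE -Etheta // Eb; set r := nval a - 1 in Sa' *.
have -> : - r * - (2%:R^-1 * (b + sgn * bar b)) = r * (2%:R^-1 * b) + r * (2%:R^-1 * (sgn * bar b)).
  by ring.
have -> : r * b = r * (2%:R^-1 * b) + r * (2%:R^-1 * b) by rewrite -mulrDr -mulrDr -half_sum.
rewrite !muD; congr (_ * _).
have := mu_sgn_bar w (r * (2%:R^-1 * b)).
rewrite !rmorphM bar_half Sa' => H; apply: (mulIf (mu_neq0 w (- (r * (2%:R^-1 * b))))).
rewrite -{2}H -!muD; congr (mu _); ring.
Qed.

End Form.

Section Lengths.
Variables (O : involutive_dvr) (A : framed_ring O) (m : nat) (h : herm_space A m).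
Local Notation V := 'rV[A]_m.
Local Notation bar := (@star O A).
Local Notation sgn := (sgn A).
Local Notation rad := (principal (unif A)).
Local Notation P := (primitive_vectors A m).
Implicit Types (u v t : V).

Lemma nonunitB (a b : A) : a \isn't a GRing.unit -> b \isn't a GRing.unit ->
  a - b \isn't a GRing.unit.
Proof. by move=> Ha Hb; apply: nonunitD => //; rewrite unitrN. Qed.

Lemma nonunitM (a b : A) : b \isn't a GRing.unit -> a * b \isn't a GRing.unit.
Proof. by rewrite -!mem_rad => Hb; rewrite ideal_mull ?rad_ideal. Qed.

(** Modulo the radical, vectors spanned by a frame of k vectors fill at most a
    k-dimensional space. *)
Lemma frame_bound k (M : 'M[A]_(k, m)) (c : V -> 'rV[A]_k) :
  (forall u, u - c u *m M \in idealV m rad) -> (m <= k)%N.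
Proof.
move=> H; pose Cm : 'M[A]_(m, k) := \matrix_i c (delta_mx 0 i).
have E : 1%:M = map_mx (@residueA O A) Cm *m map_mx (@residueA O A) M.
  rewrite -map_mxM; apply/matrixP => l j; rewrite [RHS]mxE.
  have -> : (Cm *m M) l j = (c (delta_mx 0 l) *m M) 0 j.
    by rewrite !mxE; apply: eq_bigr => r _; rewrite mxE.
  have /(idealVP _ (rad_ideal A))/(_ j) := H (delta_mx 0 l).
  rewrite mxE [X in _ + X]mxE -residueA_eq0 rmorphB subr_eq0 => /eqP <-.
  by rewrite !mxE /= eq_sym rmorph_nat.
rewrite -(mxrank1 (residue_field O) m) E; apply: leq_trans (mxrankM_maxl _ _) _.
exact: rank_leq_col.
Qed.

(** Polarization: a pair of vectors with invertible product spans a vector of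
    invertible length, as soon as some length is invertible at all. *)
Lemma polar_unit e u v : e \is a GRing.unit -> e = sgn * bar e -> h u v \is a GRing.unit ->
  exists a b, h (a *: u + b *: v) (a *: u + b *: v) \is a GRing.unit.
Proof.
move=> Ue Se Uuv; have [Uu|nUu] := boolP (h u u \is a GRing.unit).
  by exists 1, 0; rewrite scale1r scale0r addr0.
have [Uv|nUv] := boolP (h v v \is a GRing.unit).
  by exists 0, 1; rewrite scale1r scale0r add0r.
exists 1, ((h u v)^-1 * e); rewrite scale1r; set b := _ * e.
have uv : h u (b *: v) = e by rewrite hZr /b mulrAC mulVr // mul1r.
have vu : h (b *: v) u = e by rewrite hC uv -Se.
rewrite hDl !hDr uv vu hZl hZr.
have -> : h u u + e + (e + bar b * (b * h v v)) = e * 2%:R + (h u u + bar b * b * h v v) by ring.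
rewrite unitD_rad ?unitrM ?Ue ?two_unit // mem_rad.
by apply: nonunitD => //; apply: nonunitM.
Qed.

(** A frame of orthogonal vectors of invertible length, shorter than the rank,
    can be continued. *)
Lemma extend_orthogonal e k (M : 'M[A]_(k, m)) : e \is a GRing.unit -> e = sgn * bar e ->
    (k < m)%N -> (forall l, h (row l M) (row l M) \is a GRing.unit) ->
    (forall l l', l != l' -> h (row l M) (row l' M) = 0) ->
  exists2 x, h x x \is a GRing.unit & forall l, h (row l M) x = 0.
Proof.
move=> Ue Se km UM orth; pose c u : 'rV[A]_k := \row_l (h (row l M) u / h (row l M) (row l M)).
pose p u := u - c u *m M.
have rowp l u : h (row l M) (p u) = 0.
  rewrite hBr mulmx_sum_row hsumr (bigD1 l) //= big1 ?addr0 => [|l' ll']; last first.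
    by rewrite hZr orth ?mulr0 // eq_sym.
  by rewrite hZr mxE divrK ?subrr // UM.
have prow u l : h (p u) (row l M) = 0 by rewrite hC rowp rmorph0 mulr0.
have hp u v : h (p u) (p v) = h (p u) v.
  by rewrite hBr mulmx_sum_row hsumr big1 ?subr0 // => l _; rewrite hZr prow mulr0.
have plin a b u v : p (a *: u + b *: v) = a *: p u + b *: p v.
  have -> : p (a *: u + b *: v) = a *: u + b *: v - (a *: c u + b *: c v) *m M.
    rewrite /p; congr (_ - _ *m _); apply/rowP => l; rewrite !mxE hDr !hZr; ring.
  by rewrite /p mulmxDl -!scalemxAl !scalerBr opprD addrACA.
have [/existsP[u Pu]|/existsPn none] := boolP [exists u, p u \in P].
  have [x xu] := primitive_dual h Pu.
  have ux : h (p u) (p x) \is a GRing.unit.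
    rewrite hp hC xu rmorph1 mulr1; apply/unitrP; exists sgn; rewrite sgnK //.
  have [a [b Uab]] := polar_unit Ue Se ux.
  exists (p (a *: u + b *: x)); first by rewrite plin.
  by move=> l; apply: rowp.
have := @frame_bound k M c; rewrite leqNgt km /= => H; exfalso.
by apply/notF/H => u; have := none u; rewrite primitive_rad negbK.
Qed.

Lemma hDZ (x y : A) u v : h (x *: u + y *: v) (x *: u + y *: v)
  = bar x * x * h u u + bar y * y * h v v + (bar x * y * h u v + bar y * x * h v u).
Proof. by rewrite hDl !hDr !hZl !hZr; ring. Qed.

Lemma sym_ratio e d : e \is a GRing.unit -> e = sgn * bar e -> d = sgn * bar d ->
  bar (d / e) = d / e.
Proof.
move=> Ue Se Sd; have Ube : bar e \is a GRing.unit by rewrite star_unit.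
rewrite rmorphM rmorphV //; apply: (mulIr Ue); rewrite divrK //.
apply: (mulIr Ube); rewrite mulrAC divrK // [in LHS]Se [in RHS]Sd.
by rewrite mulrCA mulrA.
Qed.

(** Every symmetric element is a length modulo the radical, except for the
    nonunits when the form is hermitian of rank 2 and anisotropic. *)
Lemma lengths d : (1 < m)%N -> d = sgn * bar d ->
  (exists2 t, t \in P & d - h t t \in rad)
  \/ [/\ hermitian_case (kind A), m = 2, d \in rad & forall t, t \in P -> h t t \is a GRing.unit].
Proof.
move=> m1 Sd; have [/existsP[e /andP[Ue /eqP Se]]|/existsPn none] :=
    boolP [exists e, (e \is a GRing.unit) && (e == sgn * bar e)]; last first.
  have nU x : x = sgn * bar x -> x \in rad.
    by move=> Sx; rewrite mem_rad; have := none x; rewrite {2}Sx eqxx andbT.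
  left; exists (delta_mx 0 (Ordinal (ltnW m1))).
    by apply/primitiveP; exists (Ordinal (ltnW m1)); rewrite mxE !eqxx unitr1.
  by rewrite ideal_sub ?rad_ideal // nU // -hC.
have [|||w1 U1 _] := @extend_orthogonal e 0 0 Ue Se.
- exact: ltnW.
- by case.
- by case.
have [||w2 U2 O2] := @extend_orthogonal e 1 w1 Ue Se m1.
- by move=> l; rewrite (ord1 l) row_id.
- by move=> l l'; rewrite !ord1 eqxx.
have {O2} O12 : h w1 w2 = 0 by have := O2 0; rewrite row_id.
have O21 : h w2 w1 = 0 by rewrite hC O12 rmorph0 mulr0.
have Sl t : h t t = sgn * bar (h t t) by rewrite -hC.
pose a := h w1 w1 / e; pose b := h w2 w2 / e.
have Fa : bar a = a by apply: sym_ratio.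
have Fb : bar b = b by apply: sym_ratio.
have Fd : bar (d / e) = d / e by apply: sym_ratio.
have Ua : a \is a GRing.unit by rewrite unitrM unitrV U1.
have Ub : b \is a GRing.unit by rewrite unitrM unitrV U2.
have ha : h w1 w1 = a * e by rewrite divrK.
have hb : h w2 w2 = b * e by rewrite divrK.
have [Ud|nUd] := boolP (d \is a GRing.unit).
  have [x [y [Fx Fy Exy]]] := fixed_two_squares Fa Fb Fd Ua Ub.
  pose t := x *: w1 + y *: w2.
  have Et : d - h t t \in rad.
    have -> : d - h t t = - e * (a * x ^+ 2 + b * y ^+ 2 - d / e).
      by rewrite /t hDZ Fx Fy ha hb O12 O21 !mulr0 !addr0 -{1}[d](divrK Ue); ring.
    by rewrite ideal_mull ?rad_ideal.
  left; exists t => //; apply: (unit_primitive (w := t) (h := h)).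
  by rewrite -(@unit_rad _ A d).
have [/existsP[t /andP[Pt nUt]]|/existsPn anis] := boolP [exists t in P, h t t \isn't a GRing.unit].
  by left; exists t => //; rewrite mem_rad nonunitB.
right; have nut t : t \in P -> h t t \is a GRing.unit.
  by move=> Pt; have := anis t; rewrite Pt /= negbK.
suff [hA m2] : hermitian_case (kind A) /\ m = 2 by split=> //; rewrite mem_rad.
have contra_t t : t \in P -> h t t \isn't a GRing.unit -> False by move=> /nut ->.
have [hA|nhA] := boolP (hermitian_case (kind A)).
  split=> //; apply/eqP; rewrite eqn_leq m1 andbT leqNgt; apply/negP => m3.
  pose M : 'M[A]_(2, m) := \matrix_(l < 2) (if l == 0 then w1 else w2).
  have rM l : row l M = if l == 0 then w1 else w2 by rewrite rowK.
  have [||w3 U3 O3] := @extend_orthogonal e 2 M Ue Se m3.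
  - by move=> l; rewrite rM; case: ifP.
  - move=> l l'; rewrite !rM; case: (eqVneq l 0) => [->|l0]; case: (eqVneq l' 0) => [El'|l0'].
    + by [].
    + by [].
    + by [].
    by case/eqP; apply: val_inj; move: l l' l0 l0' => [[|[|l]] Hl] [[|[|l']] Hl'].
  have O13 : h w1 w3 = 0 by have := O3 0; rewrite rM eqxx.
  have O23 : h w2 w3 = 0 by have := O3 1; rewrite rM.
  have Fc : bar (- (h w3 w3 / e)) = - (h w3 w3 / e) by rewrite rmorphN sym_ratio.
  have [x [y [Fx Fy Exy]]] := fixed_two_squares Fa Fb Fc Ua Ub.
  have [u Eu] : exists u, u = x *: w1 + y *: w2 by eexists.
  have Ou : h u w3 = 0.
    by rewrite Eu hDl !hZl O13 O23 !mulr0 addr0.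
  have Ou' : h w3 u = 0 by rewrite hC Ou rmorph0 mulr0.
  apply: (@contra_t (u + w3)).
    by apply: (unit_primitive (w := w3) (h := h)); rewrite hDr Ou' add0r.
  rewrite -mem_rad hDl !hDr Ou Ou' addr0 add0r Eu hDZ Fx Fy O12 O21 !mulr0 !addr0 ha hb.
  have -> : x * x * (a * e) + y * y * (b * e) + h w3 w3
      = e * (a * x ^+ 2 + b * y ^+ 2 - - (h w3 w3 / e)).
    by rewrite -{1}[h w3 w3](divrK Ue); ring.
  by rewrite ideal_mull ?rad_ideal.
have sgnN : sgn = - 1 by rewrite /sgn (negPf nhA).
have Be : bar e = - e by rewrite [in RHS]Se sgnN mulN1r opprK.
have [|||||x [y [Fx Fy Exy]]] := @fixed_two_squares _ A a (- a * e ^+ 2) (- b).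
- by [].
- by rewrite rmorphM rmorphN rmorphXn Fa Be sqrrN.
- by rewrite rmorphN Fb.
- by [].
- by rewrite unitrM unitrN Ua unitrX.
have Bz : bar (x + e * y) = x - e * y by rewrite rmorphD rmorphM Fx Fy Be mulNr.
exfalso; apply: (@contra_t ((x + e * y) *: w1 + 1 *: w2)).
  apply: (unit_primitive (w := w2) (h := h)).
  by rewrite hDr !hZr O21 mulr0 add0r mul1r.
rewrite -mem_rad hDZ Bz rmorph1 O12 O21 !mulr0 !addr0 ha hb.
have -> : (x - e * y) * (x + e * y) * (a * e) + 1 * 1 * (b * e)
    = e * (a * x ^+ 2 + - a * e ^+ 2 * y ^+ 2 - - b) by ring.
by rewrite ideal_mull ?rad_ideal.
Qed.

End Lengths.

Section Characters.
Variables (C : numClosedFieldType) (O : involutive_dvr) (A : framed_ring O) (m : nat).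
Variables (h : herm_space A m) (i : {set A}) (w : weil_data C h i) (T : {set 'rV[A]_m}).
Hypotheses (ii : is_ideal i) (inz : i != [set 0]) (i2 : {in i &, forall c d : A, c * d = 0}).
Hypothesis Trep : orbit_representatives h (ann i) T.
Local Notation bar := (@star O A).
Local Notation sgn := (sgn A).
Local Notation mu := (mu w).
Local Notation N := (subg_of (unitary_scalars A)).
Local Notation rad := (principal (unif A)).
Local Notation P := (primitive_vectors A m).
Implicit Types (t v : 'rV[A]_m) (phi : {ffun N -> C}).

Lemma alpha_form t (a : N) : sgval a \in unitary_scalars_congr i ->
  alpha w t (scalar_of m a) = mu (- (nval a - 1) * h t t).
Proof.
move=> /setIdP[_ ia]; rewrite alpha_mu mu_alpha_scalar -/(nval a) in ia *.
have -> : (nval a)^-1 = 1 - (nval a - 1).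
  have Ua : nval a \is a GRing.unit := valP (sgval a).
  apply: (mulrI Ua); rewrite divrr //; apply/eqP; rewrite eq_sym -subr_eq0; apply/eqP.
  by rewrite -[RHS]oppr0 -(i2 ia ia); ring.
by rewrite mulrBl mul1r muD mu_form mul1r mulNr.
Qed.

(** phi extends alpha_t when t has the prescribed length modulo the annihilator
    of i. *)
Lemma extends_alphaP phi D t : linear_character phi -> D = sgn * bar D ->
    (forall a : N, sgval a \in unitary_scalars_congr i -> phi a = mu (- (nval a - 1) * D)) ->
  extends_alpha w t phi <-> D - h t t \in ann i.
Proof.
move=> Lphi SD HD; split=> [[_ ext]|/annP jD]; last first.
  split=> // a ia; rewrite HD // alpha_form //; have /setIdP[_ ia'] := ia.
  rewrite -/(nval a) in ia'; congr (mu _); apply/eqP.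
  by rewrite !mulNr eqr_opp -subr_eq0 -mulrBr mulrC jD.
apply: (mu_sym_skew (w := w)) => // [|s Is Ss].
  by rewrite rmorphB mulrBr -SD -hC.
have [a Ea ia] := skew_scalar ii i2 Is Ss.
have Es : nval a - 1 = s by rewrite Ea [1 + s]addrC addrK.
have := ext a ia; rewrite HD // alpha_form // Es => H.
by rewrite mulrBr muD -mulNr -H -muD mulNr subrr mu0.
Qed.

Lemma ann_rad : ann i \subset rad. Proof. exact: ann_proper. Qed.

Lemma N_tildeP phi D : linear_character phi -> D = sgn * bar D ->
    (forall a : N, sgval a \in unitary_scalars_congr i -> phi a = mu (- (nval a - 1) * D)) ->
  N_tilde w T phi <-> exists2 t, t \in P & D - h t t \in rad.
Proof.
move=> Lphi SD HD; split=> [[t /setIP[_ Pt] ext]|[t Pt tD]].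
  exists t => //; apply: (subsetP ann_rad); exact/(extends_alphaP t Lphi SD HD).
have [v vt vD] := length_lift (rad_ideal A) (subxx _) Pt SD tD.
have Pv : v \in P by rewrite (primitive_congr (rad_ideal A) (subxx _) vt).
have [u Tu /orbit_ofP[g Ug gu]] := rep_exists ii Trep inz Pv.
exists u => //; apply/(extends_alphaP u Lphi SD HD).
rewrite -vD -(unitary_h u u Ug).
have -> : h v v - h (g u) (g u) = - (h (g u - v) (g u) + h v (g u - v)).
  by rewrite hBl hBr; ring.
rewrite ideal_opp ?ann_ideal // ideal_add ?ann_ideal //.
  exact: h_idealVl (ann_ideal i) gu.
exact: h_idealVr (ann_ideal i) gu.
Qed.

End Characters.

(** An additive map has fibers of constant size. *)
Lemma card_fibers (B : finZmodType) (S K : {set B}) (rT : finType) (f : B -> rT) :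
    K \subset S -> {in S & K, forall x k, x + k \in S} ->
    {in S &, forall x y, (f x == f y) = (y - x \in K)} ->
  #|S| = (#|f @: S| * #|K|)%N.
Proof.
move=> KS SK fE; rewrite -sum1_card (partition_big_imset f) /= -sum_nat_const.
apply: eq_bigr => _ /imsetP[x Sx ->]; rewrite sum1dep_card -[RHS](card_imset _ (addrI x)).
apply: eq_card => y; rewrite in_set; apply/andP/imsetP => [[Sy]|[k Kk ->]].
  by rewrite eq_sym fE // => Kyx; exists (y - x); rewrite // addrC subrK.
by rewrite SK // eq_sym fE ?SK // addrAC subrr add0r.
Qed.

Lemma card_same_fibers (T T1 T2 : finType) (f : T -> T1) (g : T -> T2) :
  (forall x y, f x = f y <-> g x = g y) -> #|[set f x | x : T]| = #|[set g x | x : T]|.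
Proof.
have le (T1' T2' : finType) (f' : T -> T1') (g' : T -> T2') :
    (forall x y, f' x = f' y -> g' x = g' y) -> (#|[set g' x | x : T]| <= #|[set f' x | x : T]|)%N.
  move=> H; pose k y := [pick x | f' x == y].
  have -> : #|[set g' x | x : T]| = #|[set omap g' (k y) | y in [set f' x | x : T]]|.
    rewrite -(card_imset _ (@Some_inj _)) -!imset_comp; apply: eq_card => z.
    suff E : Some \o g' =1 (fun y => omap g' (k y)) \o f' by rewrite (eq_imset _ E).
    move=> x /=; rewrite /k; case: pickP => [y /eqP/H <- //|/(_ x)]; by rewrite eqxx.
  exact: leq_imset_card.
by move=> H; apply/eqP; rewrite eqn_leq !le // => x y /H.
Qed.

Section Counting.
Variables (O : involutive_dvr) (A : dvr_quotient O).
Local Notation F := (residue_field O).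
Local Notation rad := (principal (unif A)).

Lemma ideal_fibers (S K : {set A}) (rT : finType) (f : A -> rT) : is_ideal S -> is_ideal K ->
    K \subset S -> {in S &, forall x y, (f x == f y) = (y - x \in K)} ->
  #|S| = (#|f @: S| * #|K|)%N.
Proof.
move=> iS iK KS; apply: card_fibers => // x k Sx Kk.
by rewrite ideal_add // (subsetP KS).
Qed.

Lemma idealT : is_ideal [set: A].
Proof. by apply/is_idealP; split=> *; rewrite in_setT. Qed.

Lemma card_ring_rad : #|A| = (#|F| * #|rad|)%N.
Proof.
rewrite -cardsT (@ideal_fibers setT rad _ (@residueA O A)) ?subsetT ?principal_ideal ?idealT //.
  congr (_ * _)%N; rewrite -cardsT; apply: eq_card => x; rewrite in_setT; apply/imsetP.
  by have [a <-] := residueA_surj A x; exists a; rewrite ?in_setT.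
by move=> x y _ _; rewrite eq_sym -subr_eq0 -rmorphB residueA_eq0.
Qed.

Lemma mul_unif_ann k x : (k <= len A)%N ->
  (x * unif A ^+ k == 0) = (x \in principal (unif A ^+ (len A - k))).
Proof.
move=> kl; rewrite -(ann_power kl); apply/eqP/annP => [x0 _ /principalP[b ->]|].
  by rewrite mulrCA x0 mulr0.
by apply; apply/principalP; exists 1; rewrite mul1r.
Qed.

Lemma card_socle : #|principal (unif A ^+ (len A).-1)| = #|F|.
Proof.
have l0 : (0 < len A)%N := ltnW (len_gt1 A).
have rad0 : (0 < #|rad|)%N by apply/card_gt0P; exists 0; rewrite ideal_zero ?principal_ideal.
apply/eqP; rewrite -(eqn_pmul2r rad0) -card_ring_rad -cardsT.
rewrite (@ideal_fibers setT rad _ ( *%R^~ (unif A ^+ (len A).-1))) ?subsetT ?principal_ideal ?idealT //.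
  apply/eqP; congr (_ * _)%N; apply: eq_card => x; apply/principalP/imsetP => [[b ->]|[b _ ->]].
    by exists b; rewrite ?in_setT.
  by exists b.
move=> x y _ _; rewrite eq_sym -subr_eq0 -mulrBl mul_unif_ann ?leq_pred //.
by rewrite -[X in (X - _)%N](prednK l0) subSnn expr1.
Qed.

Lemma card_ring : #|A| = (#|F| ^ len A)%N.
Proof.
suff H k : (k <= len A)%N -> (#|F| ^ k * #|principal (unif A ^+ k)| = #|A|)%N.
  rewrite -(H _ (leqnn _)) unif_len (_ : #|_| = 1%N) ?muln1 //; apply/eqP/cards1P; exists 0.
  by apply/setP => x; rewrite in_set1; apply/principalP/eqP => [[b ->]|->]; [rewrite mulr0 | exists 0; rewrite mul0r].
elim: k => [_|k IHk lk].
  rewrite expn0 mul1n -[RHS]cardsT; apply: eq_card => x; rewrite in_setT; apply/principalP.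
  by exists x; rewrite expr0 mulr1.
have l0 : (0 < len A)%N := ltnW (len_gt1 A).
have step : #|principal (unif A ^+ k)| = (#|principal (unif A ^+ k.+1)| * #|F|)%N.
  rewrite (@ideal_fibers _ (principal (unif A ^+ (len A).-1)) _ ( *%R^~ (unif A))) ?principal_ideal //.
  - rewrite card_socle; congr (_ * _)%N; apply: eq_card => x.
    apply/imsetP/principalP => [[_ /principalP[b ->] ->]|[b ->]].
      by exists b; rewrite exprSr mulrA.
    by exists (b * unif A ^+ k); rewrite ?exprSr ?mulrA //; apply/principalP; exists b.
  - by apply: principal_powerS; rewrite -ltnS prednK.
  move=> x y _ _; rewrite eq_sym -subr_eq0 -mulrBl.
  by have := mul_unif_ann (y - x) l0; rewrite expr1 subn1.
by rewrite -(IHk (ltnW lk)) step expnS -mulnA mulnCA [(#|F| * _)%N]mulnC.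
Qed.

End Counting.

Section Ramified.
Variables (O : involutive_dvr) (A : framed_ring O).
Local Notation bar := (@star O A).
Local Notation F := (residue_field O).
Local Notation rad := (principal (unif A)).
Local Notation R := (fixed_ring (@star O A)).
Local Notation pi := (piA A).
Hypothesis ram : is_ramified A.

Lemma fixed_fval x : bar x = x -> exists r : R, x = fval r.
Proof.
move=> /eqP Fx; have Fx' : x \in fixed_by (@star O A) by rewrite unfold_in.
by exists (FixedRing Fx').
Qed.

Lemma mem_pR (r : R) : (r \in principal (pR A)) = (fval r \in rad).
Proof.
have /maxsetP[/andP[Ip p1] max] := p_max A.
pose J := [set r : R | fval r \in rad].
have JP s : (s \in J) = (fval s \in rad) by rewrite in_set.
have IJ : is_ideal J.
  apply/and3P; split; first by rewrite JP ideal_zero ?rad_ideal.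
    apply/forall_inP => x Jx; apply/forall_inP => y Jy; rewrite JP in Jx; rewrite JP in Jy.
    by rewrite JP ideal_add ?rad_ideal.
  apply/forallP => b; apply/forall_inP => x Jx; rewrite JP in Jx.
  by rewrite JP ideal_mull ?rad_ideal.
have J1 : 1 \notin J by rewrite JP mem_rad negbK unitr1.
rewrite -(max J) ?IJ ?J1 ?JP //; apply/subsetP => x px; rewrite JP mem_rad.
apply: contra p1 => Ux; have [y Ey] : exists y : R, (fval x)^-1 = fval y.
  by apply: fixed_fval; rewrite rmorphV // fixed_ringP.
have -> : 1 = y * x by apply: val_inj; rewrite /= -Ey mulVr.
by case/and3P: Ip => _ _ /forallP/(_ y)/forall_inP; apply.
Qed.

Lemma piA_rad : pi \in rad.
Proof. by rewrite -(maximal_idealE (pi_max A)); apply/principalP; exists 1; rewrite mul1r. Qed.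

Lemma bar_piA : bar pi = - pi. Proof. by case: ram. Qed.

Lemma quotient_card_residue : quotient_card (principal (pR A)) = #|F|.
Proof.
rewrite /quotient_card (@card_same_fibers _ _ _ _ (fun b : R => residueA (fval b))).
  rewrite -cardsT; apply: eq_card => x; rewrite in_setT; apply/imsetP.
  have [a <-] := residueA_surj A x; have [r [r' ->]] := ramified_decomp ram a.
  exists r; rewrite // rmorphD rmorphM /=.
  have /eqP -> : residueA pi == 0 by rewrite residueA_eq0 piA_rad.
  by rewrite mulr0 addr0.
have Ip : is_ideal (principal (pR A)) by case/maxsetP: (p_max A) => /andP[].
have Ip0 : 0 \in principal (pR A) by case/and3P: Ip.
have E b b' : residueA (fval b) = residueA (fval b') <-> b - b' \in principal (pR A).
  by rewrite mem_pR -residueA_eq0 /= rmorphB subr_eq0; split=> /eqP.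
move=> b b'; rewrite E; split=> [H|bb'].
  have : b \in [set b + x | x in principal (pR A)] by apply/imsetP; exists 0; rewrite ?addr0.
  by rewrite H => /imsetP[x px ->]; rewrite addrC addKr.
have cs (x y : R) : x - y \in principal (pR A) ->
    [set x + z | z in principal (pR A)] \subset [set y + z | z in principal (pR A)].
  move=> xy; apply/subsetP => _ /imsetP[z pz ->]; apply/imsetP; exists (x - y + z).
    case/and3P: Ip => _ /forall_inP/(_ _ xy)/forall_inP/(_ _ pz) //.
  by rewrite addrA [y + _]addrC subrK.
apply/eqP; rewrite eqEsubset !cs //.
case/and3P: Ip => _ _ /forallP/(_ (-1))/forall_inP/(_ _ bb').
by rewrite mulN1r opprB.
Qed.

Definition skew_set : {set A} := [set x | bar x == - x].

Lemma skewP x : reflect (bar x = - x) (x \in skew_set).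
Proof. by rewrite in_set; apply: eqP. Qed.

Lemma skew_decomp x : bar x = - x -> exists r : R, x = fval r * pi.
Proof.
move=> Sx; have [r [r' Ex]] := ramified_decomp ram x; exists r'.
have : x + x = 2%:R * (fval r' * pi).
  rewrite -{2}[x]opprK -Sx Ex rmorphD rmorphM !fixed_ringP bar_piA; ring.
by move=> E; apply: (mulrI (two_unit A)); rewrite mulr_natl mulr2n.
Qed.

Lemma skew_rad x : bar x = - x -> x \in rad.
Proof. by case/skew_decomp => r ->; rewrite ideal_mull ?rad_ideal // piA_rad. Qed.

Variables (l : nat) (n : {set A}).
Hypotheses (lenA : len A = (2 * l)%N) (Mn : minimal_ideal n).

Lemma minimal_skew x : x \in n -> bar x = - x.
Proof.
have l0 : (0 < l)%N by have := len_gt1 A; rewrite lenA; case: (l).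
have Jnz : principal (pi ^+ (len A).-1) != [set 0].
  apply/eqP => E; have : pi ^+ (len A).-1 \in principal (pi ^+ (len A).-1).
    by apply/principalP; exists 1; rewrite mul1r.
  by rewrite E in_set1 unif_piA lenA; move: l0; case: (l) => // k _; rewrite mul2n doubleS ltnn.
move=> /(subsetP (minimal_sub Mn (principal_ideal _) Jnz))/principalP[c ->].
have [r [r' ->]] := ramified_decomp ram c.
have -> : (fval r + fval r' * pi) * pi ^+ (len A).-1 = fval r * pi ^+ (len A).-1.
  rewrite mulrDl -mulrA -exprS prednK ?(ltnW (len_gt1 A)) //.
  by have := unif_piA A (len A); rewrite leqnn => /eqP ->; rewrite mulr0 addr0.
rewrite rmorphM rmorphXn fixed_ringP bar_piA lenA exprNn -signr_odd.
have -> : odd (2 * l).-1 by move: l0; case: (l) => // k _; rewrite mul2n doubleS /= odd_double.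
by rewrite expr1 mulN1r mulrN.
Qed.

Lemma card_fixed_skew : #|A| = (#|[set x : A | bar x == x]| * #|skew_set|)%N.
Proof.
rewrite -cardsT (@card_fibers _ setT skew_set _ (fun x => x + bar x)) ?subsetT //.
- congr (_ * _)%N; apply: eq_card => x; rewrite in_set; apply/imsetP/eqP => [[y _ ->]|Fx].
    by rewrite rmorphD barK addrC.
  by exists (2%:R^-1 * x); rewrite ?in_setT // rmorphM bar_half Fx -mulrDr -half_sum.
- by move=> x k _ _; rewrite in_setT.
move=> x y _ _; rewrite -subr_eq0 in_set rmorphB -[RHS]subr_eq0 opprK -oppr_eq0.
by congr (_ == 0); ring.
Qed.

Lemma card_fixed : #|[set x : A | bar x == x]| = #|skew_set|.
Proof.
have l0 : (0 < l)%N by have := len_gt1 A; rewrite lenA; case: (l).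
rewrite -(@card_in_imset _ _ (fun x => x * pi)) => [|x y].
  apply: eq_card => x; apply/imsetP/skewP => [[y]|/skew_decomp[r ->]].
    by rewrite in_set => /eqP Fy ->; rewrite rmorphM Fy bar_piA mulrN.
  by exists (fval r); rewrite // in_set fixed_ringP.
rewrite !in_set => /eqP Fx /eqP Fy /eqP; rewrite -subr_eq0 -mulrBl => /eqP z0.
have nz : x - y \in n.
  have : x - y \in ann rad.
    apply/annP => b; rewrite -(maximal_idealE (pi_max A)) => /principalP[c ->].
    by rewrite mulrCA z0 mulr0.
  by rewrite -(ann_minimal Mn) annK //; case: (minimal_ideal_ideal Mn).
have := minimal_skew nz; rewrite rmorphB Fx Fy => E.
apply/eqP; rewrite -subr_eq0; apply/eqP; apply: (mulrI (two_unit A)).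
by rewrite mulr0 mulr_natl mulr2n -{2}[x - y]opprK -E subrr.
Qed.

Lemma card_skew : #|skew_set| = (#|F| ^ l)%N.
Proof.
have := card_fixed_skew; rewrite card_fixed card_ring lenA mulnC expnM => /eqP.
by rewrite mulnn eqn_exp2r // => /eqP.
Qed.

Lemma near_one x : x * bar x = 1 -> (x - 1 \in rad) = (- x - 1 \notin rad).
Proof.
move=> Nx; have xx : bar x - x \in rad.
  have [r [r' ->]] := ramified_decomp ram x; rewrite rmorphD rmorphM !fixed_ringP bar_piA.
  have -> : fval r + fval r' * - pi - (fval r + fval r' * pi) = - (2%:R * fval r') * pi by ring.
  by rewrite ideal_mull ?rad_ideal // piA_rad.
have prod : (x - 1) * (- x - 1) \in rad.
  have -> : (x - 1) * (- x - 1) = x * (bar x - x) by rewrite [RHS]mulrBr Nx; ring.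
  by rewrite ideal_mull ?rad_ideal.
have sum : - 2%:R \notin rad by rewrite mem_rad negbK unitrN two_unit.
apply/idP/idP => [x1|]; first by apply: contra sum => x2; have -> : - 2%:R = (x - 1) + (- x - 1) :> A by [ring]; rewrite ideal_add ?rad_ideal.
rewrite !mem_rad negbK => U; move: prod; rewrite mem_rad unitrM negb_and U orbF.
by [].
Qed.

Lemma card_norm_one : #|unitary_scalars A| = (2 * #|F| ^ l)%N.
Proof.
pose D := [set x : A | (x * bar x == 1) && (x - 1 \in rad)].
have DP x : reflect (x * bar x = 1 /\ x - 1 \in rad) (x \in D).
  by rewrite in_set; apply: (iffP andP) => [[/eqP]|[->]].
have cardD : #|D| = #|skew_set|.
  have U1 x : x - 1 \in rad -> x + 1 \is a GRing.unit.
    move=> x1; have -> : x + 1 = 2%:R + (x - 1) by ring.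
    by rewrite unitD_rad ?two_unit.
  rewrite -(@card_in_imset _ _ (fun x => (x - 1) / (x + 1))) => [|x y /DP[_ x1] /DP[_ y1] E].
    apply: eq_card => s; apply/imsetP/skewP => [[x /DP[Nx x1] ->]|Ss].
      have Ux : x \is a GRing.unit by apply/unitrP; exists (bar x); rewrite mulrC.
      have Ub : bar (x + 1) \is a GRing.unit by rewrite star_unit U1.
      apply: (mulIr (U1 _ x1)); rewrite mulNr divrK ?U1 // rmorphM rmorphV ?U1 //.
      apply: (mulIr Ub); rewrite mulrAC divrK // !rmorphD rmorphN rmorph1.
      apply: (mulIr Ux).
      have -> : (bar x - 1) * (x + 1) * x = (x * bar x * (x + 1) - x * (x + 1)) by ring.
      have -> : - (x - 1) * (bar x + 1) * x = - (x - 1) * (x * bar x + x) by ring.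
      by rewrite Nx; ring.
    have sr := skew_rad Ss; have [u Nu Eu] := cayley_scalar sr Ss.
    have Us : 1 - s \is a GRing.unit by rewrite unitD_rad ?unitr1 // ideal_opp ?rad_ideal.
    have E1 : val u - 1 = 2%:R * s / (1 - s).
      by apply: (mulIr Us); rewrite divrK // mulrBl Eu divrK //; ring.
    have E2 : (val u + 1) * (1 - s) = 2%:R by rewrite mulrDl Eu divrK //; ring.
    have u1 : val u - 1 \in rad by rewrite E1 mulrAC ideal_mull ?rad_ideal.
    exists (val u).
      by apply/DP; split=> //; move: Nu; rewrite in_set => /eqP.
    have U2 := U1 _ u1; apply: (mulIr U2); rewrite divrK // E1.
    by apply: (mulIr Us); rewrite divrK // -mulrA E2 mulrC.
  apply: (mulrI (two_unit A)).
  have H : (x - 1) * (y + 1) = (y - 1) * (x + 1).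
    have := congr1 ( *%R^~ ((x + 1) * (y + 1))) E.
    by rewrite mulrA divrK ?U1 // mulrA [_ / _ * (x + 1)]mulrAC divrK ?U1.
  have -> : 2%:R * x = (x - 1) * (y + 1) - (y - 1) * (x + 1) + 2%:R * y by ring.
  by rewrite H subrr add0r.
have cardNA : #|unitary_scalars A| = #|[set x : A | x * bar x == 1]|.
  rewrite -(card_imset _ val_inj); apply: eq_card => x; rewrite in_set.
  apply/imsetP/eqP => [[u Nu ->]|Nx]; first by move: Nu; rewrite in_set => /eqP.
  by have [u Nu <-] := norm_one_unit Nx; exists u.
rewrite cardNA -(cardsID [set x : A | x - 1 \in rad]) mul2n -addnn -card_skew -cardD.
congr (_ + _)%N.
  by apply: eq_card => x; rewrite in_setI !in_set.
rewrite -[RHS](card_imset _ oppr_inj); apply: eq_card => x.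
rewrite in_setD; apply/andP/imsetP => [[]|[y /DP[Ny y1] ->]].
  rewrite !in_set => nx /eqP Nx; exists (- x); last by rewrite opprK.
  apply/DP; rewrite rmorphN mulrNN; split=> //.
  have := near_one Nx; rewrite (negPf nx) => /esym/negbFE //.
have := near_one Ny; rewrite y1 => /esym ny1.
by rewrite !in_set ny1 rmorphN mulrNN Ny.
Qed.

Lemma card_minimal_scalars : #|unitary_scalars_congr n| = #|F|.
Proof.
rewrite -(card_socle A) -(minimal_idealE Mn); have [In _] := minimal_ideal_ideal Mn.
rewrite -(@card_imset _ _ (fun u : {unit A} => val u - 1)); last by move=> u v /addIr/val_inj.
apply: eq_card => s; apply/imsetP/idP => [[u /setIdP[_ nu] ->] //|ns].
have [a Ea na] := skew_scalar In (minimal_sq0 Mn) ns (minimal_skew ns).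
by exists (sgval a); rewrite // -/(nval a) Ea addrC addKr.
Qed.

End Ramified.

Section Bases.
Variables (O : involutive_dvr) (A : framed_ring O) (m : nat) (h : herm_space A m).
Local Notation rad := (principal (unif A)).
Local Notation P := (primitive_vectors A m).
Implicit Types t v : 'rV[A]_m.

(** A vector with an invertible coordinate is a row of an elementary matrix. *)
Lemma in_basis_primitive t : in_basis t <-> t \in P.
Proof.
split=> [[M UM [l <-]]|/primitiveP[j Uj]].
  apply/primitiveP; apply/existsP; apply: contraT => /existsPn none.
  have : (M *m invmx M) l l = 1 by rewrite mulmxV // mxE eqxx.
  rewrite mxE => E; have : (1 : A) \in rad.
    rewrite -E ideal_sum ?rad_ideal // => r _; rewrite ideal_mulr ?rad_ideal // mem_rad.
    by have := none r; rewrite mxE.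
  by rewrite mem_rad unitr1.
pose d : 'rV[A]_m := delta_mx 0 j; pose c := t - d; pose k := t 0 j.
have cd : c *m d^T = (k - 1)%:M.
  apply/matrixP => a b; rewrite !ord1 mxE (bigD1 j) //= big1 ?addr0 => [|r rj].
    by rewrite !mxE !eqxx mulr1 mulr1n.
  by rewrite !mxE eqxx (negPf rj) mulr0.
have E : (1%:M + d^T *m c) *m (1%:M - k^-1 *: (d^T *m c)) = 1%:M.
  rewrite mulmxBr mulmx1 mulmxDl mul1mx -!scalemxAr -mulmxA (mulmxA c) cd mul_scalar_mx.
  rewrite -scalemxAr !scalerA mulrBr mulVr // mulr1 scalerBl scale1r.
  by rewrite [k^-1 *: _ + _]addrC subrK addrK.
exists (1%:M + d^T *m c); first by case/mulmx1_unit: E.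
exists j; rewrite rowE mulmxDr mulmx1 mulmxA -/d.
have -> : d *m d^T = 1%:M.
  apply/matrixP => a b; rewrite !ord1 mxE (bigD1 j) //= big1 ?addr0 => [|r rj].
    by rewrite !mxE !eqxx mulr1.
  by rewrite !mxE eqxx (negPf rj) mulr0.
by rewrite mul1mx addrC subrK.
Qed.

(** Isotropic vectors lift from the residue field. *)
Lemma anisotropic_unit t : ~ isotropic h -> t \in P -> h t t \is a GRing.unit.
Proof.
move=> aniso Pt; apply: contraT => nU; case: aniso.
have [||v vt v0] := @length_lift _ _ _ h rad t 0 (rad_ideal A) (subxx _) Pt.
- by rewrite rmorph0 mulr0.
- by rewrite sub0r ideal_opp ?rad_ideal // mem_rad.
exists v => //; apply/in_basis_primitive.
by rewrite (primitive_congr (rad_ideal A) (subxx _) vt).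
Qed.

End Bases.

Section PartA.
Variables (C : numClosedFieldType) (O : involutive_dvr) (A : framed_ring O) (m : nat).
Variables (h : herm_space A m) (i n : {set A}) (w : weil_data C h i) (T : {set 'rV[A]_m}).
Hypotheses (ii : is_ideal i) (inz : i != [set 0]) (i2 : {in i &, forall c d : A, c * d = 0}).
Hypotheses (Mn : minimal_ideal n) (Trep : orbit_representatives h (ann i) T) (m1 : (1 < m)%N).
Local Notation N := (subg_of (unitary_scalars A)).
Local Notation rad := (principal (unif A)).
Local Notation P := (primitive_vectors A m).
Implicit Types (t v : 'rV[A]_m) (phi : {ffun N -> C}).

Lemma part_a_full : ~ (exists l, [/\ kind A = RamifiedEven l, m = 2%N & ~ isotropic h]) ->
  forall phi, linear_character phi -> N_tilde w T phi.
Proof.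
move=> nexc phi Lphi; have [D SD HD] := character_form w ii i2 Lphi.
apply/(N_tildeP ii inz i2 Trep Lphi SD HD).
have [//|[hA m2 Drad aniso]] := lengths h m1 SD.
case: nexc; move: hA; case Ek: (kind A) => [|||l] // _; exists l; split=> // -[v /in_basis_primitive Pv v0].
by have := aniso v Pv; rewrite v0 unitr0.
Qed.

Section Exceptional.
Variable l : nat.
Hypotheses (kA : kind A = RamifiedEven l) (m2 : m = 2%N) (aniso : ~ isotropic h).

Let hA : hermitian_case (kind A). Proof. by rewrite kA. Qed.
Let ram : is_ramified A. Proof. exact: hermitian_ramified. Qed.
Let lenA : len A = (2 * l)%N.
Proof. by have := kindP A; rewrite kA => -[_ /nilpotency_len]. Qed.

Definition socle_trivial phi : bool :=
  [forall a : N, (sgval a \in unitary_scalars_congr n) ==> (phi a == 1)].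

(** In the exceptional case the characters that extend some alpha_t are those
    that are not trivial on the scalars congruent to 1 modulo the minimal ideal. *)
Lemma N_tilde_socle phi : linear_character phi -> N_tilde w T phi <-> ~~ socle_trivial phi.
Proof.
move=> Lphi; have [D SD HD] := character_form w ii i2 Lphi.
have [In nnz] := minimal_ideal_ideal Mn; have ni := minimal_sub Mn ii inz.
have triv : socle_trivial phi = (D \in rad).
  rewrite -(ann_minimal Mn); apply/forallP/idP => [tr|/annP Dn a].
    apply: (mu_sym_skew (w := w)) => // s ns Ss.
    have [a Ea na] := skew_scalar In (minimal_sq0 Mn) ns Ss.
    have := implyP (tr a) na; have ia : sgval a \in unitary_scalars_congr i.
      by have /setIdP[Na na'] := na; apply/setIdP; split=> //; apply: (subsetP ni).
    rewrite (HD a ia); have -> : nval a - 1 = s by rewrite Ea [1 + s]addrC addrK.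
    by rewrite mulNr muN => /eqP E; rewrite -[LHS]invrK E invr1.
  apply/implyP => na; have ia : sgval a \in unitary_scalars_congr i.
    by have /setIdP[Na na'] := na; apply/setIdP; split=> //; apply: (subsetP ni).
  have /setIdP[_ na'] := na; rewrite -/(nval a) in na'.
  by rewrite (HD a ia) mulNr mulrC Dn // oppr0 mu0.
rewrite triv; split=> [/(N_tildeP ii inz i2 Trep Lphi SD HD)[t Pt tD]|nD].
  rewrite mem_rad negbK; have := anisotropic_unit aniso Pt.
  by rewrite -(@unit_rad _ A D).
apply/(N_tildeP ii inz i2 Trep Lphi SD HD).
by have [//|[_ _ Drad _]] := lengths h m1 SD; rewrite Drad in nD.
Qed.

Lemma part_a_exceptional : let q := quotient_card (principal (pR A)) in
  (exists phi, linear_character phi /\ ~ N_tilde w T phi)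
  /\ exists2 s, enumerates s (N_tilde w T) & size s = (2 * (q ^ l - q ^ l.-1))%N.
Proof.
move=> q; have [In _] := minimal_ideal_ideal Mn; split.
  exists [ffun=> 1]; have L1 : @linear_character C N [ffun=> 1].
    by split=> [|a b]; rewrite !ffunE ?mulr1.
  split=> // /(N_tilde_socle L1); apply/negP; rewrite negbK.
  by apply/forallP => a; rewrite ffunE eqxx implybT.
have [s0 [Es0 sz0]] := @dual_exists C N (@scalarC _ _); have [us0 Ls0] := Es0.
pose K := [set a : N | sgval a \in unitary_scalars_congr n].
have KP a : (a \in K) = (sgval a \in unitary_scalars_congr n) by rewrite in_set.
have Kg : group_set K.
  apply/group_setP; split=> [|a b]; rewrite ?KP.
    exact: (@group1 _ (Group (congr_group_set In))).
  by move=> ka kb; rewrite sgvalM ?in_setT //; exact: (@groupM _ (Group (congr_group_set In)) _ _ ka kb).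
have [||s1 Es1 sz1] := @card_extensions C N (@scalarC _ _) (Group Kg) (fun=> 1) => //.
  by move=> a b _ _; rewrite mulr1.
have szt : count socle_trivial s0 = size s1.
  rewrite -size_filter; apply/perm_size/enumerates_perm; last exact: Es1.
  split=> [|phi]; first exact: filter_uniq.
  rewrite mem_filter; split=> [/andP[/forallP tr /Ls0 Lphi]|[Lphi tr]].
    by split=> // a; rewrite KP => ka; apply/eqP; exact: (implyP (tr a) ka).
  apply/andP; split; last exact/Ls0.
  by apply/forallP => a; apply/implyP => ka; apply/eqP/tr; rewrite KP.
exists [seq phi <- s0 | ~~ socle_trivial phi].
  split=> [|phi]; first exact: filter_uniq.
  rewrite mem_filter; split=> [/andP[nt /Ls0 Lphi]|Nphi]; first exact/N_tilde_socle.
  have Lphi : linear_character phi by case: Nphi => t _ [].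
  by apply/andP; split; [apply/N_tilde_socle | apply/Ls0].
have l0 : (0 < l)%N by have := len_gt1 A; rewrite lenA; case: (l).
have qF : q = #|residue_field O| by apply: quotient_card_residue.
have q0 : (0 < q)%N by rewrite qF; apply/card_gt0P; exists 0.
have cN : #|{: N}| = (2 * q ^ l)%N by rewrite cardN qF (card_norm_one ram lenA Mn).
have cK : #|K| = q by rewrite card_congr (card_minimal_scalars ram lenA Mn) qF.
have szn : (size s1 = 2 * q ^ l.-1)%N.
  rewrite sz1 -divgS ?subsetT // cardsT cN /= cK.
  by rewrite -[in (q ^ l)%N](prednK l0) expnSr mulnA mulnK.
apply/eqP; rewrite mulnBr -szn -szt -cN -sz0 -(count_predC socle_trivial s0) addKn size_filter.
by apply/eqP/eq_count.
Qed.

End Exceptional.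
End PartA.

Theorem theorem1p1 (C : numClosedFieldType) (O : involutive_dvr)
    (A : framed_ring O) (m : nat) (h : herm_space A m) (i n : {set A})
    (w : weil_data C h i) (T : {set 'rV[A]_m}) :
  (1 < m)%N ->
  is_ideal i -> i != [set 0] -> {in i &, forall a b, a * b = 0} ->
  minimal_ideal n ->
  orbit_representatives h (ann i) T ->
  let q := quotient_card (principal (pR A)) in
  let dimZ : C := sqrtC #|Uperp m i : Usub m i|%g%:R in
  (* (a) *)
  ((~ (exists l, [/\ kind A = RamifiedEven l, m = 2%N & ~ isotropic h]) ->
      forall phi, linear_character phi -> N_tilde w T phi)
   /\
   (forall l, kind A = RamifiedEven l -> m = 2%N -> ~ isotropic h ->
      (exists phi, linear_character phi /\ ~ N_tilde w T phi)
      /\ exists2 s, enumerates s (N_tilde w T)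
           & size s = (2 * (q ^ l - q ^ l.-1))%N))
  /\
  (* (b) *)
  (exists2 s, enumerates s (N_tilde w T)
     & is_mult_free_sum (Top_repr w n) s (Top_phi w n))
  /\
  (* (c) *)
  (is_direct_sum (Top_repr w n) (enum (primitive_reps T)) (ind_Wt w)
   /\ (zdim w)%:R = dimZ)
  /\
  (* (d) *)
  (forall t, t \in primitive_reps T ->
     exists s, [/\ enumerates s (extends_alpha w t),
       size s = #|unitary_scalars A : unitary_scalars_congr i|%g
     & is_mult_free_sum (ind_Wt w t) s (Top_phi w n)])
  /\
  (* (e) *)
  (forall phi, N_tilde w T phi ->
     exists t, [/\ t \in primitive_reps T,
       alpha_enters w t (Top_phi w n phi),
       (forall t', t' \in primitive_reps T ->
          alpha_enters w t' (Top_phi w n phi) -> t' = t),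
       alpha_stabilizer w t = coset_stabN h (ann i) t
     & (forall a, (scalar_of m a \in coset_stab h (ann i) t)
                  = (sgval a \in unitary_scalars_congr (ann i)))
       /\ exists rY : mx_representation C (coset_stabN h (ann i) t)
                         (\rank (Zt_eigenspace w t phi)),
          [/\ Zt_phi_extension rY,
            mx_rsim (Top_phi w n phi) (ind_GtN rY),
            mx_irreducible rY
          & (\rank (Zt_eigenspace w t phi))%:R
              = dimZ / #|unitary_scalars_congr (ann i) : unitary_scalars_congr i|%g%:R :> C]]).
Proof.
move=> m1 ii inz i2 Mn Trep q dimZ; split; first split.
- exact: part_a_full.
- by move=> l kA m2 aniso; exact: (part_a_exceptional w ii inz i2 Mn Trep m1 kA aniso).
split; first exact: part_b.
split; first by split; [apply: part_c | apply: zdim_sqrt].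
split; first by move=> t Tt; apply: part_d.
by move=> phi Nphi; apply: part_e.
Qed.
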